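(* Let $\Omega=(-1,1)$ and let $u,u',\dots,u^{(k-1)}\in\mathrm{AC}([-1,1])$ with $k\in\mathbb N$, $k\ge1$. (i) Let $\mu\in(k-1,k)$ and $\theta\in(-1,1)$, and suppose ${}^{C}\!D_{\theta+}^{\mu}u\in\mathrm{BV}([\theta,1])$ and ${}^{C}\!D_{\theta-}^{\mu}u\in\mathrm{BV}([-1,\theta])$. Put $$U_\theta^{(\mu)}:=V_{[-1,\theta]}[{}^{C}\!D_{\theta-}^{\mu}u]+V_{[\theta,1]}[{}^{C}\!D_{\theta+}^{\mu}u]+|({}^{C}\!D_{\theta-}^{\mu}u)(\theta-)|+|({}^{C}\!D_{\theta+}^{\mu}u)(\theta+)|.$$ Then, if $\mu>1/2$, for all integers $N\ge\mu$, $$\|u-\pi_N^Lu\|_{L^\infty(\Omega)}\le\frac{1}{2^{\mu-1}(\mu-1/2)\sqrt\pi}\,\frac{\Gamma((N-\mu+1)/2)}{\Gamma((N+\mu)/2)}\,U_\theta^{(\mu)},\qquad (A)$$ and for all integers $N\ge\mu$, $$\big\|(1-x^2)^{1/4}(u-\pi_N^Lu)\big\|_{L^\infty(\Omega)}\le\frac{1}{2^{\mu-1}\mu\,\pi}\,\frac{\Gamma((N-\mu+1)/2)}{\Gamma((N+\mu+1)/2)}\,U_\theta^{(\mu)}.\qquad (B)$$ (ii) If $u^{(k)}\in\mathrm{BV}([-1,1])$, then for all integers $N\ge k$ the estimates (A) and (B) hold with $\mu=k$ and with $U_\theta^{(\mu)}$ replaced by the total variation $V_{[-1,1]}[u^{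(k)}]$.
   Context: $P_n$ is the Legendre polynomial of degree $n$, $\hat u_n^L=\frac{2n+1}{2}\int_{-1}^1u(x)P_n(x)\,\mathrm dx$, and $\pi_N^Lu=\sum_{n=0}^N\hat u_n^LP_n$ is the $L^2(-1,1)$-orthogonal projection onto polynomials of degree at most $N$. $\mathrm{AC}$ and $\mathrm{BV}$ denote absolutely continuous functions and functions of bounded variation on the indicated closed interval; $V_{[c,d]}[h]$ is the total variation of $h$ on $[c,d]$; $h(c\pm)$ are one-sided limits. Fractional integrals: for $\rho>0$ and $f\in L^1(a,b)$, $(I_{a+}^\rho f)(x)=\frac1{\Gamma(\rho)}\int_a^x\frac{f(y)}{(x-y)^{1-\rho}}\,\mathrm dy$ and $(I_{b-}^\rho f)(x)=\frac1{\Gamma(\rho)}\int_x^b\frac{f(y)}{(y-x)^{1-\rho}}\,\mathrm dy$; $I^0$ is the identity. Caputo derivatives: for $\mu\in(k-1,k]$, $({}^{C}\!D_{a+}^{\mu}f)(x)=(I_{a+}^{k-\mu}f^{(k)})(x)$ and $({}^{C}\!D_{b-}^{\mu}f)(x)=(-1)^k(I_{b-}^{k-\mu}f^{(k)})(x)$. These (and $u^{(k)}$) are defined almost everywhere; saying that such a function is in BV means it agrees a.e. with a BV function, with which it is then identified. *)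

(* Defs.v *)
From HB Require Import structures.
From mathcomp Require Import all_boot all_order all_algebra.
From mathcomp Require Import all_classical all_reals all_analysis.

Set Implicit Arguments.
Unset Strict Implicit.
Unset Printing Implicit Defensive.

Import Order.TTheory GRing.Theory Num.Theory.
Import numFieldNormedType.Exports.

Local Open Scope classical_set_scope.
Local Open Scope ring_scope.

(* Euler's integral; meaningful for [0 < s] only. *)
Definition Gamma (R : realType) (s : R) : R :=
  \int[@lebesgue_measure R]_(t in `]0, +oo[) (t `^ (s - 1) * expR (- t)).

(* Rodrigues' formula, normalized by P_n(1) = 1. *)
Definition legendre (R : realType) (n : nat) : {poly R} :=
  (2 ^+ n * n`!%:R)^-1 *: derivn n (('X ^+ 2 - 1) ^+ n).

Definition legendre_coef (R : realType) (u : R -> R) (n : nat) : R :=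
  (2 * n%:R + 1) / 2 *
  \int[@lebesgue_measure R]_(x in `[-1, 1]) (u x * (legendre R n).[x]).

Definition legendre_proj (R : realType) (N : nat) (u : R -> R) : {poly R} :=
  \sum_(n < N.+1) legendre_coef u n *: legendre R n.

(* The essential supremum of |f| over ]-1, 1[: extending f by 0 outside the
   interval does not change it. *)
Definition Linfty_norm (R : realType) (f : R -> R) : \bar R :=
  Lnorm (@lebesgue_measure R) +oo%E (EFin \o (f \_ `]-1, 1[)).

Definition absolutely_continuous (R : realType) (a b : R) (f : R -> R) : Prop :=
  forall e : R, 0 < e -> exists2 d : R, 0 < d &
    forall (n : nat) (s t : 'I_n -> R),
      (forall i, a <= s i /\ s i < t i /\ t i <= b) ->
      trivIset [set: 'I_n] (fun i => `]s i, t i[%classic) ->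
      \sum_(i < n) (t i - s i) < d ->
      \sum_(i < n) `|f (t i) - f (s i)| < e.

(* f, f', ..., f^(k-1) are in AC([a, b]).  Only f itself is given at a and b:
   for 0 < j < k the derivative f^(j) has to exist at every point of ]a, b[, and
   its values at a and b are those of its continuous extension.  Derivability is
   asked for separately because derive1 is total.  f^(k) is then
   [derive1n k f], which is the genuine derivative almost everywhere in [a, b]. *)
Definition AC_derivatives (R : realType) (a b : R) (k : nat) (f : R -> R) :
    Prop :=
  absolutely_continuous a b f /\
  forall j : nat, (j.+1 < k)%N ->
    (forall x : R, a < x < b -> derivable (derive1n j f) x 1) /\
    exists2 g : R -> R, absolutely_continuous a b g &
      forall x : R, a < x < b -> g x = derive1n j.+1 f x.

Definition frac_int_left (R : realType) (a rho : R) (f : R -> R) (x : R) : R :=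
  if rho == 0 then f x else
  (Gamma rho)^-1 *
  \int[@lebesgue_measure R]_(y in `[a, x]) (f y / (x - y) `^ (1 - rho)).

Definition frac_int_right (R : realType) (b rho : R) (f : R -> R) (x : R) : R :=
  if rho == 0 then f x else
  (Gamma rho)^-1 *
  \int[@lebesgue_measure R]_(y in `[x, b]) (f y / (y - x) `^ (1 - rho)).

(* In both Caputo derivatives k is the integer with k - 1 < mu <= k. *)
Definition caputo_left (R : realType) (a : R) (k : nat) (mu : R) (f : R -> R) :
    R -> R :=
  frac_int_left a (k%:R - mu) (derive1n k f).

Definition caputo_right (R : realType) (b : R) (k : nat) (mu : R) (f : R -> R) :
    R -> R :=
  fun x => (-1) ^+ k * frac_int_right b (k%:R - mu) (derive1n k f) x.

(* h, defined almost everywhere on [a, b], is in BV([a, b]) when it has such a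
   v, with which it is then identified. *)
Definition BV_version (R : realType) (a b : R) (h v : R -> R) : Prop :=
  bounded_variation a b v /\ ae_eq (@lebesgue_measure R) `[a, b]%classic h v.

(* vl and vr are the BV versions of the two Caputo derivatives on [-1, theta]
   and [theta, 1]. *)
Definition U_theta (R : realType) (theta : R) (vl vr : R -> R) : \bar R :=
  (total_variation (-1) theta vl + total_variation theta 1 vr
   + `|lim (vl x @[x --> theta^'-])|%:E
   + `|lim (vr x @[x --> theta^'+])|%:E)%E.

(* Main.v *)
(* For n > N, integrating u P_n by parts k times leaves the integral of u^(k)
   against the k-fold integral of P_n; the semigroup property of fractional
   integration turns it, on each side of theta, into the integral of the Caputo
   derivative against the fractional integral of order mu of P_n, and one more
   integration by parts in the BV sense leaves U_theta times the maximum of the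
   fractional integral of order mu + 1 of P_n. The latter satisfies a second
   order differential equation whose Sonin function peaks at x = 0, where it is
   expressed through Gamma functions by the recurrences in n and mu. With |P_n|
   <= 1, or with Bernstein's bound for (1 - x^2)^(1/4) |P_n|, the terms of the
   Legendre series are then dominated by the increments of a telescoping
   sequence that starts at the right-hand side of the estimate. *)

Require Import Defs.
From HB Require Import structures.
From mathcomp Require Import all_boot all_order all_algebra.
From mathcomp Require Import all_classical all_reals all_analysis.
From mathcomp Require Import measurable_realfun ess_sup_inf ring lra zify.
Import Order.TTheory GRing.Theory Num.Theory.
Import numFieldNormedType.Exports.
Set Implicit Arguments.
Unset Strict Implicit.
Unset Printing Implicit Defensive.
Local Open Scope classical_set_scope.
Local Open Scope ring_scope.

Lemma FTC2_integrable {R : realType} (f F : R -> R) (a b : R) : a < b ->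
  (@lebesgue_measure R).-integrable `[a, b] (EFin \o f) ->
  {in `]a, b[, continuous f} ->
  {within `[a, b], continuous F} ->
  (forall x, x \in `]a, b[ -> is_derive x 1 F (f x)) ->
  \int[@lebesgue_measure R]_(x in `[a, b]) f x = F b - F a.
Proof.
move=> ab intf cf cF dF.
pose G x := \int[@lebesgue_measure R]_(t in `[a, x]) f t.
have cG : {within `[a, b], continuous G}.
  exact: parameterized_integral_continuous (ltW ab) intf.
have dG x : x \in `]a, b[ -> is_derive x 1 G (f x).
  move=> xab; have [ax xb] : a < x /\ x < b by move: xab; rewrite in_itv/= => /andP[].
  have [dGx G'x] := continuous_FTC1_closed xb intf ax (cf _ xab).
  by apply: DeriveDef; [exact: dGx|rewrite -derive1E].
have [x xab|x|c _] := @MVT R (F \- G) (fun=> 0) a b ab.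
- have ? := dF _ xab; have ? := dG _ xab.
  by rewrite -(subrr (f x)); exact: is_deriveB.
- by apply: continuousB; [exact: cF|exact: cG].
rewrite mul0r /= => /eqP; rewrite subr_eq0 => /eqP.
rewrite {2}/G set_itv1 Rintegral_set1 subr0 => <-.
by rewrite opprB addrC subrK.
Qed.

Lemma integrable_itv_oo_cc {R : realType} (f : R -> R) (a b : R) :
  (@lebesgue_measure R).-integrable `]a, b[ (EFin \o f) ->
  (@lebesgue_measure R).-integrable `[a, b] (EFin \o f).
Proof.
move=> /integrableP[/measurable_EFinP mf intf].
have mf1 : measurable_fun `]a, b] f by apply/measurable_fun_itv_bndo_bndcP.
have mf2 : measurable_fun `[a, b] f by apply/measurable_fun_itv_obnd_cbndP.
apply/integrableP; split; first exact/measurable_EFinP.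
rewrite -integral_itv_obnd_cbnd; last first.
  by apply: measurableT_comp => //; exact/measurable_EFinP.
by rewrite -integral_itv_bndo_bndc//; apply: measurableT_comp => //; exact/measurable_EFinP.
Qed.

Lemma ge0_FTC2_integrable {R : realType} (f F : R -> R) (a b : R) : a < b ->
  {in `]a, b[, forall x, 0 <= f x} ->
  {in `]a, b[, continuous f} ->
  {within `[a, b], continuous F} ->
  (forall x, x \in `]a, b[ -> is_derive x 1 F (f x)) ->
  (@lebesgue_measure R).-integrable `[a, b] (EFin \o f).
Proof.
move=> ab f0 cf cF dF; apply: integrable_itv_oo_cc.
have mf : measurable_fun `]a, b[ f.
  by apply: open_continuous_measurable_fun => // x; rewrite inE; exact: cf.
apply/integrableP; split; first exact/measurable_EFinP.
pose h n : R := (b - a) / n.+3%:R.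
have ba0 : 0 < b - a by rewrite subr_gt0.
have h0 n : 0 < h n by rewrite divr_gt0.
have h3 n : h n <= (b - a) / 3.
  by rewrite ler_pM2l// lef_pV2 ?posrE// ler_nat.
have ltD n : a + h n < b - h n by move: (h3 n) (h0 n); lra.
pose D n : set R := `[a + h n, b - h n]%classic.
have Dab n : D n `<=` `]a, b[.
  move=> x; rewrite /D/= !in_itv/=.
  by have := h0 n; lra.
have [M FM] : exists M : R, forall x, x \in `[a, b] -> `|F x| <= M.
  have [c _ cM] := EVT_max (ltW ab) cF.
  have [d _ dm] := EVT_min (ltW ab) cF.
  exists (`|F c| + `|F d|) => x xab.
  have := cM _ xab; have := dm _ xab.
  have := ler_norm (F c); have := ler_norm (- F d); rewrite normrN ler_norml.
  by have := normr_ge0 (F c); have := normr_ge0 (F d); lra.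
have iD n : (\int[lebesgue_measure]_(x in D n) (f x)%:E <= (2 * M)%:E)%E.
  rewrite (@continuous_FTC2 _ f F)//.
  - rewrite -EFinB lee_fin.
    have /FM : a + h n \in `[a, b] by rewrite in_itv/=; have := h3 n; have := h0 n; lra.
    have /FM : b - h n \in `[a, b] by rewrite in_itv/=; have := h3 n; have := h0 n; lra.
    by rewrite !ler_norml; lra.
  - by apply: continuous_in_subspaceT => x; rewrite inE => /Dab; exact: cf.
  - have dD x : x \in `]a, b[ -> derivable F x 1 by move=> /dF[].
    split; first by move=> x xD; apply: dD; apply: Dab; move: xD; apply: subset_itv_oo_cc.
    + apply: cvg_at_right_filter; apply: differentiable_continuous.
      apply/derivable1_diffP/dD/(Dab n); rewrite /D/= in_itv/=; have := ltD n; lra.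
    + apply: cvg_at_left_filter; apply: differentiable_continuous.
      apply/derivable1_diffP/dD/(Dab n); rewrite /D/= in_itv/=; have := ltD n; lra.
  - move=> x /subset_itv_oo_cc /Dab /dF xD; rewrite derive1E; exact: derive_val.
have UD : \bigcup_n D n = `]a, b[%classic.
  apply/seteqP; split => [x [n _ /Dab]//|x].
  rewrite /= in_itv/= => /andP[ax xb].
  pose e := Num.min (x - a) (b - x).
  have e0 : 0 < e by rewrite lt_min !subr_gt0 ax.
  have [n ne] : exists n : nat, (b - a) / e < n%:R.
    exists (Num.bound ((b - a) / e)); apply: archi_boundP.
    by rewrite divr_ge0// ltW.
  exists n => //.
  have hn : h n < e.
    rewrite /h ltr_pdivrMr// mulrC -ltr_pdivrMr// (lt_le_trans ne)// ler_nat.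
    by rewrite -addn3 leq_addr.
  move: hn; rewrite lt_min => /andP[? ?].
  by rewrite /D/= in_itv/=; lra.
rewrite -UD; apply: (@le_lt_trans _ _ (2 * M)%:E); last exact: ltry.
have -> : (\int[lebesgue_measure]_(x in \bigcup_n D n) `|(EFin \o f) x| =
    \int[lebesgue_measure]_(x in \bigcup_n D n) (f x)%:E)%E.
  by apply: eq_integral => x; rewrite UD inE => xab; rewrite /= ger0_norm//; exact: f0.
have mDf n : measurable_fun (D n) (EFin \o f).
  by apply/measurable_EFinP; apply: measurable_funS mf => //; exact: Dab.
have cvgD : (\int[lebesgue_measure]_(x in D n) (f x)%:E)%E @[n --> \oo] -->
    (\int[lebesgue_measure]_(x in \bigcup_n D n) (f x)%:E)%E.
  apply: ge0_nondecreasing_set_cvg_integral => //.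
  - move=> m n mn; apply/subsetPset => x; rewrite /D/= !in_itv/=.
    have hmn : h n <= h m.
      by rewrite /h ler_pM2l// lef_pV2 ?posrE// ler_nat !ltnS.
    by lra.
  - by move=> n; exact: measurable_itv.
  - by move=> n x /Dab; rewrite lee_fin; exact: f0.
rewrite -(cvg_lim _ cvgD)//; apply: lime_le; first by apply/cvg_ex; eexists; exact: cvgD.
exact: nearW.
Qed.

Lemma is_derive_continuous {R : realType} (f : R -> R) (x df : R) :
  is_derive x 1 f df -> {for x, continuous f}.
Proof. by move=> [dfx _]; apply/differentiable_continuous/derivable1_diffP. Qed.

Lemma powR_continuous_within {R : realType} (p b : R) : 0 < p ->
  {within `[0, b], continuous (fun t : R => t `^ p)}.
Proof.
move=> p0; have [b0|b0] := ltP 0 b; last first.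
  move: b0; rewrite le_eqVlt => /predU1P[->|b0].
    by rewrite set_itv1; exact: continuous_subspace1.
  by rewrite set_itv_ge ?bnd_simp -?ltNge//; exact: continuous_subspace0.
have cpos x : 0 < x -> {for x, continuous (fun t : R => t `^ p)}.
  by move=> x0; apply: is_derive_continuous; exact: is_derive1_powR.
apply/continuous_within_itvP => //; split.
- by move=> x; rewrite in_itv/= => /andP[x0 _]; exact: cpos.
- by rewrite powR0 ?gt_eqF//; exact: powR_cvg0.
- by apply: cvg_at_left_filter; exact: cpos.
Qed.

Lemma powR_le_expR {R : realType} (p : R) : exists2 C : R, 0 <= C &
  forall t : R, 1 <= t -> t `^ p <= C * expR (t / 2).
Proof.
pose c := 2 * (`|p| + 1); have c0 : 0 < c by rewrite mulr_gt0// ltr_pwDr.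
exists (expR (`|p| * ln c)); first exact: expR_ge0.
move=> t t1; have t0 : 0 < t by apply: lt_le_trans t1.
rewrite -expRD /powR gt_eqF// ler_expR.
have lnt0 : 0 <= ln t by rewrite ln_ge0.
apply: (@le_trans _ _ (`|p| * ln t)); first by rewrite ler_wpM2r// ler_norm.
have -> : ln t = ln (t / c) + ln c by rewrite -lnM ?posrE ?divr_gt0// divfK// gt_eqF.
rewrite mulrDr addrC lerD2l.
have h : ln (t / c) <= t / c - 1.
  have := @le_ln1Dx R (t / c - 1); rewrite (_ : 1 + (t / c - 1) = t / c); last by ring.
  by apply; rewrite ltrBrDr addNr divr_gt0.
apply: (@le_trans _ _ (`|p| * (t / c))).
  by rewrite ler_wpM2l// (le_trans h)// gerBl.
rewrite mulrA ler_pdivrMr// /c.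
by have := normr_ge0 p; lra.
Qed.

Definition gamma_integrand {R : realType} (s t : R) : R := t `^ (s - 1) * expR (- t).

Lemma measurable_gamma_integrand {R : realType} (s : R) (D : set R) :
  measurable_fun D (gamma_integrand s).
Proof.
apply: measurable_funTS; apply: measurable_funM; first exact: measurable_powR.
by apply: measurableT_comp => //; exact: measurable_expR.
Qed.

Lemma gamma_integrand_ge0 {R : realType} (s t : R) : 0 <= gamma_integrand s t.
Proof. by rewrite mulr_ge0 ?powR_ge0 ?expR_ge0. Qed.

Lemma is_derive_expR_scale {R : realType} (k x : R) :
  is_derive x 1 (fun t : R => expR (k * t)) (k * expR (k * x)).
Proof.
have h : is_derive x 1 (fun t : R => k * t) (k : R).
  have := @is_deriveZ R R^o R^o id k x 1 1 (is_derive_id x 1).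
  by rewrite /GRing.scale/= mulr1.
by rewrite mulrC; exact: (is_derive1_comp (is_derive_expR (k * x)) h).
Qed.

Lemma integral_expR_half {R : realType} (k a : R) : 0 < k ->
  (\int[@lebesgue_measure R]_(t in `[a, +oo[) (expR (- k * t))%:E =
   (expR (- k * a) / k)%:E)%E.
Proof.
move=> k0; have d (x : R) : is_derive x 1 (fun t : R => - (expR (- k * t) / k)) (expR (- k * x)).
  have -> : (fun t : R => - (expR (- k * t) / k)) = (- k^-1) *: (fun t : R => expR (- k * t)).
    by apply/funext => t; rewrite -[RHS]/(- k^-1 * expR (- k * t)) [RHS]mulNr [in RHS]mulrC.
  have -> : expR (- k * x) = - k^-1 *: (- k * expR (- k * x) : R^o).
    by rewrite /GRing.scale/= mulrA mulrNN mulVf ?gt_eqF// mul1r.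
  by apply: is_deriveZ; exact: is_derive_expR_scale.
rewrite (@ge0_continuous_FTC2y _ _ (fun t => - (expR (- k * t) / k)) _ 0)//.
- by rewrite EFinN oppeK add0e.
- apply: continuous_subspaceT => x; apply: is_derive_continuous; exact: is_derive_expR_scale.
- rewrite -oppr0 -(mul0r k^-1); apply: cvgN; apply: cvgM; last exact: cvg_cst.
  under eq_fun do rewrite mulNr.
  apply: (cvg_comp (fun t : R => k * t) (fun t => expR (- t))); last exact: cvgr_expR.
  exact: gt0_cvgMry.
- by apply: cvg_at_right_filter; exact: is_derive_continuous (d a).
- by move=> x _; rewrite derive1E; apply: derive_val.
Qed.

Lemma integrable_gamma_integrand {R : realType} (s : R) : 0 < s ->
  (@lebesgue_measure R).-integrable `]0, +oo[ (EFin \o gamma_integrand s).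
Proof.
move=> s0; apply/integrableP; split.
  by apply/measurable_EFinP; exact: measurable_gamma_integrand.
have -> : (`]0, +oo[ = `]0, 1] `|` `]1, +oo[ :> set R)%classic.
  by rewrite -itv_bndbnd_setU ?bnd_simp.
rewrite ge0_integral_setU//=; last 2 first.
- apply/measurable_EFinP; apply: measurableT_comp => //; exact: measurable_gamma_integrand.
- by apply/disj_setPS => x [/=]; rewrite !in_itv/= => h1 h2; lra.
apply: lte_add_pinfty.
- have /integrableP[_] : (@lebesgue_measure R).-integrable `[0, 1] (EFin \o (fun t : R => t `^ (s - 1))).
    apply: (@ge0_FTC2_integrable _ _ (fun t => s^-1 * t `^ s)) => //.
    + by move=> x _; exact: powR_ge0.
    + move=> x; rewrite in_itv/= => /andP[x0 _].
      by apply: is_derive_continuous; exact: is_derive1_powR.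
    + by move=> x; apply: cvgM; [exact: cvg_cst|exact: powR_continuous_within].
    + move=> x; rewrite in_itv/= => /andP[x0 _].
      have -> : x `^ (s - 1) = s^-1 *: (s * x `^ (s - 1) : R^o).
        by rewrite /GRing.scale/= mulrA mulVf ?gt_eqF// mul1r.
      apply: is_deriveZ; exact: is_derive1_powR.
  apply: le_lt_trans.
  rewrite -integral_itv_obnd_cbnd; last first.
    by apply/measurable_EFinP; apply: measurableT_comp => //; apply: measurable_funTS; exact: measurable_powR.
  apply: ge0_le_integral => //.
  + apply/measurable_EFinP; apply: measurableT_comp => //; exact: measurable_gamma_integrand.
  + apply/measurable_EFinP; apply: measurableT_comp => //; apply: measurable_funTS; exact: measurable_powR.
  + move=> x; rewrite /= in_itv/= => /andP[x0 _]; rewrite lee_fin !ger0_norm ?powR_ge0 ?gamma_integrand_ge0//.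
    by rewrite ler_piMr ?powR_ge0// -expR0 ler_expR oppr_le0 ltW.
- have [C C0 HC] := powR_le_expR (s - 1).
  apply: (@le_lt_trans _ _ (\int[lebesgue_measure]_(t in `[1%R, +oo[) (C%:E * (expR (- 2^-1 * t))%:E))%E); last first.
    rewrite ge0_integralZl//.
    + by rewrite integral_expR_half// -EFinM ltry.
    + apply/measurable_EFinP; apply: measurable_funTS; apply: measurableT_comp; first exact: measurable_expR.
      exact: mulrl_measurable.
  rewrite -integral_itv_obnd_cbnd; last first.
    apply/measurable_EFinP; apply: measurable_funTS; apply: measurable_funM => //; apply: measurableT_comp; first exact: measurable_expR.
    exact: mulrl_measurable.
  apply: ge0_le_integral => //.
  + apply/measurable_EFinP; apply: measurableT_comp => //; exact: measurable_gamma_integrand.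
  + apply/measurable_EFinP; apply: measurable_funTS; apply: measurable_funM => //; apply: measurableT_comp; first exact: measurable_expR.
    exact: mulrl_measurable.
  + move=> x; rewrite /= in_itv/= andbT => /ltW x1; rewrite -EFinM lee_fin ger0_norm ?gamma_integrand_ge0//.
    rewrite /gamma_integrand (_ : - x = x / 2 * (-1) + - 2^-1 * x); last by field.
    rewrite expRD mulrA ler_pM2r ?expR_gt0// mulrN1 expRN ler_pdivrMr ?expR_gt0//.
    exact: HC.
Qed.

Lemma integrableZl_EFin {R : realType} (D : set R) (c : R) (f : R -> R) : measurable D ->
  (@lebesgue_measure R).-integrable D (EFin \o f) ->
  (@lebesgue_measure R).-integrable D (EFin \o (fun x => c * f x)).
Proof.
move=> mD fi; have := @integrableZl _ _ _ (@lebesgue_measure R) _ mD c _ fi.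
by apply: eq_integrable.
Qed.

Lemma integrableD_EFin {R : realType} (D : set R) (f g : R -> R) : measurable D ->
  (@lebesgue_measure R).-integrable D (EFin \o f) ->
  (@lebesgue_measure R).-integrable D (EFin \o g) ->
  (@lebesgue_measure R).-integrable D (EFin \o (fun x => f x + g x)).
Proof.
move=> mD fi gi; have := @integrableD _ _ _ (@lebesgue_measure R) _ mD _ _ fi gi.
by apply: eq_integrable.
Qed.

Lemma integrableB_EFin {R : realType} (D : set R) (f g : R -> R) : measurable D ->
  (@lebesgue_measure R).-integrable D (EFin \o f) ->
  (@lebesgue_measure R).-integrable D (EFin \o g) ->
  (@lebesgue_measure R).-integrable D (EFin \o (fun x => f x - g x)).
Proof.
move=> mD fi gi; have := @integrableB _ _ _ (@lebesgue_measure R) _ mD _ _ fi gi.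
by apply: eq_integrable.
Qed.

Lemma integrable_gamma_integrand_itv {R : realType} (s b : R) : 0 < s ->
  (@lebesgue_measure R).-integrable `[0, b] (EFin \o gamma_integrand s).
Proof.
move=> s0; apply: integrable_itv_oo_cc.
apply: integrableS (integrable_gamma_integrand s0) => //.
by apply: subset_itvl; rewrite bnd_simp.
Qed.

Lemma GammaE {R : realType} (s : R) :
  Gamma s = \int[@lebesgue_measure R]_(t in `]0, +oo[) gamma_integrand s t.
Proof. by []. Qed.

Lemma cvg_Gamma {R : realType} (s : R) : 0 < s ->
  \int[@lebesgue_measure R]_(t in `[0, n%:R]) gamma_integrand s t @[n --> \oo]
    --> Gamma s.
Proof.
move=> s0.
have ind (n : nat) : (\int[@lebesgue_measure R]_(t in `]0%R, n%:R])
      (gamma_integrand s t)%:E)%E = (\int[@lebesgue_measure R]_(t in `[0, n%:R]) gamma_integrand s t)%:E.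
  rewrite /Rintegral fineK; last first.
    by apply: integrable_fin_num => //; exact: integrable_gamma_integrand_itv.
  rewrite integral_itv_obnd_cbnd//; apply/measurable_EFinP; exact: measurable_gamma_integrand.
suff H : (EFin \o (fun n : nat => \int[@lebesgue_measure R]_(t in `[0, n%:R]) gamma_integrand s t)) n
    @[n --> \oo] --> (Gamma s)%:E by exact: (fine_cvg H).
rewrite /comp; under eq_fun do rewrite -ind.
rewrite GammaE /Rintegral fineK; last first.
  by apply: integrable_fin_num => //; exact: integrable_gamma_integrand.
have -> : (`]0, +oo[ = \bigcup_n `]0, n%:R] :> set R)%classic.
  by rewrite itv_bndy_bigcup_BRight; under eq_bigcupr do rewrite add0r.
apply: ge0_nondecreasing_set_cvg_integral => //.
- move=> m n mn; apply/subsetPset; apply: subset_itvl.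
  by rewrite bnd_simp ler_nat.
- by move=> n; apply/measurable_EFinP; exact: measurable_gamma_integrand.
- by move=> n x _; rewrite lee_fin gamma_integrand_ge0.
Qed.

Lemma powR_expRN_cvg0 {R : realType} (p : R) :
  (n%:R `^ p * expR (- n%:R) : R) @[n --> \oo] --> (0 : R).
Proof.
have [C C0 HC] := powR_le_expR p.
apply: (@squeeze_cvgr _ _ _ _ (cst 0) (fun n : nat => C * expR (- (n%:R / 2)))).
- near=> n; rewrite /cst mulr_ge0 ?powR_ge0 ?expR_ge0//=.
  rewrite (_ : - n%:R = - (n%:R / 2) + - (n%:R / 2)); last by field.
  rewrite expRD mulrA ler_pM2r ?expR_gt0// expRN ler_pdivrMr ?expR_gt0//.
  by apply: HC; rewrite ler1n; near: n; exact: nbhs_infty_gt.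
- exact: cvg_cst.
- rewrite -(mulr0 C); apply: cvgM; first exact: cvg_cst.
  apply: (cvg_comp (fun n : nat => n%:R : R) (fun x => expR (- (x / 2)))); first exact: cvgr_idn.
  apply: (cvg_comp (fun x : R => x / 2) (fun x => expR (- x))); last exact: cvgr_expR.
  by apply: gt0_cvgMly => //; exact: cvg_id.
Unshelve. all: by end_near. Qed.

Lemma Gamma_ge0 {R : realType} (s : R) : 0 <= Gamma s.
Proof. by rewrite GammaE; apply: Rintegral_ge0 => t _; exact: gamma_integrand_ge0. Qed.

Lemma GammaS {R : realType} (s : R) : 0 < s -> Gamma (s + 1) = s * Gamma s.
Proof.
move=> s0; have s10 : 0 < s + 1 by rewrite ltr_wpDr.
pose I r (n : nat) := \int[@lebesgue_measure R]_(t in `[0, n%:R]) gamma_integrand r t.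
have parts (n : nat) : s * I s n - I (s + 1) n = n%:R `^ s * expR (- n%:R).
  case: n => [|n]; first by rewrite /I set_itv1 !Rintegral_set1 powR0 ?gt_eqF// mulr0 mul0r subrr.
  rewrite /I -RintegralZl//; last exact: integrable_gamma_integrand_itv.
  have i1 := integrable_gamma_integrand_itv n.+1%:R s0.
  have i2 := integrable_gamma_integrand_itv n.+1%:R s10.
  have i1' : (@lebesgue_measure R).-integrable `[0, n.+1%:R] (EFin \o (fun t => s * gamma_integrand s t)).
    exact: integrableZl_EFin.
  rewrite -RintegralB//.
  have d (x : R) : 0 < x -> is_derive x 1 (fun t : R => t `^ s * expR (- t))
     (s * gamma_integrand s x - gamma_integrand (s + 1) x).
    move=> x0; have e : is_derive x 1 (fun t : R => expR (- t)) (- expR (- x)).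
      rewrite -mulrN1; exact: (is_derive1_comp (is_derive_expR (- x)) (is_deriveNid x 1)).
    have h := @is_deriveM _ _ _ _ x 1 _ _ (is_derive1_powR s x0) e.
    rewrite /gamma_integrand addrK.
    have -> : s * (x `^ (s - 1) * expR (- x)) - x `^ s * expR (- x) =
       x `^ s *: (- expR (- x) : R^o) + expR (- x) *: (s * x `^ (s - 1) : R^o).
      by rewrite /GRing.scale/=; ring.
    exact: h.
  apply: etrans; first apply: (@FTC2_integrable _ _ (fun t : R => t `^ s * expR (- t))) => //.
  - exact: integrableB_EFin.
  - move=> x; rewrite in_itv/= => /andP[x0 _].
    have c r : {for x, continuous (gamma_integrand r)}.
      apply: cvgM; first exact: is_derive_continuous (is_derive1_powR _ x0).
      apply: continuous_comp; [exact: opp_continuous|exact: continuous_expR].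
    by apply: cvgB; [apply: cvgM; [exact: cvg_cst|exact: c]|exact: c].
  - move=> x; apply: cvgM; first exact: powR_continuous_within.
    apply: continuous_subspaceT => y; apply: continuous_comp; [exact: opp_continuous|exact: continuous_expR].
  - by move=> x; rewrite in_itv/= => /andP[x0 _]; exact: d.
  by rewrite /= (powR0 (lt0r_neq0 s0)) mul0r subr0.
have cv : s * I s n - I (s + 1) n @[n --> \oo] --> s * Gamma s - Gamma (s + 1).
  by apply: cvgB; [apply: cvgM; [exact: cvg_cst|exact: cvg_Gamma]|exact: cvg_Gamma].
have cv0 : s * I s n - I (s + 1) n @[n --> \oo] --> (0 : R).
  by under eq_fun do rewrite parts; exact: powR_expRN_cvg0.
have h : s * Gamma s - Gamma (s + 1) = 0 by exact: cvg_unique cv cv0.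
by apply/eqP; rewrite eq_sym -subr_eq0 h.
Qed.

Lemma Gamma1 {R : realType} : Gamma 1 = 1 :> R.
Proof.
rewrite GammaE /Rintegral.
rewrite integral_itv_obnd_cbnd; last by apply/measurable_EFinP; exact: measurable_gamma_integrand.
have := @integral_expR_half R 1 0 ltr01; rewrite mulr0 expR0 divr1.
under eq_integral do rewrite mulN1r.
move=> h; transitivity (fine (1%:E : \bar R)) => //; congr fine; rewrite -h.
by apply: eq_integral => x _; rewrite /gamma_integrand subrr powRr0 mul1r.
Qed.

Lemma powR_bernoulli {R : realType} (a x : R) : 0 < a -> 0 <= x <= 1 ->
  a `^ x <= 1 + x * (a - 1).
Proof.
move=> a0 /andP[x0 x1]; pose c := 1 + x * (a - 1).
have c0 : 0 < c.
  have -> : c = (1 - x) + x * a by rewrite /c; ring.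
  have [->|xn0] := eqVneq x 0; first by rewrite subr0 mul0r addr0.
  by rewrite ltr_wpDl ?subr_ge0// mulr_gt0// lt_def xn0.
have ln_le (y : R) : 0 < y -> ln y <= y - 1.
  move=> y0; have := @le_ln1Dx R (y - 1); rewrite (_ : 1 + (y - 1) = y); last by ring.
  by apply; rewrite ltrBrDr addNr.
rewrite /powR gt_eqF// -[leRHS]lnK ?posrE// ler_expR -/c.
have la : ln a - ln c <= a / c - 1 by rewrite -ln_div ?posrE//; apply: ln_le; exact: divr_gt0.
have l1 : - ln c <= c^-1 - 1 by rewrite -lnV ?posrE//; apply: ln_le; rewrite invr_gt0.
have e : x * (a / c - 1) + (1 - x) * (c^-1 - 1) = 0.
  have -> : x * (a / c - 1) + (1 - x) * (c^-1 - 1) = (1 + x * (a - 1)) / c - 1 by ring.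
  by rewrite -/c divff ?subrr// gt_eqF.
have := ler_wpM2l x0 la; have := @ler_wpM2l _ (1 - x) _ _ _ l1.
by rewrite subr_ge0 => /(_ x1); lra.
Qed.

Lemma Gamma_le {R : realType} (m x : R) : 0 < m -> 0 <= x <= 1 ->
  Gamma (m + x) <= m `^ x * Gamma m.
Proof.
move=> m0 x01; have m10 : 0 < m + 1 by rewrite ltr_wpDr.
have mx0 : 0 < m + x by case/andP: x01 => ? _; rewrite ltr_wpDr.
have i1 := integrable_gamma_integrand m0.
have i2 := integrable_gamma_integrand m10.
pose k := m `^ x * (1 - x); pose l := m `^ x * (x / m).
have il (r c : R) : 0 < r -> (@lebesgue_measure R).-integrable `]0, +oo[ (EFin \o (fun t => c * gamma_integrand r t)).
  by move=> r0; apply: integrableZl_EFin => //; exact: integrable_gamma_integrand.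
have -> : m `^ x * Gamma m = k * Gamma m + l * Gamma (m + 1).
  rewrite GammaS// /k /l; field.
  by rewrite gt_eqF.
rewrite !GammaE -!RintegralZl// -RintegralD//; [|exact: il..].
apply: le_Rintegral => //.
- exact: integrable_gamma_integrand.
- by apply: integrableD_EFin => //; exact: il.
move=> t /=; rewrite in_itv/= andbT => t0.
rewrite /gamma_integrand !mulrA -mulrDl ler_pM2r ?expR_gt0//.
have -> : t `^ (m + x - 1) = t `^ (m - 1) * t `^ x.
  by rewrite (_ : m + x - 1 = (m - 1) + x) ?powRD ?(gt_eqF t0) ?implybT//; ring.
have -> : t `^ (m + 1 - 1) = t `^ (m - 1) * t.
  rewrite (_ : m + 1 - 1 = (m - 1) + 1); last by ring.
  by rewrite powRD ?(gt_eqF t0) ?implybT// powRr1// ltW.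
have -> : t `^ x = m `^ x * (t / m) `^ x.
  by rewrite -powRM ?divr_ge0 ?(ltW m0) ?(ltW t0)// mulrC divfK// gt_eqF.
have -> : k * t `^ (m - 1) + l * (t `^ (m - 1) * t) =
    t `^ (m - 1) * (m `^ x * (1 + x * (t / m - 1))).
  by rewrite /k /l; field; rewrite gt_eqF.
by rewrite !ler_wpM2l ?powR_ge0// powR_bernoulli// divr_gt0.
Qed.

Lemma Gamma_gt0 {R : realType} (s : R) : 0 < s -> 0 < Gamma s.
Proof.
have base (r : R) : 0 < r -> r <= 1 -> 0 < Gamma r.
  move=> r0 r1; have r10 : 0 < r + 1 by rewrite ltr_wpDr.
  suff : 0 < Gamma (r + 1) by rewrite GammaS// pmulr_rgt0.
  have := @Gamma_le R (r + 1) (1 - r) r10.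
  rewrite (_ : r + 1 + (1 - r) = 1 + 1); last by ring.
  rewrite (GammaS ltr01) Gamma1 mulr1 => h.
  have {}h : 1 <= (r + 1) `^ (1 - r) * Gamma (r + 1) by apply: h; lra.
  rewrite lt_def Gamma_ge0 andbT; apply/eqP => G0.
  by move: h; rewrite G0 mulr0 ler10.
have step (n : nat) (r : R) : 0 < r -> r <= n.+1%:R -> 0 < Gamma r.
  elim: n r => [|n IH] r r0 rn; first exact: base.
  have [r1|r1] := leP r 1; first exact: base.
  rewrite -(subrK 1 r) GammaS ?subr_gt0// mulr_gt0 ?subr_gt0//.
  by apply: IH; rewrite ?subr_gt0// lerBlDr natr1.
move=> s0; apply: (step (Num.bound s)) => //.
by rewrite (le_trans (ltW (archi_boundP (ltW s0))))// ler_nat.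
Qed.

(* The conditions of the Bohr-Mollerup theorem; only the consequence of
   log-convexity that the uniqueness proof uses is kept. *)
Definition gamma_like {R : realType} (g : R -> R) :=
  [/\ forall x : R, 0 < x -> 0 < g x,
      forall x : R, 0 < x -> g (x + 1) = x * g x,
      g 1 = 1 &
      forall m x : R, 0 < m -> 0 <= x <= 1 -> g (m + x) <= (m + 1) `^ x * g m].

Lemma gamma_like_Gamma {R : realType} : gamma_like (@Gamma R).
Proof.
split; [exact: Gamma_gt0|exact: GammaS|exact: Gamma1|move=> m x m0 x01].
apply: (le_trans (Gamma_le m0 x01)); rewrite ler_wpM2r ?Gamma_ge0//.
case/andP: x01 => x0 _.
by rewrite ge0_ler_powR// ?nnegrE ?lerDl// ?addr_ge0 ?ltW.
Qed.

Lemma gamma_like_le {R : realType} (g h : R -> R) : gamma_like g -> gamma_like h ->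
  forall x, 0 < x -> g x <= h x.
Proof.
move=> [g0 gS g1 gle] [h0 hS h1 hle].
have gh (n : nat) : g n.+1%:R = h n.+1%:R.
  elim: n => [|n IH]; first by rewrite g1 h1.
  by rewrite -natr1 gS// hS// IH.
have base (x : R) : 0 < x -> x <= 1 -> g x <= h x.
  move=> x0 x1.
  have rat (n : nat) : g (x + n%:R) * h x = h (x + n%:R) * g x.
    elim: n => [|n IH]; first by rewrite !addr0 mulrC.
    have xn : 0 < x + n%:R by rewrite ltr_wpDr.
    by rewrite -natr1 addrA gS// hS// -!mulrA IH.
  have bound (n : nat) : n.+1%:R * g x <= n.+3%:R * h x.
    have n0 : 0 < n.+1%:R :> R by [].
    have xn : 0 < x + n.+1%:R by rewrite ltr_wpDr.
    have e1 : g (x + n.+1%:R) <= n.+3%:R `^ x * h n.+1%:R.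
      rewrite addrC (le_trans (gle _ _ n0 _)) ?(ltW x0)// gh ler_wpM2r ?(ltW (h0 _ n0))//.
      by rewrite ge0_ler_powR ?(ltW x0) ?nnegrE// natr1 ler_nat.
    have e2 : n.+1%:R * h n.+1%:R <= n.+3%:R `^ (1 - x) * h (x + n.+1%:R).
      have := hle (x + n.+1%:R) (1 - x) xn.
      rewrite (_ : x + n.+1%:R + (1 - x) = n.+1%:R + 1); last by ring.
      rewrite hS// => /(_ _) H; apply: (le_trans (H _)); first by lra.
      rewrite ler_wpM2r ?(ltW (h0 _ xn))// ge0_ler_powR ?nnegrE ?subr_ge0//.
        by rewrite addr_ge0// ltW.
      by rewrite -addrA natr1 -(natr1 n.+2) addrC lerD2l.
    have e3 : n.+3%:R `^ x * n.+3%:R `^ (1 - x) = n.+3%:R :> R.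
      rewrite -powRD; last by rewrite (@gt_eqF _ _ n.+3%:R)// implybT.
      by rewrite addrC subrK powRr1.
    rewrite -(ler_pM2l (h0 _ xn)) mulrCA -rat mulrCA mulrA [leRHS]mulrA ler_pM2r ?h0//.
    rewrite [leLHS]mulrC (le_trans (ler_wpM2l (ltW n0) e1))//.
    apply: (@le_trans _ _ (n.+3%:R `^ x * (n.+3%:R `^ (1 - x) * h (x + n.+1%:R)))).
      by rewrite mulrCA ler_pM2l ?powR_gt0.
    by rewrite mulrA e3 mulrC.
  rewrite leNgt; apply/negP => hg; have d0 : 0 < g x - h x by rewrite subr_gt0.
  have := archi_boundP (divr_ge0 (mulr_ge0 (ler0n _ 2) (ltW (h0 _ x0))) (ltW d0) : 0 <= 2 * h x / (g x - h x)).
  set n := Num.bound _ => hn; have := bound n.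
  have : 2 * h x < n%:R * (g x - h x) by rewrite -ltr_pdivrMr.
  rewrite -(natr1 n.+2) -(natr1 n.+1) -(natr1 n); nra.
have step (n : nat) (r : R) : 0 < r -> r <= n.+1%:R -> g r <= h r.
  elim: n r => [|n IH] r r0 rn; first exact: base.
  have [r1|r1] := leP r 1; first exact: base.
  have r10 : 0 < r - 1 by rewrite subr_gt0.
  rewrite -(subrK 1 r) gS// hS// ler_pM2l//.
  by apply: IH => //; rewrite lerBlDr natr1.
move=> s s0; apply: (step (Num.bound s)) => //.
by rewrite (le_trans (ltW (archi_boundP (ltW s0))))// ler_nat.
Qed.

Lemma gamma_like_Gamma_eq {R : realType} (g : R -> R) : gamma_like g ->
  forall x, 0 < x -> g x = Gamma x.
Proof.
move=> gg x x0; apply/eqP; rewrite eq_le.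
by rewrite !gamma_like_le//; exact: gamma_like_Gamma.
Qed.

Lemma Gamma_duplication {R : realType} (s : R) : 0 < s ->
  Gamma s * Gamma 2^-1 = 2 `^ (s - 1) * Gamma (s / 2) * Gamma ((s + 1) / 2).
Proof.
move=> s0; have h0 : 0 < Gamma (2^-1 : R) by rewrite Gamma_gt0.
suff <- : 2 `^ (s - 1) * Gamma (s / 2) * Gamma ((s + 1) / 2) / Gamma 2^-1 = Gamma s.
  by rewrite mulfVK// gt_eqF.
move: s s0; apply: gamma_like_Gamma_eq; split.
- by move=> x x0; rewrite !mulr_gt0 ?powR_gt0 ?Gamma_gt0 ?divr_gt0 ?invr_gt0 ?addr_gt0.
- move=> x x0; rewrite (_ : (x + 1 + 1) / 2 = x / 2 + 1); last by field.
  rewrite GammaS ?divr_gt0// (_ : x + 1 - 1 = (x - 1) + 1); last by ring.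
  rewrite powRD; last by rewrite (@gt_eqF _ _ 2)// implybT.
  rewrite powRr1//; move: (Gamma 2^-1) h0 (Gamma (x / 2)) (Gamma ((x + 1) / 2)) => a a0 b c.
  by move: (2 `^ (x - 1)) => p; field; exact: lt0r_neq0.
- rewrite subrr powRr0 mul1r (_ : (1 + 1) / 2 = 1); last by field.
  by rewrite Gamma1 mulr1 mul1r divff// gt_eqF.
- move=> m x m0 x01; rewrite mulrA ler_pM2r ?invr_gt0//.
  case/andP: (x01) => x0 x1.
  have m20 : 0 < m / 2 by rewrite divr_gt0.
  have m120 : 0 < (m + 1) / 2 by rewrite divr_gt0// addr_gt0.
  have x2 : 0 <= x / 2 <= 1 by rewrite divr_ge0//=; lra.
  have h1 := Gamma_le m20 x2; have h2 := Gamma_le m120 x2.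
  rewrite (_ : m + x - 1 = (m - 1) + x); last by ring.
  rewrite powRD; last by rewrite (@gt_eqF _ _ 2)// implybT.
  rewrite (_ : (m + x) / 2 = m / 2 + x / 2); last by ring.
  rewrite (_ : (m + x + 1) / 2 = (m + 1) / 2 + x / 2); last by ring.
  have gen (A B G1 G2 g1 g2 p1 p2 M : R) : 0 <= A -> 0 <= B -> 0 <= G1 -> 0 <= G2 ->
      0 <= g1 -> 0 <= g2 -> G1 <= p1 * g1 -> G2 <= p2 * g2 -> B * (p1 * p2) <= M ->
      A * B * G1 * G2 <= M * (A * g1 * g2).
    move=> A0 B0 G10 G20 g10 g20 l1 l2 l3.
    apply: (@le_trans _ _ (A * B * ((p1 * g1) * (p2 * g2)))).
      by rewrite -mulrA ler_wpM2l ?mulr_ge0// ler_pM.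
    have -> : A * B * (p1 * g1 * (p2 * g2)) = B * (p1 * p2) * (A * g1 * g2) by ring.
    by rewrite ler_wpM2r ?mulr_ge0.
  apply: gen h1 h2 _; rewrite ?powR_ge0 ?Gamma_ge0//.
  apply: (@le_trans _ _ (2 `^ x * (((m + 1) / 2) `^ (x / 2) * ((m + 1) / 2) `^ (x / 2)))).
    rewrite ler_pM2l ?powR_gt0// ler_wpM2r ?powR_ge0//.
    have ? := ltW m20; have ? := ltW m120.
    by rewrite ge0_ler_powR ?nnegrE ?(proj1 (andP x2))//; lra.
  rewrite -powRD; last by rewrite (@gt_eqF _ _ ((m + 1) / 2))// implybT.
  rewrite -splitr -powRM//; last exact: ltW.
  by rewrite mulrC divfK.
Qed.

Section pointwise_derivatives.
Context {R : realType}.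
Implicit Types (f g : R -> R) (x d e c : R).

(* [is_derive] behind a definition, so that type class resolution does not
   interfere with goal-directed computation of derivatives. *)
Definition has_derivative (f : R -> R) (x d : R) : Prop := is_derive x 1 f d.

Lemma has_derivative_eq f x d e : has_derivative f x d -> d = e -> has_derivative f x e.
Proof. by move=> fd <-. Qed.

Lemma has_derivative_id x : has_derivative (fun t : R => t) x 1.
Proof. exact: is_derive_id. Qed.

Lemma has_derivative_cst x c : has_derivative (fun _ : R => c) x 0.
Proof. exact: is_derive_cst. Qed.

Lemma has_derivativeD f g x d e : has_derivative f x d -> has_derivative g x e ->
  has_derivative (fun t => f t + g t) x (d + e).
Proof. by move=> fd ge; exact: (@is_deriveD _ _ _ f g x 1 _ _ fd ge). Qed.

Lemma has_derivativeN f x d : has_derivative f x d -> has_derivative (fun t => - f t) x (- d).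
Proof. by move=> fd; exact: (@is_deriveN _ _ _ f x 1 _ fd). Qed.

Lemma has_derivativeM f g x d e : has_derivative f x d -> has_derivative g x e ->
  has_derivative (fun t => f t * g t) x (d * g x + f x * e).
Proof.
move=> fd ge; apply: has_derivative_eq; first exact: (@is_deriveM _ _ f g x 1 _ _ fd ge).
by rewrite /GRing.scale/= addrC mulrC.
Qed.

Lemma has_derivativeX f n x d : has_derivative f x d ->
  has_derivative (fun t => f t ^+ n) x (n%:R * f x ^+ n.-1 * d).
Proof.
move=> fd; elim: n => [|n IH].
  by apply: has_derivative_eq; [exact: has_derivative_cst|rewrite /= !mul0r].
under eq_fun do rewrite exprS.
apply: has_derivative_eq; first exact: has_derivativeM fd IH.
by case: n {IH} => [|n]; rewrite /= ?exprS -?natr1; ring.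
Qed.

Lemma has_derivative_comp f g x d e : has_derivative f (g x) d -> has_derivative g x e ->
  has_derivative (fun t => f (g t)) x (d * e).
Proof. exact: is_derive1_comp. Qed.

Lemma has_derivative_cos f x d : has_derivative f x d ->
  has_derivative (fun t => cos (f t)) x (- sin (f x) * d).
Proof. by move=> fd; exact: (has_derivative_comp (is_derive_cos _) fd). Qed.

Lemma has_derivative_sin f x d : has_derivative f x d ->
  has_derivative (fun t => sin (f t)) x (cos (f x) * d).
Proof. by move=> fd; exact: (has_derivative_comp (is_derive_sin _) fd). Qed.

Lemma has_derivative_powR f p x d : 0 < f x -> has_derivative f x d ->
  has_derivative (fun t => f t `^ p) x (p * f x `^ (p - 1) * d).
Proof. by move=> fx0 fd; exact: (@has_derivative_comp (fun t => t `^ p) _ _ _ _ (is_derive1_powR p fx0) fd). Qed.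

Lemma has_derivativeV f x d : f x != 0 -> has_derivative f x d ->
  has_derivative (fun t => (f t)^-1) x (- d / f x ^+ 2).
Proof.
move=> fx0 [fd fdE]; apply: DeriveDef; first exact: derivableV.
by rewrite deriveV// fdE /GRing.scale/= !mulNr mulrC.
Qed.

Lemma ge0_derive_le (f df : R -> R) (a b : R) : a <= b ->
  {within `[a, b], continuous f} ->
  (forall x, a < x < b -> has_derivative f x (df x)) ->
  (forall x, a < x < b -> 0 <= df x) -> f a <= f b.
Proof.
rewrite le_eqVlt => /predU1P[->//|ab] cf dF df0.
have dF' x : x \in `]a, b[ -> is_derive x 1 f (df x) by rewrite in_itv/=; exact: dF.
have [c cab fba] := @MVT R f df a b ab dF' cf.
by rewrite -subr_ge0 fba mulr_ge0 ?subr_ge0 ?(ltW ab)// df0.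
Qed.

Lemma is_derive_continuousT (f df : R -> R) :
  (forall x, has_derivative f x (df x)) -> continuous f.
Proof. by move=> dF x; exact: (@is_derive_continuous _ _ _ _ (dF x)). Qed.

End pointwise_derivatives.

Ltac solve_derivative := repeat first
  [ assumption | exact: has_derivative_id | exact: has_derivative_cst | apply: has_derivativeD | apply: has_derivativeN
  | apply: has_derivativeM | apply: has_derivativeX | apply: has_derivative_cos | apply: has_derivative_sin ].

Lemma continuousT_integrable {R : realType} (f : R -> R) (a b : R) : continuous f ->
  (@lebesgue_measure R).-integrable `[a, b] (EFin \o f).
Proof.
move=> cf; apply: continuous_compact_integrable; first exact: segment_compact.
exact: continuous_subspaceT.
Qed.

Lemma FTC2_continuousT {R : realType} (f F : R -> R) (a b : R) : a < b ->
  continuous f -> (forall x, has_derivative F x (f x)) ->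
  \int[@lebesgue_measure R]_(x in `[a, b]) f x = F b - F a.
Proof.
move=> ab cf dF; apply: FTC2_integrable => //.
- exact: continuousT_integrable.
- by apply: continuous_subspaceT; exact: is_derive_continuousT dF.
- by move=> x _; exact: dF.
Qed.

Section trigonometric_bounds.
Context {R : realType}.

Lemma sin_le_id (x : R) : 0 <= x -> sin x <= x.
Proof.
move=> x0; have d (t : R) : has_derivative (fun t : R => t - sin t) t (1 - cos t).
  by apply: has_derivative_eq; [solve_derivative|ring].
have := @ge0_derive_le R (fun t => t - sin t) (fun t => 1 - cos t) 0 x x0.
rewrite sin0 subr0 subr_ge0; apply.
- exact: continuous_subspaceT (is_derive_continuousT d).
- by move=> t _; exact: d.
- by move=> t _; rewrite subr_ge0 cos_le1.
Qed.

Lemma cos_ge_quadratic (x : R) : 0 <= x -> 1 - x ^+ 2 / 2 <= cos x.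
Proof.
move=> x0; have d (t : R) : has_derivative (fun t : R => cos t + t ^+ 2 * 2^-1) t (t - sin t).
  by apply: has_derivative_eq; [solve_derivative|rewrite /=; field].
have := @ge0_derive_le R (fun t => cos t + t ^+ 2 * 2^-1) (fun t => t - sin t) 0 x x0.
rewrite cos0 expr0n/= mul0r addr0 lerBlDr; apply.
- exact: continuous_subspaceT (is_derive_continuousT d).
- by move=> t _; exact: d.
- by move=> t /andP[t0 _]; rewrite subr_ge0 sin_le_id// ltW.
Qed.

Lemma mulr_cos_le_sin (x : R) : 0 <= x <= pi -> x * cos x <= sin x.
Proof.
move=> /andP[x0 xpi]; have d (t : R) : has_derivative (fun t : R => sin t - t * cos t) t (t * sin t).
  by apply: has_derivative_eq; [solve_derivative|rewrite /=; ring].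
have := @ge0_derive_le R (fun t => sin t - t * cos t) (fun t => t * sin t) 0 x x0.
rewrite sin0 mul0r subrr subr_ge0; apply.
- exact: continuous_subspaceT (is_derive_continuousT d).
- by move=> t _; exact: d.
- move=> t /andP[t0 tx]; rewrite mulr_ge0 ?sin_ge0_pi ?(ltW t0)//.
  by rewrite (le_trans (ltW tx)).
Qed.

Definition cos_moment (z : R) (m : nat) : R :=
  \int[@lebesgue_measure R]_(x in `[0, pi / 2]) (cos (z * x) * cos x ^+ (2 * m)%N).

Lemma continuous_cos_moment (z : R) (n : nat) : continuous (fun x : R => cos (z * x) * cos x ^+ n).
Proof.
by apply: is_derive_continuousT => x; solve_derivative.
Qed.

Lemma cos_moment_rec (z : R) (m : nat) :
  (4 * m.+1%:R ^+ 2 - z ^+ 2) * cos_moment z m.+1 =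
  2 * m.+1%:R * (2 * m.+1%:R - 1) * cos_moment z m.
Proof.
have pi2 : 0 < pi / 2 :> R by rewrite divr_gt0 ?pi_gt0.
pose a : R := 4 * m.+1%:R ^+ 2 - z ^+ 2.
pose b : R := 2 * m.+1%:R * (2 * m.+1%:R - 1).
pose f (x : R) := a * (cos (z * x) * cos x ^+ (2 * m.+1)) - b * (cos (z * x) * cos x ^+ (2 * m)).
pose F (x : R) := - z * sin (z * x) * cos x ^+ (2 * m.+1)
  + (2 * m.+1%:R) * (cos (z * x) * (cos x ^+ (2 * m.+1).-1 * sin x)).
have i n : (@lebesgue_measure R).-integrable `[0, pi / 2] (EFin \o (fun x : R => cos (z * x) * cos x ^+ n)).
  by apply: continuousT_integrable; exact: continuous_cos_moment.
apply/eqP; rewrite -subr_eq0 -/a -/b /cos_moment -!RintegralZl//.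
rewrite -RintegralB//; [|exact: integrableZl_EFin..].
apply/eqP; apply: etrans; first apply: (@FTC2_continuousT _ f F).
- exact: pi2.
- by move=> x; apply: cvgB; (apply: cvgM; [exact: cvg_cst|exact: continuous_cos_moment]).
- move=> x; apply: has_derivative_eq; first by rewrite /F; solve_derivative.
  have e : (2 * m.+1)%N = (2 * m).+2 by lia.
  rewrite /f e /= /a /b.
  have -> : (2 * m).+2%:R = 2 * m.+1%:R :> R by rewrite -e natrM.
  have -> : (2 * m).+1%:R = 2 * m.+1%:R - 1 :> R.
    by rewrite -natrM e -[in RHS]natr1 addrK.
  have s2 : sin x * sin x = 1 - cos x * cos x by have := cos2Dsin2 x; rewrite !expr2; lra.
  have -> : cos x ^+ (2 * m).+2 = cos x * cos x * cos x ^+ (2 * m) by rewrite !exprS mulrA.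
  have -> : cos x ^+ (2 * m).+1 = cos x * cos x ^+ (2 * m) by rewrite exprS.
  move: (cos x ^+ (2 * m)) (cos (z * x)) (sin (z * x)) (m.+1%:R : R) s2 => C A S M.
  move: (cos x) (sin x) => c s s2.
  transitivity (A * C * (2 * M * (2 * M) * (c * c) - z * z * (c * c) - (2 * M) * (2 * M - 1) * (s * s + c * c))); last first.
    by rewrite s2; ring.
  ring.
- rewrite /F cos_pihalf (_ : (2 * m.+1)%N = (2 * m).+2); last by lia.
  by rewrite /= !exprS !(mulr0, mul0r, sin0, addr0, subrr).
Qed.

End trigonometric_bounds.

Section reflection.
Context {R : realType}.
Implicit Types (w z : R) (m : nat).

Let pi2 : 0 < pi / 2 :> R. Proof. by rewrite divr_gt0 ?pi_gt0. Qed.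

Let icos z n : (@lebesgue_measure R).-integrable `[0, pi / 2]
  (EFin \o (fun x : R => cos (z * x) * cos x ^+ n)).
Proof. by apply: continuousT_integrable; exact: continuous_cos_moment. Qed.

Let cos_itv_ge0 (x : R) : x \in `[0, pi / 2] -> 0 <= cos x.
Proof.
rewrite in_itv/= => /andP[x0 x1]; apply: cos_ge0_pihalf; rewrite x1 andbT.
by rewrite (le_trans _ x0)// oppr_le0 ltW.
Qed.

Lemma cos_moment0_0 : cos_moment 0 0 = pi / 2 :> R.
Proof.
rewrite /cos_moment (@eq_Rintegral _ _ _ _ _ (cst 1)); last first.
  by move=> x _; rewrite mul0r cos0 muln0 expr0 mulr1.
by rewrite Rintegral_cst//= lebesgue_measure_itv/= lte_fin pi2 mul1r /= subr0.
Qed.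

Lemma cos_moment_0 z : z * cos_moment z 0 = sin (z * (pi / 2)).
Proof.
rewrite /cos_moment -RintegralZl//.
transitivity (sin (z * (pi / 2)) - sin (z * 0)); last by rewrite mulr0 sin0 subr0.
apply: (@FTC2_continuousT _ _ (fun x => sin (z * x))) => [|x|x].
- exact: pi2.
- by apply: cvgM; [exact: cvg_cst|exact: continuous_cos_moment].
- by apply: has_derivative_eq; [solve_derivative|rewrite muln0 expr0 /=; ring].
Qed.

Lemma cos_moment0_gt0 m : 0 < cos_moment (0 : R) m.
Proof.
elim: m => [|m IH]; first by rewrite cos_moment0_0.
have := cos_moment_rec (0 : R) m; rewrite expr0n/= subr0 => h.
have m0 : 0 < m.+1%:R :> R by [].
have m1 : 1 <= m.+1%:R :> R by rewrite ler1n.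
have : 0 < 4 * m.+1%:R ^+ 2 * cos_moment (0 : R) m.+1.
  by rewrite h !mulr_gt0//; lra.
by rewrite pmulr_rgt0// mulr_gt0// exprn_gt0.
Qed.

Lemma cos_moment_le z m : cos_moment z m <= cos_moment 0 m.
Proof.
apply: le_Rintegral => // x xI; rewrite mul0r cos0 mul1r.
by rewrite ler_piMl ?cos_le1// exprn_ge0// cos_itv_ge0.
Qed.

Lemma cos_moment_ge z m : 0 <= z ->
  (1 - z ^+ 2 / (2 * (2 * m.+1%:R - 1))) * cos_moment 0 m.+1 <= cos_moment z m.+1.
Proof.
move=> z0.
have m1 : 1 <= m.+1%:R :> R by rewrite ler1n.
have mn0 : 2 * m.+1%:R - 1 != 0 :> R by rewrite gt_eqF//; lra.
have E : cos_moment (0 : R) m = cos_moment 0 m.+1 * (1 + 1 / (2 * m.+1%:R - 1)).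
  have := cos_moment_rec (0 : R) m; rewrite expr0n/= subr0 => h.
  have k0 : 2 * m.+1%:R * (2 * m.+1%:R - 1) != 0 :> R by rewrite mulf_neq0.
  apply: (mulfI k0); rewrite -h; field.
  by apply/eqP => h0; move: mn0; rewrite -h0; apply/negP/negPn/eqP; ring.
have -> : (1 - z ^+ 2 / (2 * (2 * m.+1%:R - 1))) * cos_moment 0 m.+1 =
    (1 + z ^+ 2 / 2) * cos_moment 0 m.+1 - z ^+ 2 / 2 * cos_moment 0 m.
  rewrite E; field.
  by apply/eqP => h0; move: mn0; rewrite -h0; apply/negP/negPn/eqP; ring.
rewrite /cos_moment -!RintegralZl// -RintegralB//; [|exact: integrableZl_EFin..].
apply: le_Rintegral => //.
  by apply: integrableB_EFin => //; exact: integrableZl_EFin.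
move=> x xI; rewrite mul0r cos0 !mul1r.
have x0 : 0 <= x by move: xI; rewrite /= in_itv/= => /andP[].
have c0 := cos_itv_ge0 xI.
have xpi : 0 <= x <= pi.
  by move: xI; rewrite /= in_itv/= => /andP[-> /le_trans]; apply; have := pi_gt0 R; lra.
have -> : (2 * m.+1)%N = (2 * m).+2 by lia.
have cC : 0 <= cos x ^+ (2 * m) by rewrite exprn_ge0.
have zx0 : 0 <= z * x by rewrite mulr_ge0.
have h1 := cos_ge_quadratic zx0; have h2 := mulr_cos_le_sin xpi.
have h3 : (x * cos x) ^+ 2 <= sin x ^+ 2 by rewrite ler_sqr ?nnegrE ?mulr_ge0// sin_ge0_pi.
have h4 := cos2Dsin2 x.
rewrite !exprS; move: (cos x ^+ (2 * m)) cC => C C0.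
have h5 : (1 - (z * x) ^+ 2 / 2) * (cos x * (cos x * C)) <= cos (z * x) * (cos x * (cos x * C)).
  by rewrite ler_wpM2r ?mulr_ge0.
apply: le_trans h5.
have h6 : (x * cos x) ^+ 2 * (z ^+ 2 / 2 * C) <= sin x ^+ 2 * (z ^+ 2 / 2 * C).
  by rewrite ler_wpM2r ?mulr_ge0 ?sqr_ge0.
have s2 : sin x ^+ 2 = 1 - cos x ^+ 2 by lra.
rewrite s2 in h6; rewrite expr0 mulr1; lra.
Qed.

Lemma cos_moment_Gamma w m : 0 <= w < 1 ->
  cos_moment (2 * w) m * (Gamma (m.+1%:R + w) * Gamma (m.+1%:R - w)) * cos_moment 0 0
  = cos_moment (2 * w) 0 * (Gamma (1 + w) * Gamma (1 - w)) * (cos_moment 0 m * Gamma m.+1%:R ^+ 2).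
Proof.
move=> /andP[w0 w1]; have m0 (n : nat) : 0 < n.+1%:R :> R by [].
have a0 (n : nat) : 0 < n.+1%:R + w by rewrite ltr_wpDr.
have b0 (n : nat) : 0 < n.+1%:R - w by rewrite subr_gt0 (lt_le_trans w1)// ler1n.
elim: m => [|m IH].
  by rewrite Gamma1 expr1n mulr1.
have m1 : 1 <= m.+1%:R :> R by rewrite ler1n.
have h1 := cos_moment_rec (2 * w) m; have h2 := cos_moment_rec (0 : R) m.
rewrite -(natr1 m.+1).
have -> : m.+1%:R + 1 + w = (m.+1%:R + w) + 1 by ring.
have -> : m.+1%:R + 1 - w = (m.+1%:R - w) + 1 by ring.
rewrite (GammaS (a0 m)) (GammaS (b0 m)) (GammaS (m0 m)).
move: IH; move: (Gamma (m.+1%:R + w)) (Gamma (m.+1%:R - w)) (Gamma m.+1%:R) (Gamma (1 + w)) (Gamma (1 - w)) => g1 g2 g3 g4 g5.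
move: h1 h2 (cos_moment (2 * w) 0) (cos_moment 0 0).
move: (cos_moment (2 * w) m.+1) (cos_moment 0 m.+1) (cos_moment (2 * w) m) (cos_moment 0 m).
move: (m.+1%:R : R) => M I1 J1 I J h1 h2 I0 J0 IH.
have e1 : I1 * ((M + w) * (M - w)) = 2 * M * (2 * M - 1) * I / 4 by rewrite -h1; field.
have e2 : J1 * M ^+ 2 = 2 * M * (2 * M - 1) * J / 4 by rewrite -h2; field.
transitivity (I1 * ((M + w) * (M - w)) * (g1 * g2 * J0)); first by ring.
transitivity (I0 * (g4 * g5) * g3 ^+ 2 * (J1 * M ^+ 2)); last by ring.
rewrite e1 e2.
transitivity (2 * M * (2 * M - 1) / 4 * (I * (g1 * g2) * J0)); first by ring.
by rewrite IH; ring.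
Qed.

End reflection.

Lemma le_of_inv_nat {R : realType} (x y K : R) :
  (forall n : nat, x <= y + K / n.+1%:R) -> x <= y.
Proof.
move=> h; rewrite leNgt; apply/negP => yx; have d0 : 0 < x - y by rewrite subr_gt0.
have := archi_boundP (normr_ge0 (K / (x - y))); set n := Num.bound _ => hn.
have n0 : 0 < n.+1%:R :> R by [].
have := h n; rewrite -lerBlDl ler_pdivlMr//.
apply/negP; rewrite -ltNge mulrC -ltr_pdivrMr//.
by rewrite (le_lt_trans (ler_norm _))// (lt_trans hn)// ltr_nat.
Qed.

Lemma Gamma_reflection {R : realType} (w : R) : 0 <= w < 1 ->
  sin (pi * w) * (Gamma (1 + w) * Gamma (1 - w)) = pi * w.
Proof.
move=> w01; have /andP[w0 w1] := w01.
pose c := cos_moment (2 * w) 0 * (Gamma (1 + w) * Gamma (1 - w)).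
pose J : R := cos_moment 0 0.
have J0 : 0 < J := cos_moment0_gt0 0.
suff cJ : c = J.
  have := cos_moment_0 (2 * w); rewrite (_ : 2 * w * (pi / 2) = pi * w); last by field.
  move=> <-; rewrite -mulrA -/c cJ /J cos_moment0_0; by field.
have facts (n : nat) : let m : R := n.+1%:R in
    let G := Gamma n.+2%:R in let g1 := Gamma (n.+2%:R + w) in let g2 := Gamma (n.+2%:R - w) in
    [/\ 0 < G, 0 < g1 * g2, m * (g1 * g2) <= (m + 1) * G ^+ 2 & (m + 1) * G ^+ 2 <= (m + 2) * (g1 * g2)].
  move=> m G g1 g2.
  have m1 : 1 <= m by rewrite /m ler1n.
  have m0 : 0 < m by [].
  have mE : n.+2%:R = m + 1 by rewrite natr1.
  have w01' : 0 <= 1 - w <= 1 by apply/andP; split; lra.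
  have w01'' : 0 <= w <= 1 by rewrite w0 ltW.
  have a0 : 0 < m + 1 + w by lra.
  have b0 : 0 < m + 1 - w by lra.
  have m10 : 0 < m + 1 by lra.
  have G0 : 0 < G by apply: Gamma_gt0.
  have g10 : 0 < g1 by apply: Gamma_gt0; rewrite mE.
  have g20 : 0 < g2 by apply: Gamma_gt0; rewrite mE.
  have GE : G = m * Gamma m by rewrite /G mE GammaS.
  have u1 : g1 <= (m + 1) `^ w * G by rewrite /g1 /G mE; exact: Gamma_le.
  have u2 : g2 <= m `^ (1 - w) * Gamma m.
    by rewrite /g2 mE (_ : m + 1 - w = m + (1 - w)); [exact: Gamma_le|ring].
  have l1 : G <= (m + 1 - w) `^ w * g2.
    have := Gamma_le b0 w01''; rewrite subrK /G /g2 mE; exact.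
  have l2 : (m + 1) * G <= (m + 1 + w) `^ (1 - w) * g1.
    have := Gamma_le a0 w01'; rewrite (_ : m + 1 + w + (1 - w) = (m + 1) + 1); last by ring.
    by rewrite (GammaS m10) /G /g1 mE; exact.
  have P1 : (m + 1) `^ w * m `^ (1 - w) <= m + 1.
    apply: (@le_trans _ _ ((m + 1) `^ w * (m + 1) `^ (1 - w))).
      rewrite ler_wpM2l ?powR_ge0// ge0_ler_powR ?nnegrE ?(ltW m0) ?(ltW m10)//; first by lra.
      by rewrite lerDl.
    rewrite -powRD; last by rewrite (gt_eqF m10) implybT.
    by rewrite addrCA subrr addr0 powRr1// ltW.
  have P2 : (m + 1 + w) `^ (1 - w) * (m + 1 - w) `^ w <= m + 2.
    have m20 : 0 < m + 2 by lra.
    apply: (@le_trans _ _ ((m + 2) `^ (1 - w) * (m + 2) `^ w)).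
      have le1 : m + 1 + w <= m + 2 by lra.
      have le2 : m + 1 - w <= m + 2 by lra.
      have le3 : 0 <= 1 - w by lra.
      by rewrite ler_pM ?powR_ge0// ge0_ler_powR ?nnegrE ?(ltW m20) ?(ltW a0) ?(ltW b0).
    rewrite -powRD; last by rewrite (gt_eqF m20) implybT.
    by rewrite subrK powRr1// ltW.
  move: P1 P2; move: ((m + 1) `^ w) (m `^ (1 - w)) ((m + 1 + w) `^ (1 - w)) ((m + 1 - w) `^ w) u1 u2 l1 l2 => p1 p2 p3 p4 u1 u2 l1 l2 P1 P2.
  have Gm0 : 0 < Gamma m by apply: Gamma_gt0.
  clearbody G g1 g2 m.
  split => //; first exact: mulr_gt0.
  - have h1 : g1 * g2 <= (p1 * G) * (p2 * Gamma m) by rewrite ler_pM// ltW.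
    have h2 : (p1 * p2) * (G * Gamma m) <= (m + 1) * (G * Gamma m).
      by rewrite ler_wpM2r// ltW// mulr_gt0.
    have h3 : m * (g1 * g2) <= m * ((m + 1) * (G * Gamma m)).
      rewrite ler_wpM2l ?(ltW m0)// (le_trans h1)// (le_trans _ h2)//.
      by rewrite mulrACA.
    apply: (le_trans h3); rewrite expr2 [in leRHS]GE le_eqVlt; apply/orP; left; apply/eqP.
    by rewrite GE; ring.
  - have h1 : (m + 1) * G * G <= p3 * g1 * (p4 * g2).
      by rewrite ler_pM ?(ltW G0)// mulr_ge0 ?(ltW m10) ?(ltW G0).
    have h2 : (p3 * p4) * (g1 * g2) <= (m + 2) * (g1 * g2).
      by rewrite ler_wpM2r// ltW// mulr_gt0.
    by rewrite expr2 mulrA (le_trans h1)// (le_trans _ h2)// mulrACA.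
have key (n : nat) : cos_moment (2 * w) n.+1 * (Gamma (n.+2%:R + w) * Gamma (n.+2%:R - w)) * J
  = c * (cos_moment 0 n.+1 * Gamma n.+2%:R ^+ 2) by exact: cos_moment_Gamma.
clearbody c J.
have cJle (n : nat) : c <= J * (1 + 1 / n.+1%:R).
  have [G0 g0 hu _] := facts n; have := key n.
  have := cos_moment_le (2 * w) n.+1; have := cos_moment0_gt0 n.+1 (R := R).
  have m0 : 0 < n.+1%:R :> R by [].
  move: hu; move: (_ * _) g0 (Gamma n.+2%:R) G0 => g g0 G G0.
  move: (cos_moment (2 * w) n.+1) (cos_moment 0 n.+1) => I K hu K0 IK e.
  have KG : 0 < K * G ^+ 2 by rewrite mulr_gt0// exprn_gt0.
  rewrite -(ler_pM2r KG) -e.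
  apply: (@le_trans _ _ (K * g * J)); first by rewrite !ler_wpM2r// ltW.
  rewrite -(ler_pM2l m0).
  have -> : n.+1%:R * (J * (1 + 1 / n.+1%:R) * (K * G ^+ 2)) = (K * J) * ((n.+1%:R + 1) * G ^+ 2).
    by field; rewrite gt_eqF.
  have -> : n.+1%:R * (K * g * J) = (K * J) * (n.+1%:R * g) by ring.
  by rewrite ler_wpM2l// ltW// mulr_gt0.
have cJge (n : nat) : J * (1 - 3 / n.+2%:R) <= c.
  have [G0 g0 _ hl] := facts n.+1; have := key n.+1.
  have w20 : 0 <= 2 * w by rewrite mulr_ge0.
  have := cos_moment_ge n.+1 w20; have := cos_moment0_gt0 n.+2 (R := R).
  have m0 : 0 < n.+2%:R :> R by [].
  have m2 : 2 <= n.+2%:R :> R by rewrite ler_nat.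
  move: hl; move: (_ * _) g0 (Gamma n.+3%:R) G0 => g g0 G G0.
  move: (cos_moment (2 * w) n.+2) (cos_moment 0 n.+2) m0 m2 => I K.
  move: (n.+2%:R : R) => m m0 m2 hu K0 IK e.
  have m1 : 1 <= m by lra.
  have KG : 0 < K * G ^+ 2 by rewrite mulr_gt0// exprn_gt0.
  rewrite -(ler_pM2r KG) -e.
  have IK' : (1 - 2 / m) * K <= I.
    apply: le_trans IK; rewrite ler_pM2r// lerD2l lerN2.
    have q0 : 0 < 2 * (2 * m - 1) by lra.
    have w2m : w ^+ 2 * m <= m.
      by rewrite ler_piMl ?(ltW m0)// expr_le1// ltW.
    by rewrite ler_pdivrMr// mulrAC ler_pdivlMr// exprMn; lra.
  have h1 : (1 - 2 / m) * K * g * J <= I * g * J by rewrite !ler_wpM2r// ltW.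
  have m20 : 0 < m + 2 by lra.
  have h2 : (m + 1) / (m + 2) * G ^+ 2 <= g by rewrite mulrAC ler_pdivrMr// [leRHS]mulrC.
  apply: le_trans h1.
  have k0 : 0 <= (1 - 2 / m) * K * J.
    rewrite mulr_ge0 ?(ltW J0)// mulr_ge0 ?(ltW K0)// subr_ge0 ler_pdivrMr// mul1r//.
  apply: (@le_trans _ _ ((1 - 2 / m) * K * J * ((m + 1) / (m + 2) * G ^+ 2))); last first.
    by rewrite [leRHS]mulrAC ler_wpM2l.
  have -> : J * (1 - 3 / m) * (K * G ^+ 2) = (1 - 3 / m) * (J * K * G ^+ 2) by ring.
  have -> : (1 - 2 / m) * K * J * ((m + 1) / (m + 2) * G ^+ 2) = (1 - 2 / m) * ((m + 1) / (m + 2)) * (J * K * G ^+ 2) by ring.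
  rewrite ler_pM2r ?mulr_gt0 ?exprn_gt0//.
  rewrite -subr_ge0.
  have -> : (1 - 2 / m) * ((m + 1) / (m + 2)) - (1 - 3 / m) = 4 / (m * (m + 2)).
    by field; rewrite !gt_eqF.
  by rewrite divr_ge0// mulr_ge0// ltW.
apply: le_anti; apply/andP; split.
  by apply: (@le_of_inv_nat _ _ _ J) => n; rewrite (le_trans (cJle n))// mulrDr mulr1 mulrA mulr1.
apply: (@le_of_inv_nat _ _ _ (3 * J)) => n; rewrite -lerBlDr (le_trans _ (cJge n))//.
rewrite mulrBr mulr1 lerD2l lerN2 mulrCA -mulrA ler_pM2l//.
by rewrite ler_pM2l// lef_pV2 ?posrE// ler_nat.
Qed.

Lemma Gamma_half {R : realType} : Gamma (2^-1 : R) ^+ 2 = pi.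
Proof.
have h01 : 0 <= (2^-1 : R) < 1 by rewrite invr_ge0 ler0n/= invf_lt1// ltr1n.
have := Gamma_reflection h01; rewrite sin_pihalf mul1r addrC GammaS//.
rewrite (_ : 1 - 2^-1 = 2^-1 :> R); last by field.
by rewrite expr2; move: (Gamma (2^-1 : R)) (pi : R) => g p; lra.
Qed.

Lemma Gamma_addhalf_le {R : realType} (x : R) : 0 < x ->
  Gamma (x + 2^-1) ^+ 2 <= x * Gamma x ^+ 2.
Proof.
move=> x0; have h : 0 <= (2^-1 : R) <= 1 by rewrite invr_ge0 ler0n/= invf_le1// ler1n.
have := Gamma_le x0 h; rewrite powR12_sqrt ?(ltW x0)// => H.
have -> : x * Gamma x ^+ 2 = (Num.sqrt x * Gamma x) ^+ 2 by rewrite exprMn sqr_sqrtr// ltW.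
by rewrite ler_sqr// ?nnegrE ?mulr_ge0 ?sqrtr_ge0 ?Gamma_ge0.
Qed.

Lemma Gamma_addhalf_ge {R : realType} (x : R) : 0 < x ->
  x ^+ 2 * Gamma x ^+ 2 <= (x + 2^-1) * Gamma (x + 2^-1) ^+ 2.
Proof.
move=> x0; rewrite -exprMn -GammaS//.
have x20 : 0 < x + 2^-1 by rewrite addr_gt0.
have := Gamma_addhalf_le x20.
by rewrite (_ : x + 2^-1 + 2^-1 = x + 1)//; field.
Qed.

(* The quotient of the two sides is increased by x |-> x + 1 and tends to 1. *)
Lemma Gamma_watson {R : realType} (x : R) : 0 <= x ->
  (x + 4^-1) * Gamma (x + 2^-1) ^+ 2 <= Gamma (x + 1) ^+ 2.
Proof.
move=> x0.
have pos (n : nat) : 0 < x + n%:R + 2^-1 by rewrite ltr_wpDl// addr_ge0.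
have pos1 (n : nat) : 0 < x + n%:R + 1 by rewrite ltr_wpDl// addr_ge0.
pose h (n : nat) := (x + n%:R + 4^-1) * Gamma (x + n%:R + 2^-1) ^+ 2 / Gamma (x + n%:R + 1) ^+ 2.
have hS (n : nat) : h n <= h n.+1.
  rewrite /h -(natr1 n).
  have -> : x + (n%:R + 1) + 2^-1 = (x + n%:R + 2^-1) + 1 by ring.
  rewrite (_ : x + (n%:R + 1) = x + n%:R + 1); last by ring.
  rewrite (GammaS (pos n)) (GammaS (pos1 n)).
  have := Gamma_gt0 (pos n); have := Gamma_gt0 (pos1 n).
  have y0 : 0 <= x + n%:R by rewrite addr_ge0.
  move: (Gamma (x + n%:R + 2^-1)) (Gamma (x + n%:R + 1)) => g g1.
  move: (x + n%:R) y0 => y y0 g10 g0.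
  have y10 : 0 < y + 1 by lra.
  rewrite -subr_ge0.
  have -> : (y + 1 + 4^-1) * ((y + 2^-1) * g) ^+ 2 / ((y + 1) * g1) ^+ 2 - (y + 4^-1) * g ^+ 2 / g1 ^+ 2
    = 16^-1 * g ^+ 2 / ((y + 1) * g1) ^+ 2 by field; rewrite !gt_eqF.
  by rewrite divr_ge0 ?sqr_ge0// mulr_ge0 ?sqr_ge0.
have hle (n : nat) : h n.+1 <= 1 + 4^-1 / n.+1%:R.
  have y0 : 0 < x + n.+1%:R by rewrite ltr_wpDl.
  have := Gamma_addhalf_le y0; rewrite /h (GammaS y0).
  have := Gamma_gt0 y0; have yn : n.+1%:R <= x + n.+1%:R by rewrite lerDr.
  have n0 : 0 < n.+1%:R :> R by [].
  move: (Gamma (x + n.+1%:R + 2^-1)) (Gamma (x + n.+1%:R)) => g g1.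
  move: (x + n.+1%:R) y0 yn => y y0 yn g10 gle.
  apply: (@le_trans _ _ ((y + 4^-1) * (y * g1 ^+ 2) / (y * g1) ^+ 2)).
    rewrite ler_pM2r ?invr_gt0 ?exprn_gt0 ?mulr_gt0//.
    by rewrite ler_wpM2l// addr_ge0// ltW.
  have -> : (y + 4^-1) * (y * g1 ^+ 2) / (y * g1) ^+ 2 = 1 + 4^-1 / y.
    by field; rewrite !gt_eqF.
  by rewrite lerD2l ler_pM2l// lef_pV2 ?posrE.
have h0E : h 0 = (x + 4^-1) * Gamma (x + 2^-1) ^+ 2 / Gamma (x + 1) ^+ 2 by rewrite /h addr0.
clearbody h.
have h0n (n : nat) : h 0 <= h n by elim: n => // n IH; exact: le_trans (hS n).
have : h 0 <= 1 by apply: (@le_of_inv_nat _ _ _ 4^-1) => n; exact: le_trans (hle n).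
rewrite h0E ler_pdivrMr ?mul1r//.
by rewrite exprn_gt0// Gamma_gt0// ltr_wpDl.
Qed.

(* [Gamma (x + 1/2)^2 / (Gamma x * Gamma (x + 1))] is increasing: the ratio of
   its values at x and y is decreased by a common shift by 1 and tends to 1. *)
Lemma Gamma_addhalf_ratio {R : realType} (x y : R) : 0 < x -> x <= y ->
  y * Gamma (x + 2^-1) ^+ 2 * Gamma y ^+ 2 <= x * Gamma (y + 2^-1) ^+ 2 * Gamma x ^+ 2.
Proof.
move=> x0 xy; have y0 : 0 < y by apply: lt_le_trans xy.
pose psi (z : R) := Gamma (z + 2^-1) ^+ 2 / (z * Gamma z ^+ 2).
have pp z : 0 < z -> 0 < psi z.
  move=> z0; rewrite divr_gt0 ?mulr_gt0 ?exprn_gt0 ?Gamma_gt0// addr_gt0//.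
have pS z : 0 < z -> psi (z + 1) = psi z * (1 + 4^-1 / (z * (z + 1))).
  move=> z0; have z20 : 0 < z + 2^-1 by rewrite addr_gt0.
  rewrite /psi (_ : z + 1 + 2^-1 = z + 2^-1 + 1); last by ring.
  rewrite (GammaS z0) (GammaS z20).
  have := Gamma_gt0 z0; move: (Gamma (z + 2^-1)) (Gamma z) => g g1 g10.
  by field; rewrite !gt_eqF// addr_gt0.
have p1 z : 0 < z -> psi z <= 1.
  move=> z0; rewrite ler_pdivrMr ?mul1r ?Gamma_addhalf_le//.
  by rewrite mulr_gt0// exprn_gt0// Gamma_gt0.
have plow z : 0 < z -> z / (z + 2^-1) <= psi z.
  move=> z0; have z20 : 0 < z + 2^-1 by rewrite addr_gt0.
  have G0 := Gamma_gt0 z0.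
  rewrite ler_pdivrMr// mulrAC ler_pdivlMr ?mulr_gt0 ?exprn_gt0//.
  by rewrite mulrA -expr2 [leRHS]mulrC Gamma_addhalf_ge.
have psiP : psi x <= psi y -> y * Gamma (x + 2^-1) ^+ 2 * Gamma y ^+ 2 <= x * Gamma (y + 2^-1) ^+ 2 * Gamma x ^+ 2.
  have := Gamma_gt0 x0; have := Gamma_gt0 y0; rewrite /psi.
  move: (Gamma (x + 2^-1)) (Gamma x) (Gamma (y + 2^-1)) (Gamma y) => g1 g2 g3 g4 g40 g20.
  rewrite ler_pdivrMr ?mulr_gt0 ?exprn_gt0// mulrAC ler_pdivlMr ?mulr_gt0 ?exprn_gt0//.
  by rewrite mulrCA mulrA [X in _ <= X -> _]mulrCA [X in _ <= X -> _]mulrA.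
clearbody psi.
have key (n : nat) : psi x * psi (y + n%:R) <= psi y * psi (x + n%:R).
  elim: n => [|n IH]; first by rewrite !addr0 mulrC.
  have xn : 0 < x + n%:R by rewrite ltr_wpDr.
  have yn : 0 < y + n%:R by rewrite ltr_wpDr.
  have xyn : x + n%:R <= y + n%:R by rewrite lerD2r.
  rewrite -(natr1 n) !addrA (pS _ xn) (pS _ yn) !mulrA.
  have yn1 : 0 < y + n%:R + 1 by rewrite addr_gt0.
  apply: ler_pM => //.
  - by rewrite mulr_ge0// ltW// pp.
  - by rewrite addr_ge0// divr_ge0// mulr_ge0 ?(ltW yn) ?(ltW yn1).
  - have xn1 : 0 < x + n%:R + 1 by rewrite addr_gt0.
    rewrite lerD2l ler_pM2l// lef_pV2 ?posrE ?mulr_gt0//.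
    by apply: ler_pM; [exact: ltW|exact: ltW|by []|rewrite lerD2r].
apply: psiP.
apply: (@le_of_inv_nat _ _ _ (psi y)) => n.
have xn : 0 < x + n.+1%:R by rewrite ltr_wpDr.
have yn : 0 < y + n.+1%:R by rewrite ltr_wpDr.
have h1 : psi x * psi (y + n.+1%:R) <= psi y.
  by rewrite (le_trans (key n.+1))// ler_piMr ?(ltW (pp _ _))// p1.
have h2 : psi x * ((y + n.+1%:R) / (y + n.+1%:R + 2^-1)) <= psi y.
  by apply: le_trans h1; rewrite ler_wpM2l ?(ltW (pp _ _))// plow.
move: h2; rewrite mulrA ler_pdivrMr ?addr_gt0// -ler_pdivlMr// => /le_trans; apply.
have ny : n.+1%:R <= y + n.+1%:R by rewrite lerDr ltW.
rewrite -mulrA -[X in _ <= X + _]mulr1 -mulrDr ler_wpM2l ?(ltW (pp _ _))//.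
rewrite mulrDl divff ?gt_eqF// lerD2l.
rewrite ler_pdivrMr// mulrC ler_pdivlMr//; lra.
Qed.

Lemma within_continuous_powR {R : realType} (A : set R) (f : R -> R) (r : R) : 0 < r ->
  (forall x, A x -> 0 <= f x) -> {within A, continuous f} ->
  {within A, continuous (fun x => f x `^ r)}.
Proof.
move=> r0 f0 cf; apply/subspace_continuousP => x Ax.
have cfx := (subspace_continuousP A f).1 cf x Ax.
have := f0 x Ax; rewrite le_eqVlt => /predU1P[fx0|fx0]; last first.
  apply: (cvg_comp f (fun t => t `^ r)); first exact: cfx.
  exact: (is_derive_continuous (is_derive1_powR r fx0)).
apply/cvgrPdist_lt => e e0; rewrite /from_subspace -fx0 powR0 ?gt_eqF//.
have d0 : 0 < e `^ r^-1 by rewrite powR_gt0.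
move/cvgrPdist_lt : cfx => /(_ _ d0) cfx.
near=> y; have Ay : A y by near: y; exact: withinT.
rewrite sub0r normrN ger0_norm ?powR_ge0//.
have -> : e = (e `^ r^-1) `^ r by rewrite -powRrM mulVf ?gt_eqF// powRr1// ltW.
rewrite gt0_ltr_powR ?nnegrE ?f0 ?powR_ge0//.
have : `|f x - f y| < e `^ r^-1 by near: y; exact: cfx.
by rewrite -fx0 sub0r normrN ger0_norm ?f0.
Unshelve. all: by end_near. Qed.

(* Euler's beta integral on an arbitrary interval.  As a function of r, the
   integral times [Gamma (r + q) / Gamma q] is gamma-like. *)
Section beta_integral.
Context {R : realType}.
Variables (a b q : R).
Hypotheses (ab : a < b) (q1 : 1 < q).
Implicit Types r x : R.

Let q0 : 0 < q. Proof. exact: lt_trans q1. Qed.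

Let l0 : 0 < b - a. Proof. by rewrite subr_gt0. Qed.

Definition beta_integrand r x := (x - a) `^ (r - 1) * (b - x) `^ (q - 1).

Definition beta_integral r := \int[@lebesgue_measure R]_(x in `[a, b]) beta_integrand r x.

Let measurable_beta r (D : set R) : measurable_fun D (beta_integrand r).
Proof.
apply: measurable_funTS; apply: measurable_funM.
  by apply: (measurableT_comp (measurable_powR (r - 1))); exact: measurable_funB.
by apply: (measurableT_comp (measurable_powR (q - 1))); exact: measurable_funB.
Qed.

Let d1 r x : a < x -> has_derivative (fun x => (x - a) `^ r) x (r * (x - a) `^ (r - 1)).
Proof.
move=> ax; apply: has_derivative_eq; first by apply: has_derivative_powR; [rewrite subr_gt0|solve_derivative].
by rewrite /= addr0 mulr1.
Qed.

Let d2 r x : x < b -> has_derivative (fun x => (b - x) `^ r) x (- (r * (b - x) `^ (r - 1))).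
Proof.
move=> ax; apply: has_derivative_eq; first by apply: has_derivative_powR; [rewrite subr_gt0|solve_derivative].
by rewrite add0r mulrN1.
Qed.

Let cont1 r : 0 < r -> {within `[a, b], continuous (fun x : R => (x - a) `^ r)}.
Proof.
move=> r0; apply: within_continuous_powR => //.
  by move=> x; rewrite /= in_itv/= subr_ge0 => /andP[].
by apply: continuous_subspaceT => x; apply: cvgB; [exact: cvg_id|exact: cvg_cst].
Qed.

Let cont2 r : 0 < r -> {within `[a, b], continuous (fun x : R => (b - x) `^ r)}.
Proof.
move=> r0; apply: within_continuous_powR => //.
  by move=> x; rewrite /= in_itv/= subr_ge0 => /andP[].
by apply: continuous_subspaceT => x; apply: cvgB; [exact: cvg_cst|exact: cvg_id].
Qed.

Let contoo r : {in `]a, b[, continuous (beta_integrand r)}.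
Proof.
move=> x; rewrite in_itv/= => /andP[ax xb].
by apply: cvgM; [exact: (is_derive_continuous (d1 _ ax))|exact: (is_derive_continuous (d2 _ xb))].
Qed.

Lemma integrable_sub_powR r : 0 < r ->
  (@lebesgue_measure R).-integrable `[a, b] (EFin \o (fun x => (x - a) `^ (r - 1))).
Proof.
move=> r0; apply: (@ge0_FTC2_integrable _ _ (fun x => r^-1 * (x - a) `^ r)) => //.
- by move=> x _; exact: powR_ge0.
- by move=> x; rewrite in_itv/= => /andP[ax _]; exact: (is_derive_continuous (d1 _ ax)).
- by move=> x; apply: cvgM; [exact: cvg_cst|exact: cont1].
- move=> x; rewrite in_itv/= => /andP[ax _].
  have : has_derivative (fun x => r^-1 * (x - a) `^ r) x ((x - a) `^ (r - 1)).
    apply: has_derivative_eq; first by apply: has_derivativeM; [exact: has_derivative_cst|exact: d1 ax].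
    by rewrite mul0r add0r mulrA mulVf ?mul1r// gt_eqF.
  exact.
Qed.

Lemma integrable_beta_integrand r : 0 < r ->
  (@lebesgue_measure R).-integrable `[a, b] (EFin \o beta_integrand r).
Proof.
move=> r0; have i := integrableZl_EFin ((b - a) `^ (q - 1)) (measurable_itv `[a, b]) (integrable_sub_powR r0).
apply: le_integrable i => //.
  by apply/measurable_EFinP; exact: measurable_beta.
move=> x; rewrite /= in_itv/= => /andP[ax xb].
rewrite lee_fin /beta_integrand !ger0_norm ?mulr_ge0 ?powR_ge0// mulrC ler_wpM2r ?powR_ge0//.
by rewrite ge0_ler_powR ?nnegrE ?subr_ge0 ?(ltW q1) ?(ltW ab)// lerD2l lerN2.
Qed.

Lemma beta_integral_ge0 r : 0 <= beta_integral r.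
Proof. by apply: Rintegral_ge0 => x _; rewrite mulr_ge0 ?powR_ge0. Qed.

Lemma beta_integral1 : beta_integral 1 = (b - a) `^ q / q.
Proof.
have <- : - (q^-1 * (b - b) `^ q) - (- (q^-1 * (b - a) `^ q)) = (b - a) `^ q / q.
  by rewrite subrr powR0 ?gt_eqF// mulr0 oppr0 add0r opprK mulrC.
apply: (@FTC2_integrable _ _ (fun x => - (q^-1 * (b - x) `^ q))) => //.
- exact: integrable_beta_integrand.
- by move=> x; apply: cvgN; apply: cvgM; [exact: cvg_cst|exact: cont2].
- move=> x; rewrite in_itv/= => /andP[ax xb].
  have : has_derivative (fun x => - (q^-1 * (b - x) `^ q)) x (beta_integrand 1 x).
    apply: has_derivative_eq; first by apply: has_derivativeN; apply: has_derivativeM; [exact: has_derivative_cst|exact: d2 xb].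
    rewrite /beta_integrand subrr powRr0 mul1r mul0r add0r mulrN opprK mulrA mulVf ?mul1r// gt_eqF//.
  exact.
Qed.

Lemma beta_integrandS r x : 0 < r -> x \in `]a, b[ ->
  beta_integrand (r + 1) x = (x - a) * beta_integrand r x.
Proof.
move=> r0; rewrite in_itv/= => /andP[ax _]; rewrite /beta_integrand mulrA addrK.
by rewrite mulr_powRB1// subr_ge0 ltW.
Qed.

Lemma beta_integralS r : 0 < r ->
  (r + q) * beta_integral (r + 1) = r * (b - a) * beta_integral r.
Proof.
move=> r0; have r10 : 0 < r + 1 by rewrite addr_gt0.
have i1 := integrable_beta_integrand r0; have i2 := integrable_beta_integrand r10.
apply/eqP; rewrite eq_sym -subr_eq0 /beta_integral -!RintegralZl// -RintegralB//; [|exact: integrableZl_EFin..].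
apply/eqP; transitivity ((b - a) `^ r * (b - b) `^ q - (a - a) `^ r * (b - a) `^ q); last first.
  by rewrite !subrr !powR0 ?gt_eqF// mulr0 mul0r subrr.
apply: (@FTC2_integrable _ _ (fun x => (x - a) `^ r * (b - x) `^ q)) => //.
- by apply: integrableB_EFin => //; exact: integrableZl_EFin.
- by move=> x xab; apply: cvgB; (apply: cvgM; [exact: cvg_cst|exact: contoo]).
- by move=> x; apply: cvgM; [exact: cont1|exact: cont2].
- move=> x xab; have := xab; rewrite in_itv/= => /andP[ax xb].
  have : has_derivative (fun x => (x - a) `^ r * (b - x) `^ q) x
     (r * (b - a) * beta_integrand r x - (r + q) * beta_integrand (r + 1) x).
    apply: has_derivative_eq; first by apply: has_derivativeM; [exact: d1|exact: d2].
    have -> : (b - x) `^ q = (b - x) * (b - x) `^ (q - 1) by rewrite mulr_powRB1// subr_ge0 ltW.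
    have -> : (x - a) `^ r = (x - a) * (x - a) `^ (r - 1) by rewrite mulr_powRB1// subr_ge0 ltW.
    rewrite beta_integrandS// /beta_integrand.
    by move: ((b - x) `^ (q - 1)) ((x - a) `^ (r - 1)) => u v; ring.
  exact.
Qed.

Lemma beta_integral_le (m x : R) : 0 < m -> 0 <= x <= 1 ->
  beta_integral (m + x) <= (m * (b - a) / (m + q)) `^ x * beta_integral m.
Proof.
move=> m0 x01; have m10 : 0 < m + 1 by rewrite ltr_wpDr.
have mx0 : 0 < m + x by case/andP: x01 => ? _; rewrite ltr_wpDr.
have mq0 : 0 < m + q by rewrite addr_gt0.
pose c := m * (b - a) / (m + q).
have c0 : 0 < c by rewrite divr_gt0// mulr_gt0.
have i1 := integrable_beta_integrand m0; have i2 := integrable_beta_integrand m10.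
pose k := c `^ x * (1 - x); pose l := c `^ x * (x / c).
have bS : beta_integral (m + 1) = c * beta_integral m.
  apply: (@mulfI _ (m + q)); first by rewrite gt_eqF.
  by rewrite beta_integralS// /c; field; rewrite gt_eqF.
have -> : c `^ x * beta_integral m = k * beta_integral m + l * beta_integral (m + 1).
  rewrite bS /k /l; move: (c `^ x) (beta_integral m) => u v; field.
  by rewrite gt_eqF.
rewrite /beta_integral -!RintegralZl// -RintegralD//; [|exact: integrableZl_EFin..].
rewrite -!(@Rintegral_itv_obnd_cbnd _ a (BRight b)); last 2 first.
- have := integrableD_EFin (measurable_itv `[a, b]) (integrableZl_EFin k (measurable_itv `[a, b]) i1) (integrableZl_EFin l (measurable_itv `[a, b]) i2).
  by apply: integrableS => //; exact: subset_itv_oc_cc.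
- by apply: integrableS (integrable_beta_integrand mx0) => //; exact: subset_itv_oc_cc.
apply: le_Rintegral => //.
- by apply: integrableS (integrable_beta_integrand mx0) => //; exact: subset_itv_oc_cc.
- have := integrableD_EFin (measurable_itv `[a, b]) (integrableZl_EFin k (measurable_itv `[a, b]) i1) (integrableZl_EFin l (measurable_itv `[a, b]) i2).
  by apply: integrableS => //; exact: subset_itv_oc_cc.
move=> t /=; rewrite in_itv/= => /andP[at0 tb].
have ta0 : 0 < t - a by rewrite subr_gt0.
rewrite /beta_integrand !mulrA -mulrDl ler_wpM2r ?powR_ge0//.
have -> : (t - a) `^ (m + x - 1) = (t - a) `^ (m - 1) * (t - a) `^ x.
  by rewrite (_ : m + x - 1 = (m - 1) + x) ?powRD ?(gt_eqF ta0) ?implybT//; ring.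
have -> : (t - a) `^ (m + 1 - 1) = (t - a) `^ (m - 1) * (t - a).
  by rewrite addrK mulrC mulr_powRB1// ltW.
have -> : (t - a) `^ x = c `^ x * ((t - a) / c) `^ x.
  rewrite -powRM; [|exact: ltW|by apply: divr_ge0; exact: ltW].
  by rewrite mulrC divfK// gt_eqF.
have -> : k * (t - a) `^ (m - 1) + l * ((t - a) `^ (m - 1) * (t - a)) =
    (t - a) `^ (m - 1) * (c `^ x * (1 + x * ((t - a) / c - 1))).
  by rewrite /k /l; move: (c `^ x) ((t - a) `^ (m - 1)) => u v; field; rewrite gt_eqF.
by rewrite !ler_wpM2l ?powR_ge0// powR_bernoulli// divr_gt0.
Qed.

Theorem beta_integralE r : 0 < r ->
  beta_integral r = (b - a) `^ (r + q - 1) * (Gamma r * Gamma q / Gamma (r + q)).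
Proof.
move=> r0; pose g (r : R) := beta_integral r * Gamma (r + q) / Gamma q / (b - a) `^ (r + q - 1).
have Gq := Gamma_gt0 q0.
have bp s : 0 < (b - a) `^ s by rewrite powR_gt0.
have gS : gamma_like g.
  have gS x : 0 < x -> g (x + 1) = x * g x.
    move=> x0; have xq0 : 0 < x + q by rewrite addr_gt0.
    rewrite /g (_ : x + 1 + q = x + q + 1); last by ring.
    rewrite (GammaS xq0) (_ : x + q + 1 - 1 = x + q); last by ring.
    rewrite -(mulr_powRB1 (ltW l0) xq0).
    have := beta_integralS x0; have := bp (x + q - 1).
    move: ((b - a) `^ (x + q - 1)) (beta_integral (x + 1)) (beta_integral x) (Gamma (x + q)) => p b1 b2 G p0 h.
    have -> : b1 = x * (b - a) * b2 / (x + q) by rewrite -h mulrC mulKf// gt_eqF.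
    by field; rewrite !gt_eqF.
  have g1 : g 1 = 1.
    rewrite /g beta_integral1 (_ : 1 + q - 1 = q); last by ring.
    rewrite [1 + q]addrC.
    rewrite (GammaS q0); have := bp q; move: Gq; move: (Gamma q) ((b - a) `^ q) => G p G0 p0.
    by field; rewrite !gt_eqF.
  have gle m x : 0 < m -> 0 <= x <= 1 -> g (m + x) <= m `^ x * g m.
    move=> m0 x01; have mq0 : 0 < m + q by rewrite addr_gt0.
    have := Gamma_le mq0 x01; have := beta_integral_le m0 x01.
    rewrite /g (_ : m + q + x = m + x + q); last by ring.
    have -> : (b - a) `^ (m + x + q - 1) = (b - a) `^ x * (b - a) `^ (m + q - 1).
      rewrite (_ : m + x + q - 1 = x + (m + q - 1)); last by ring.
      by rewrite powRD// (gt_eqF l0) implybT.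
    have -> : (m * (b - a) / (m + q)) `^ x = m `^ x * (b - a) `^ x / (m + q) `^ x.
      have p0 : (m + q) `^ x != 0 by rewrite gt_eqF// powR_gt0.
      have y0 : 0 <= m * (b - a) / (m + q) by apply: divr_ge0; [apply: mulr_ge0|]; exact: ltW.
      apply: (mulIf p0); rewrite (divfK p0) -(powRM _ (ltW m0) (ltW l0)) -(powRM _ y0 (ltW mq0)).
      by rewrite divfK// gt_eqF.
    have := beta_integral_ge0 (m + x); have := bp x; have := bp (m + q - 1).
    have := @powR_gt0 _ (m + q) x mq0; have := powR_ge0 m x.
    have Gmx : 0 <= Gamma (m + x + q) by apply: Gamma_ge0.
    move: Gmx Gq; move: ((b - a) `^ (m + q - 1)) ((b - a) `^ x) (m `^ x) ((m + q) `^ x) (Gamma (m + q)) (Gamma (m + x + q)) (Gamma q)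
      (beta_integral m) (beta_integral (m + x)) => p1 p2 p3 p4 G1 G2 G b1 b2 G20 G0 p30 p40 p10 p20 b20 h1 h2.
    have h3 : b2 * G2 <= (p3 * p2 / p4 * b1) * (p4 * G1) by rewrite ler_pM.
    have -> : p3 * (b1 * G1 / G / p1) = ((p3 * p2 / p4 * b1) * (p4 * G1)) / G / (p2 * p1).
      by field; rewrite !gt_eqF.
    by rewrite !ler_wpM2r// invr_ge0 ltW// mulr_gt0.
  have gpos0 m : 0 < m -> 0 <= g m.
    by move=> m0; rewrite /g !mulr_ge0 ?beta_integral_ge0 ?Gamma_ge0 ?invr_ge0 ?(ltW (bp _)) ?(ltW Gq).
  clearbody g; split => //.
  - have base (s : R) : 0 < s -> s <= 1 -> 0 < g s.
      move=> s0 s1; have s10 : 0 < s + 1 by rewrite addr_gt0.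
      suff : 0 < g (s + 1) by rewrite gS// pmulr_rgt0.
      rewrite lt_def gpos0// andbT; apply/eqP => g0.
      have s1' : 0 <= 1 - s <= 1 by apply/andP; split; lra.
      have := gle (s + 1) (1 - s) s10 s1'.
      rewrite g0 mulr0 (_ : s + 1 + (1 - s) = 1 + 1); last by ring.
      by rewrite gS// g1 mulr1 ler10.
    have step (n : nat) (s : R) : 0 < s -> s <= n.+1%:R -> 0 < g s.
      elim: n s => [|n IH] s s0 sn; first exact: base.
      have [s1|s1] := leP s 1; first exact: base.
      have s10 : 0 < s - 1 by rewrite subr_gt0.
      rewrite -(subrK 1 s) gS// mulr_gt0//.
      by apply: IH => //; rewrite lerBlDr natr1.
    move=> s s0; apply: (step (Num.bound s)) => //.
    by rewrite (le_trans (ltW (archi_boundP (ltW s0))))// ler_nat.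
  - move=> m x m0 x01; apply: (le_trans (gle _ _ m0 x01)); rewrite ler_wpM2r ?gpos0//.
    case/andP: x01 => x0 _.
    by rewrite ge0_ler_powR// ?nnegrE ?lerDl// ?addr_ge0 ?ltW.
rewrite -(gamma_like_Gamma_eq gS r0) /g.
have Grq : 0 < Gamma (r + q) by rewrite Gamma_gt0// addr_gt0.
have := bp (r + q - 1).
move: Grq Gq; move: (Gamma (r + q)) (Gamma q) ((b - a) `^ (r + q - 1)) (beta_integral r) => G1 G2 p B G10 G20 p0.
by field; rewrite !gt_eqF.
Qed.

End beta_integral.

Section legendre_polynomials.
Context {R : realType}.
Implicit Types (n m : nat) (x : R).

Local Notation P n := (legendre R n).

Let c n : R := (2 ^+ n * n`!%:R)^-1.

Let Q n : {poly R} := ('X ^+ 2 - 1) ^+ n.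

Let sc k (p : {poly R}) : k%:R *: p = k%:R * p.
Proof. by rewrite -mul_polyC polyC_natr. Qed.

Let cS n : c n.+1 * (2 * n.+1%:R) = c n.
Proof.
rewrite /c exprS factS natrM.
have f0 : n`!%:R != 0 :> R by rewrite pnatr_eq0 -lt0n fact_gt0.
have p0 : 2 ^+ n != 0 :> R by rewrite expf_neq0.
have n0 : n.+1%:R != 0 :> R by rewrite pnatr_eq0.
by move: (2 ^+ n) (n`!%:R : R) (n.+1%:R : R) p0 f0 n0 => p f k p0 f0 n0; field; rewrite p0 f0 n0.
Qed.

Let dQ n : (Q n.+1)^`() = (2 * n.+1%:R) *: (Q n * 'X).
Proof.
rewrite /Q deriv_exp /= derivB derivXn derivC subr0 /=.
rewrite expr1 -natrM sc natrM; move: (('X ^+ 2 - 1) ^+ n : {poly R}) => q.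
rewrite -[LHS]mulr_natl -['X *+ 2]mulr_natl; move: (n.+1%:R : {poly R}) => k.
by ring.
Qed.

Let derivn_MX (q : {poly R}) n : (q * 'X)^`(n.+1) = n.+1%:R *: q^`(n) + q^`(n.+1) * 'X.
Proof. by have := derivnMXaddC n q 0; rewrite addr0 scaler_nat. Qed.

Let legendreS_raw n : P n.+1 = c n *: (Q n * 'X)^`(n).
Proof.
rewrite /legendre -/(c n.+1) -/(Q n.+1) derivSn dQ derivnZ scalerA cS //.
Qed.

Lemma legendre0 : P 0 = 1.
Proof. by rewrite /legendre expr0 fact0 mul1r invr1 scale1r expr0 derivn0. Qed.

Lemma legendre1 : P 1 = 'X.
Proof.
by rewrite legendreS_raw /c /Q expr0 fact0 mul1r invr1 scale1r expr0 mul1r derivn0.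
Qed.

Lemma deriv_legendreS n : (P n.+1)^`() = 'X * (P n)^`() + n.+1%:R *: P n.
Proof.
rewrite legendreS_raw derivZ -derivnS derivn_MX scalerDr addrC /legendre -/(c n) -/(Q n).
by rewrite derivZ -derivnS -!mul_polyC; ring.
Qed.

Lemma legendre_deriv_mul n : ('X ^+ 2 - 1) * (P n)^`() = n.+1%:R *: (P n.+1 - 'X * P n).
Proof.
case: n => [|n].
  by rewrite legendre0 legendre1 derivC mulr0 mulr1 subrr scaler0.
have e1 : P n.+2 = 'X * P n.+1 + n.+1%:R * ((c n.+1)%:P * (Q n.+1)^`(n)).
  by rewrite legendreS_raw derivn_MX sc /legendre -/(c n.+1) -/(Q n.+1) -!mul_polyC; ring.
have e2 : 2 * n.+2%:R * P n.+2 = ('X ^+ 2 - 1) * (P n.+1)^`()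
     + 2 * n.+2%:R * ('X * P n.+1) + n.+2%:R * (n.+1%:R * ((c n.+1)%:P * (Q n.+1)^`(n))).
  have -> : P n.+2 = c n.+2 *: (Q n.+1 * 'X * 'X - Q n.+1)^`(n.+2).
    rewrite /legendre -/(c n.+2); congr (_ *: derivn _ _).
    by rewrite exprSr mulrBr mulr1 expr2 mulrA.
  rewrite -natrM -sc scalerA natrM [2 * _ * _]mulrC cS.
  rewrite derivnB !derivn_MX !sc /legendre -/(c n.+1) -/(Q n.+1) derivZ -derivnS -!mul_polyC natrM.
  by move: ((Q n.+1)^`(n)) ((Q n.+1)^`(n.+1)) ((Q n.+1)^`(n.+2)) (n.+2%:R : {poly R}) (n.+1%:R : {poly R}) (c n.+1)%:P => a0 a1 a2 k l cc; ring.
move: e1 e2; rewrite sc.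
move: (('X ^+ 2 - 1) * _) (n.+1%:R * _) (P n.+2) ('X * P n.+1) (n.+2%:R : {poly R}) => u v a b k -> h.
have -> : u = 2 * k * (b + v) - 2 * k * b - k * v by rewrite h; ring.
by ring.
Qed.

#[local] Opaque legendre.

Lemma legendre_bonnet n :
  n.+2%:R *: P n.+2 = (2 * n + 3)%:R *: ('X * P n.+1) - n.+1%:R *: P n.
Proof.
have h1 := legendre_deriv_mul n.+1.
have h2 := legendre_deriv_mul n; have h3 := deriv_legendreS n.
have := congr1 (fun p => ('X ^+ 2 - 1) * p) h3; rewrite h1 mulrDr mulrCA h2.
rewrite !sc natrD natrM -!natr1.
move: (P n.+2) (P n.+1) (P n) (n%:R : {poly R}) => a b d k h.
have -> : (k + 1 + 1) * a = (k + 1 + 1) * (a - 'X * b) + (k + 1 + 1) * ('X * b) by ring.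
by rewrite h; ring.
Qed.

Lemma deriv_legendre n : (P n)^`() = 'X * (P n.+1)^`() - n.+1%:R *: P n.+1.
Proof.
have h2 := legendre_deriv_mul n; have h3 := deriv_legendreS n.
rewrite h3; move: h2; rewrite !sc.
move: (P n.+1) (P n) ((P n)^`()) (n.+1%:R : {poly R}) => a b d k h.
have -> : 'X * ('X * d + k * b) - k * a = ('X ^+ 2 - 1) * d + d - k * (a - 'X * b) by ring.
by rewrite h; ring.
Qed.

Lemma legendre_ode n :
  (1 - 'X ^+ 2) * (P n)^`()^`() - 2%:R *: ('X * (P n)^`()) + n%:R *: (n.+1%:R *: P n) = 0.
Proof.
have h2 := legendre_deriv_mul n; have h3 := deriv_legendreS n.
have := congr1 (@deriv R) h2.
rewrite derivM derivZ derivB derivXn derivB derivM derivX -polyC1 derivC subr0 polyC1 /= h3 !sc expr1.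
have -> : 'X *+ 2 = 2 * 'X :> {poly R} by rewrite mulr_natl.
rewrite -[n.+1%:R]natr1.
move: (P n) ((P n)^`()) ((P n)^`()^`()) (n%:R : {poly R}) => a d d2 k h.
have -> : (1 - 'X ^+ 2) * d2 - 2 * ('X * d) + k * ((k + 1) * a) =
   (k + 1) * ('X * d + (k + 1) * a - (1 * a + 'X * d)) - (2 * 'X * d + ('X ^+ 2 - 1) * d2) by ring.
by rewrite h; ring.
Qed.

Lemma size_legendre n : size (P n) = n.+1.
Proof.
suff : size (P n) = n.+1 /\ size (P n.+1) = n.+2 by case.
elim: n => [|n [IH1 IH2]]; first by rewrite legendre0 legendre1 size_poly1 size_polyX.
split => //.
have k0 : n.+2%:R != 0 :> R by rewrite pnatr_eq0.
rewrite -(size_scale _ k0) legendre_bonnet.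
have P0 : P n.+1 != 0 by rewrite -size_poly_eq0 IH2.
have s1 : size ((2 * n + 3)%:R *: ('X * P n.+1)) = n.+3.
  rewrite size_scale; first by rewrite mulrC size_mulX// IH2.
  by rewrite pnatr_eq0 addn_eq0 andbF.
by rewrite size_polyDl s1// size_polyN size_scale ?IH1// pnatr_eq0.
Qed.

Lemma horner_legendre1 n : (P n).[1] = 1.
Proof.
elim: n => [|n IH]; first by rewrite legendre0 hornerC.
have := congr1 (fun p => p.[1]) (legendre_deriv_mul n).
move: IH; move: (P n.+1) ((P n)^`()) => a d; move: (P n) => b IH.
rewrite !(hornerD, hornerN, hornerM, hornerZ, hornerX, hornerXn, hornerC, IH) ?expr1n ?mulr1 subrr mul0r => /esym/eqP.
by rewrite mulf_eq0 pnatr_eq0/= subr_eq0 => /eqP.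
Qed.

Lemma horner_legendreN n x : (P n).[- x] = (-1) ^+ n * (P n).[x].
Proof.
suff : (P n).[- x] = (-1) ^+ n * (P n).[x] /\ (P n.+1).[- x] = (-1) ^+ n.+1 * (P n.+1).[x] by case.
elim: n => [|n [IH1 IH2]].
  by rewrite legendre0 legendre1 !hornerE expr1 mulN1r.
split => //.
have k0 : n.+2%:R != 0 :> R by rewrite pnatr_eq0.
apply: (mulfI k0).
have h y : n.+2%:R * (P n.+2).[y] = (2 * n + 3)%:R * (y * (P n.+1).[y]) - n.+1%:R * (P n).[y].
  have := congr1 (fun p => p.[y]) (legendre_bonnet n).
  by move: (P n.+2) (P n.+1) (P n) => p2 p1 p0; rewrite !hornerE.
rewrite mulrCA !h IH1 IH2 !exprS; ring.
Qed.

End legendre_polynomials.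

Section legendre_bounds.
Context {R : realType}.
Implicit Types (n m : nat) (x : R).

Local Notation P n := (legendre R n).

Lemma has_derivative_horner (p : {poly R}) x : has_derivative (horner p) x p^`().[x].
Proof. exact: is_derive_poly. Qed.

Lemma horner_legendre_ode n x :
  (1 - x ^+ 2) * (P n)^`()^`().[x] = 2 * x * (P n)^`().[x] - n%:R * n.+1%:R * (P n).[x].
Proof.
have := congr1 (fun p => p.[x]) (@legendre_ode R n).
move: ((P n)^`()^`()) => p2; move: ((P n)^`()) => p1; move: (P n) => p0.
rewrite !(hornerD, hornerN, hornerM, hornerZ, hornerX, hornerXn, hornerC).
by move: (p2.[x]) (p1.[x]) (p0.[x]) (n%:R : R) (n.+1%:R : R) => a b c k l h; lra.
Qed.

Lemma horner_legendre_abs x n : `|(P n).[x]| = `|(P n).[`|x|]|.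
Proof.
have [x0|x0] := ger0P x => //.
by rewrite horner_legendreN normrM normrX normrN1 expr1n mul1r.
Qed.

Lemma legendre_norm_le1 n x : -1 <= x <= 1 -> `|(P n).[x]| <= 1.
Proof.
rewrite -ler_norml => x1; rewrite horner_legendre_abs.
case: n => [|n]; first by rewrite legendre0 hornerC normr1.
pose k : R := n.+1%:R * n.+2%:R; have k0 : 0 < k by rewrite mulr_gt0.
pose S (y : R) := (P n.+1).[y] ^+ 2 + k^-1 * ((1 - y ^+ 2) * (P n.+1)^`().[y] ^+ 2).
have dS (y : R) : has_derivative S y (k^-1 * (2 * y * (P n.+1)^`().[y] ^+ 2)).
  apply: has_derivative_eq.
    by rewrite /S; repeat first [exact: has_derivative_horner|solve_derivative|apply: has_derivativeX].
  have := horner_legendre_ode n.+1 y; rewrite -/k.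
  move: ((P n.+1)^`()^`().[y]) ((P n.+1)^`().[y]) ((P n.+1).[y]) => a b c h.
  transitivity (2 * c * b + k^-1 * (2 * b * ((1 - y ^+ 2) * a) - 2 * y * b ^+ 2)); first by rewrite /=; ring.
  by rewrite h; field; rewrite gt_eqF.
have S1 : S `|x| <= S 1.
  apply: (@ge0_derive_le _ S _ _ _ x1) => [|y _|y /andP[y0 _]].
  - by apply: continuous_subspaceT; exact: is_derive_continuousT dS.
  - exact: dS.
  - have yy : 0 <= y := le_trans (normr_ge0 x) (ltW y0).
    have ki : 0 <= k^-1 by rewrite invr_ge0 ltW.
    exact: mulr_ge0 ki (mulr_ge0 (mulr_ge0 (ler0n _ 2) yy) (sqr_ge0 _)).
have SE : (P n.+1).[`|x|] ^+ 2 <= S `|x|.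
  by rewrite /S lerDl mulr_ge0 ?invr_ge0 ?(ltW k0)// mulr_ge0 ?sqr_ge0// subr_ge0 expr_le1.
rewrite -(@expr_le1 _ 2)// real_normK ?num_real//.
apply: (le_trans SE); apply: (le_trans S1).
by rewrite /S horner_legendre1 !expr1n subrr mul0r mulr0 addr0.
Qed.

Lemma horner0_deriv_legendre n : (P n)^`().[0] = - (n.+1%:R * (P n.+1).[0]).
Proof.
have := congr1 (fun p => p.[0]) (@legendre_deriv_mul R n).
move: (P n.+1) ((P n)^`()) => a d; move: (P n) => b.
rewrite !(hornerD, hornerN, hornerM, hornerZ, hornerX, hornerXn, hornerC) ?expr0n ?mul0r/= ?sub0r ?mulN1r ?mul0r ?subr0.
by move=> <-; rewrite opprK.
Qed.

Lemma horner0_legendreSS n : n.+2%:R * (P n.+2).[0] = - (n.+1%:R * (P n).[0]).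
Proof.
have := congr1 (fun p => p.[0]) (@legendre_bonnet R n).
move: (P n.+2) (P n.+1) (P n) => p2 p1 p0.
by rewrite !(hornerD, hornerN, hornerM, hornerZ, hornerX, hornerXn, hornerC) mul0r mulr0 sub0r.
Qed.

Lemma horner0_legendre_odd m : (P (2 * m).+1).[0] = 0.
Proof.
elim: m => [|m IH]; first by rewrite muln0 legendre1 hornerX.
have -> : (2 * m.+1).+1 = (2 * m).+3 by lia.
have := horner0_legendreSS (2 * m).+1; rewrite IH mulr0 oppr0 => /eqP.
by rewrite mulf_eq0 pnatr_eq0 => /eqP.
Qed.

Lemma horner0_legendre_even m :
  (P (2 * m)).[0] ^+ 2 * (pi * Gamma (m%:R + 1) ^+ 2) = Gamma (m%:R + 2^-1) ^+ 2.
Proof.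
elim: m => [|m IH].
  by rewrite muln0 legendre0 hornerC !add0r Gamma1 Gamma_half !expr1n !mulr1 mul1r.
have -> : (2 * m.+1)%N = (2 * m).+2 by lia.
have m1 : 0 < m%:R + 1 :> R by rewrite ltr_wpDl.
have m2 : 0 < m%:R + 2^-1 :> R by rewrite ltr_wpDl.
have := horner0_legendreSS (2 * m); rewrite -(natr1 m).
rewrite (GammaS m1) (_ : m%:R + 1 + 2^-1 = m%:R + 2^-1 + 1); last by ring.
rewrite (GammaS m2); move: (Gamma (m%:R + 2^-1 : R)) (Gamma (m%:R + 1 : R)) IH => G1 g IH h.
rewrite !exprMn -IH; move: h.
have -> : (2 * m).+2%:R = 2 * (m%:R + 1) :> R by rewrite natr1 -natrM; congr (_%:R); lia.
have -> : (2 * m).+1%:R = 2 * (m%:R + 2^-1) :> R by rewrite -natr1 natrM mulrDr mulfV.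
move: ((P (2 * m)).[0]) ((P (2 * m).+2).[0]) (pi : R) => a b p h.
have h2 : (m%:R + 1) * b = - ((m%:R + 2^-1) * a) by apply: (@mulfI _ 2) => //; rewrite mulrA h; ring.
have -> : b ^+ 2 * (p * ((m%:R + 1) ^+ 2 * g ^+ 2)) = ((m%:R + 1) * b) ^+ 2 * (p * g ^+ 2) by ring.
by rewrite h2; ring.
Qed.

Lemma horner0_legendre_le n : pi * (n%:R + 2^-1) * (P n).[0] ^+ 2 <= 2.
Proof.
have [m [->|->]] : exists m, n = (2 * m)%N \/ n = (2 * m).+1.
  by exists n./2; have := odd_double_half n; case: (odd n) => /=; rewrite -mul2n; lia.
2: by rewrite horner0_legendre_odd expr0n/= mulr0.
have m0 : 0 <= m%:R :> R by [].
have G0 : 0 < Gamma (m%:R + 1 : R) by rewrite Gamma_gt0// ltr_wpDl.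
have := Gamma_watson m0; rewrite -horner0_legendre_even natrM.
move: (m%:R : R) G0 m0 => k G0 k0; move: (Gamma (k + 1 : R)) G0 ((P (2 * m)).[0]) (pi : R) => g g0 a p h.
have g20 : 0 < g ^+ 2 by rewrite exprn_gt0.
rewrite -(ler_pM2r g20).
have -> : p * (2 * k + 2^-1) * a ^+ 2 * g ^+ 2 = 2 * ((k + 4^-1) * (a ^+ 2 * (p * g ^+ 2))) by field.
by rewrite ler_pM2l.
Qed.

Lemma horner0_legendre_mul n : (P n).[0] = 0 \/ (P n.+1).[0] = 0.
Proof.
have [m [->|->]] : exists m, n = (2 * m)%N \/ n = (2 * m).+1.
  by exists n./2; have := odd_double_half n; case: (odd n) => /=; rewrite -mul2n; lia.
  by right; exact: horner0_legendre_odd.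
by left; exact: horner0_legendre_odd.
Qed.

(* Sonin's argument for [sqrt (sin phi) * P_n (cos phi)], written in the
   variable [x = cos phi]; [w] stands for [1 / sin phi]. *)
Lemma legendre_bernstein n x : -1 < x < 1 ->
  pi * (n%:R + 2^-1) * ((1 - x ^+ 2) `^ 2^-1 * (P n).[x] ^+ 2) <= 2.
Proof.
rewrite -ltr_norml => x1; rewrite -[(P n).[x] ^+ 2]real_normK ?num_real// horner_legendre_abs.
rewrite real_normK ?num_real// -[x ^+ 2]real_normK ?num_real//.
have := normr_ge0 x; move: (`|x| : R) x1 => {}x x1 x0.
pose K : R := 4 * n%:R * n.+1%:R + 1.
have K0 : 0 < K by rewrite ltr_wpDl// !mulr_ge0.
have KE : K = 4 * (n%:R + 2^-1) ^+ 2 by rewrite /K -natr1; field.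
pose w (y : R) := (1 - y ^+ 2) `^ (- 2^-1).
pose v (y : R) := y * (P n).[y] * 2^-1 - (1 - y ^+ 2) * (P n)^`().[y].
pose q (y : R) := K * (1 - y ^+ 2) + 1.
pose S (y : R) := w y * ((1 - y ^+ 2) * (P n).[y] ^+ 2 + 4 * (1 - y ^+ 2) * v y ^+ 2 * (q y)^-1).
pose dS (y : R) := - (8 * y * w y * v y ^+ 2 / q y ^+ 2).
have r0 (y : R) : 0 <= y < 1 -> 0 < 1 - y ^+ 2.
  by move=> /andP[y0 y1]; rewrite subr_gt0 expr_lt1.
have q0 (y : R) : 0 <= y < 1 -> 0 < q y by move=> /r0 ry; rewrite /q addr_gt0// mulr_gt0.
have D (y : R) : 0 <= y < 1 -> has_derivative S y (dS y).
  move=> y01; have ry := r0 _ y01; have qy := q0 _ y01.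
  have dw : has_derivative w y (y * w y / (1 - y ^+ 2)).
    apply: has_derivative_eq; first by apply: has_derivative_powR; [exact: ry|solve_derivative].
    have -> : (1 - y ^+ 2) `^ (- 2^-1 - 1) = w y / (1 - y ^+ 2).
      by rewrite powRD ?(gt_eqF ry) ?implybT// powR_inv1// ltW.
    by move: (w y) ((1 - y ^+ 2)^-1) => a b /=; field.
  have dq : has_derivative (fun t => (q t)^-1) y (2 * K * y / q y ^+ 2).
    apply: has_derivative_eq; first by apply: has_derivativeV; [rewrite gt_eqF|rewrite /q; solve_derivative].
    by move: (q y ^+ 2)^-1 => a /=; ring.
  apply: has_derivative_eq.
    rewrite /S; apply: has_derivativeM dw _; apply: has_derivativeD.
      by repeat first [exact: has_derivative_horner|solve_derivative|apply: has_derivativeX].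
    apply: has_derivativeM dq; apply: has_derivativeM; first by solve_derivative.
    by rewrite /v; repeat first [exact: has_derivative_horner|solve_derivative|apply: has_derivativeX].
  have ode := horner_legendre_ode n y.
  rewrite /dS /=; rewrite /v in ode *.
  have Ky : K = (q y - 1) / (1 - y ^+ 2) by rewrite /q addrK mulfK// gt_eqF.
  have nK : n%:R * n.+1%:R = (K - 1) / 4 :> R by rewrite /K; field.
  move: ode; rewrite nK; move: ((P n)^`()^`().[y]) ((P n)^`().[y]) ((P n).[y]) (w y) => a b c W ode.
  have aE : a = (2 * y * b - (K - 1) / 4 * c) / (1 - y ^+ 2) by rewrite -ode mulrC mulKf// gt_eqF.
  rewrite aE /q.
  have q1 : K * (1 - y ^+ 2) + 1 != 0 by rewrite gt_eqF.
  have r1 : 1 - y ^+ 2 != 0 by rewrite gt_eqF.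
  field.
  by rewrite q1 r1.
have Sle : S x <= S 0.
  rewrite -lerN2; apply: (@ge0_derive_le _ (fun y => - S y) (fun y => - dS y) 0 x) => //.
  - apply: continuous_in_subspaceT => y; rewrite inE/= in_itv/= => /andP[y0 yx].
    have /D dSy : 0 <= y < 1 by rewrite y0 (le_lt_trans yx).
    by apply: cvgN; exact: is_derive_continuous dSy.
  - by move=> y /andP[y0 yx]; apply: has_derivativeN; apply: D; rewrite (ltW y0) (lt_trans yx).
  - move=> y /andP[y0 yx]; rewrite /dS opprK.
    exact: divr_ge0 (mulr_ge0 (mulr_ge0 (mulr_ge0 (ler0n _ 8) (ltW y0)) (powR_ge0 _ _)) (sqr_ge0 _)) (sqr_ge0 _).
have x01 : 0 <= x < 1 by rewrite x0.
have rx := r0 _ x01; have qx := q0 _ x01.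
have SE : (1 - x ^+ 2) `^ 2^-1 * (P n).[x] ^+ 2 <= S x.
  have -> : (1 - x ^+ 2) `^ 2^-1 = w x * (1 - x ^+ 2).
    rewrite /w mulrC -{2}(opprK (2^-1 : R)) -{1}(@mulr_powRB1 _ (1 - x ^+ 2) 2^-1) ?(ltW rx)//.
    by congr (_ * _ `^ _); field.
  rewrite /S -mulrA mulrDr lerDl.
  exact: mulr_ge0 (powR_ge0 _ _) (divr_ge0 (mulr_ge0 (mulr_ge0 (ler0n _ 4) (ltW rx)) (sqr_ge0 _)) (ltW qx)).
have S0 : S 0 = (P n).[0] ^+ 2 + 4 * (n.+1%:R * (P n.+1).[0]) ^+ 2 / (K + 1).
  have z2 : (0 : R) ^+ 2 = 0 by rewrite expr0n.
  rewrite /S /w /v /q z2 subr0 powR1 [K * 1]mulr1 horner0_deriv_legendre.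
  by move: ((P n).[0]) ((P n.+1).[0]) ((K + 1)^-1) => a b Ki; ring.
apply: (@le_trans _ _ (pi * (n%:R + 2^-1) * S 0)).
  rewrite ler_wpM2l ?(le_trans SE Sle)// mulr_ge0 ?ltW ?pi_gt0//.
rewrite S0; have [Z|Z] := horner0_legendre_mul n; last first.
  by rewrite Z mulr0 expr0n/= mulr0 mul0r addr0 horner0_legendre_le.
rewrite Z expr0n/= add0r.
have := horner0_legendre_le n.+1; rewrite /K -[n.+1%:R]natr1.
have := pi_gt0 R; have : 0 <= n%:R :> R by [].
move: ((P n.+1).[0]) (pi : R) (n%:R : R) => a p k k0 p0 h.
have kk : 0 <= 4 * k * (k + 1) by rewrite mulr_ge0 ?mulr_ge0 ?addr_ge0.
have k2 : 0 < 4 * k * (k + 1) + 1 + 1 by lra.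
rewrite mulrA ler_pdivrMr//.
have a2 : 0 <= p * a ^+ 2 by rewrite mulr_ge0 ?sqr_ge0// ltW.
move: h; have -> : p * (k + 1 + 2^-1) * a ^+ 2 = (k + 3 / 2) * (p * a ^+ 2) by field.
have -> : p * (k + 2^-1) * (4 * ((k + 1) * a) ^+ 2) = 4 * (k + 2^-1) * (k + 1) ^+ 2 * (p * a ^+ 2) by ring.
move: (p * a ^+ 2) a2 => A A0 h.
have k3 : 0 < k + 3 / 2 by rewrite ltr_wpDl.
have hA : A <= 2 / (k + 3 / 2) by rewrite ler_pdivlMr// mulrC.
apply: (@le_trans _ _ (4 * (k + 2^-1) * (k + 1) ^+ 2 * (2 / (k + 3 / 2)))).
  by rewrite ler_wpM2l// mulr_ge0 ?sqr_ge0// mulr_ge0// addr_ge0.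
rewrite mulrA ler_pdivrMr//; nra.
Qed.

End legendre_bounds.

Lemma isd_sum {R : realType} (n : nat) (h : 'I_n -> R -> R) (d : 'I_n -> R) (x : R) :
  (forall i, has_derivative (h i) x (d i)) ->
  has_derivative (fun t => \sum_(i < n) h i t) x (\sum_(i < n) d i).
Proof.
elim: n h d => [|n IH] h d hd.
  by under eq_fun do rewrite big_ord0; rewrite big_ord0; exact: has_derivative_cst.
under eq_fun do rewrite big_ord_recr /=; rewrite big_ord_recr /=.
by apply: has_derivativeD; [apply: IH => i|]; exact: hd.
Qed.

Section fractional_polynomials.
Context {R : realType}.
Implicit Types (n j : nat) (s z : R) (q : {poly R}).

(* The fractional integral of order [s] from 0 of [q], evaluated at [z]. *)
Definition frac_poly s q z : R :=
  \sum_(j < size q) q`_j * (j`!%:R / Gamma (j%:R + s + 1)) * z `^ (j%:R + s).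

Lemma frac_polyE N s q z : (size q <= N)%N ->
  frac_poly s q z = \sum_(j < N) q`_j * (j`!%:R / Gamma (j%:R + s + 1)) * z `^ (j%:R + s).
Proof.
move=> qN; rewrite /frac_poly.
rewrite (big_ord_widen _ (fun j => q`_j * (j`!%:R / Gamma (j%:R + s + 1)) * z `^ (j%:R + s)) qN).
rewrite big_mkcond /=; apply: eq_bigr => j _; case: ltnP => // h.
by rewrite nth_default// !mul0r.
Qed.

Lemma has_derivative_frac_poly s q z : 0 < s -> 0 < z ->
  has_derivative (frac_poly s q) z (frac_poly (s - 1) q z).
Proof.
move=> s0 z0; apply: isd_sum => j.
have js : 0 < j%:R + s by rewrite ltr_wpDl.
apply: has_derivative_eq; first by apply: has_derivativeM; [exact: has_derivative_cst|apply: has_derivative_powR z0 _; exact: has_derivative_id].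
rewrite (GammaS js) (_ : j%:R + (s - 1) + 1 = j%:R + s); last by ring.
rewrite (_ : j%:R + (s - 1) = j%:R + s - 1); last by ring.
have := Gamma_gt0 js; move: (Gamma (j%:R + s)) (z `^ (j%:R + s - 1)) (z `^ (j%:R + s)) => g p p' g0.
by field; rewrite !gt_eqF.
Qed.

Lemma frac_poly0 s q : 0 < s -> frac_poly s q 0 = 0.
Proof.
move=> s0; rewrite /frac_poly big1// => j _.
by rewrite powR0 ?mulr0// gt_eqF// ltr_wpDl.
Qed.

Lemma frac_poly_continuous s q b : 0 < s -> {within `[0, b], continuous (frac_poly s q)}.
Proof.
move=> s0; rewrite /frac_poly; elim: (size q) => [|n IH].
  rewrite [X in continuous X](_ : _ = cst 0); first by move=> x; exact: cvg_cst.
  by apply/funext => z; exact: big_ord0.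
rewrite [X in continuous X](_ : _ = (fun z => \sum_(j < n) q`_j * (j`!%:R / Gamma (j%:R + s + 1)) * z `^ (j%:R + s)) \+
   (fun z => q`_n * (n`!%:R / Gamma (n%:R + s + 1)) * z `^ (n%:R + s))); last first.
  by apply/funext => z; exact: big_ord_recr.
move=> x; apply: cvgD; first exact: IH.
apply: cvgM; first exact: cvg_cst.
apply: powR_continuous_within; by rewrite ltr_wpDl.
Qed.

Definition legendre_flip n : {poly R} := legendre R n \Po (1 - 'X).

Local Notation L := legendre_flip.

Let deriv_flip (p : {poly R}) : (p \Po (1 - 'X))^`() = - (p^`() \Po (1 - 'X)).
Proof. by rewrite deriv_comp derivB -polyC1 derivC derivX sub0r mulrN1. Qed.

Let coefXderiv (p : {poly R}) j : ('X * p^`())`_j = j%:R * p`_j.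
Proof.
by rewrite coefXM; case: j => [|j]; rewrite ?mul0r//= coef_deriv mulr_natl.
Qed.

Lemma horner_legendre_flip n z : (L n).[z] = (legendre R n).[1 - z].
Proof. by rewrite horner_comp !(hornerD, hornerN, hornerX, hornerC). Qed.

Lemma size_legendre_flip n : size (L n) = n.+1.
Proof.
rewrite size_comp_poly2 ?size_legendre//.
by rewrite addrC size_polyDl ?size_polyN ?size_polyX// size_poly1.
Qed.

Lemma legendre_flip_coef0 n : (L n)`_0 = 1.
Proof. by rewrite -horner_coef0 horner_legendre_flip subr0 horner_legendre1. Qed.

Lemma legendre_flip_coefS n j :
  2 * j.+1%:R ^+ 2 * (L n)`_j.+1 = (j%:R * j.+1%:R - n%:R * n.+1%:R) * (L n)`_j.
Proof.
have e : 2%:R *: ('X * (L n)^`())^`() - 'X * ('X * (L n)^`())^`() - 'X * (L n)^`() + n%:R *: (n.+1%:R *: L n) = 0.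
  have := congr1 (fun p : {poly R} => p \Po (1 - 'X)) (@legendre_ode R n).
  rewrite derivM derivX mul1r /L !deriv_flip derivN deriv_flip opprK.
  move: (legendre R n) (legendre R n)^`() (legendre R n)^`()^`() => p p' p''.
  rewrite comp_poly0 !(comp_polyD, comp_polyZ, comp_polyM, raddfN, raddfB) /=.
  rewrite !(comp_polyD, comp_polyZ, comp_polyM, raddfN, raddfB) /=.
  rewrite comp_polyX -polyC1 comp_polyC polyC1.
  rewrite -!mul_polyC !polyC_natr.
  move: (p \Po _) (p' \Po _) (p'' \Po _) => a b c <-; ring.
move: (L n) e => p /(congr1 (fun p : {poly R} => p`_j)).
rewrite !(coefD, coefN, coefZ, coefXderiv) coef_deriv coefXderiv coef0 -(mulr_natl (j.+1%:R * p`_j.+1)).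
move: (p`_j.+1) (p`_j) (n%:R : R) (n.+1%:R : R) => a b k l.
rewrite -[j.+1%:R]natr1; move: (j%:R : R) => i h.
by apply/eqP; rewrite -subr_eq0 -[X in _ == X]h; apply/eqP; ring.
Qed.

Lemma legendre_flip_coef_up n j :
  j.+1%:R * (L n.+1)`_j.+1 = j.+1%:R * (L n)`_j.+1 - (j%:R + n.+1%:R) * (L n)`_j.
Proof.
have e : (L n.+1)^`() = (L n)^`() - 'X * (L n)^`() - n.+1%:R *: L n.
  rewrite /L !deriv_flip deriv_legendreS.
  move: (legendre R n) (legendre R n)^`() => p p'.
  rewrite comp_polyD comp_polyM comp_polyZ comp_polyX -!mul_polyC.
  move: (p \Po _) (p' \Po _) => a b; move: (n.+1%:R : R)%:P => c; ring.
move: (L n.+1) (L n) e => p q /(congr1 (fun p : {poly R} => p`_j)).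
rewrite !(coefD, coefN, coefZ, coefXderiv) !coef_deriv -(mulr_natl p`_j.+1) -(mulr_natl q`_j.+1) => ->.
move: p`_j.+1 p`_j q`_j.+1 q`_j (j.+1%:R : R) => a b c d i1; move: (j%:R : R) (n.+1%:R : R) => i m; ring.
Qed.

Lemma legendre_flip_coef_down n j :
  j.+1%:R * (L n)`_j.+1 = j.+1%:R * (L n.+1)`_j.+1 + (n.+1%:R - j%:R) * (L n.+1)`_j.
Proof.
have e : (L n)^`() = (L n.+1)^`() - 'X * (L n.+1)^`() + n.+1%:R *: L n.+1.
  rewrite /L !deriv_flip [in LHS]deriv_legendre.
  move: (legendre R n.+1) (legendre R n.+1)^`() => p p'.
  rewrite raddfB/= comp_polyM comp_polyZ comp_polyX -!mul_polyC.
  move: (p \Po _) (p' \Po _) => a b; move: (n.+1%:R : R)%:P => c; ring.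
move: (L n.+1) (L n) e => p q /(congr1 (fun p : {poly R} => p`_j)).
rewrite !(coefD, coefN, coefZ, coefXderiv) !coef_deriv -(mulr_natl p`_j.+1) -(mulr_natl q`_j.+1) => ->.
move: p`_j.+1 p`_j q`_j.+1 q`_j (j.+1%:R : R) => a b c d i1; move: (j%:R : R) (n.+1%:R : R) => i m; ring.
Qed.

Lemma frac_legendre_ode n s z : 1 < s -> 0 < z ->
  z * (2 - z) * frac_poly (s - 1 - 1) (L n) z - 2 * (s - 1) * (1 - z) * frac_poly (s - 1) (L n) z
  + (n%:R - s + 1) * (n%:R + s) * frac_poly s (L n) z = 0.
Proof.
move=> s1 z0; have s0 : 0 < s - 1 by rewrite subr_gt0.
pose t (j : nat) : R := (L n)`_j * (j`!%:R / Gamma (j%:R + s + 1)) * (j%:R + s) * z `^ (j%:R + s).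
have sz : (size (L n) <= n.+2)%N by rewrite size_legendre_flip.
rewrite !(frac_polyE _ _ sz).
pose A (j : nat) : R := (L n)`_j * (j`!%:R / Gamma (j%:R + s)) * z `^ (j%:R + s - 1).
have tele : forall N, (N <= n.+2)%N ->
  z * (2 - z) * \sum_(j < N) (L n)`_j * (j`!%:R / Gamma (j%:R + (s - 1 - 1) + 1)) * z `^ (j%:R + (s - 1 - 1))
  - 2 * (s - 1) * (1 - z) * \sum_(j < N) (L n)`_j * (j`!%:R / Gamma (j%:R + (s - 1) + 1)) * z `^ (j%:R + (s - 1))
  + (n%:R - s + 1) * (n%:R + s) * \sum_(j < N) (L n)`_j * (j`!%:R / Gamma (j%:R + s + 1)) * z `^ (j%:R + s)
  = - (2 * N%:R * A N).
  elim=> [|N IH] Nn; first by rewrite !big_ord0 !mulr0 mul0r oppr0; ring.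
  rewrite !big_ord_recr /=.
  move: (IH (ltnW Nn)); move: (\sum_(i < N) _) => S2; move: (\sum_(i < N) _) => S1; move: (\sum_(i < N) _) => S0 IHN.
  have Ns : 0 < N%:R + s - 1 by rewrite -addrA ltr_wpDl.
  have Ns1 : 0 < N%:R + s by lra.
  rewrite (_ : N%:R + (s - 1 - 1) + 1 = N%:R + s - 1); last by ring.
  rewrite (_ : N%:R + (s - 1 - 1) = N%:R + s - 1 - 1); last by ring.
  rewrite (_ : N%:R + (s - 1) + 1 = N%:R + s - 1 + 1); last by ring.
  rewrite (_ : N%:R + (s - 1) = N%:R + s - 1); last by ring.
  have -> : A N.+1 = (L n)`_N.+1 * (N.+1%:R * N`!%:R / Gamma (N%:R + s + 1)) * z `^ (N%:R + s).
    rewrite /A factS natrM -[X in Gamma (X + _)]natr1 -[X in z `^ (X + _ - _)]natr1.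
    by rewrite (addrAC N%:R 1 s) addrK.
  have -> : z `^ (N%:R + s) = z * z * z `^ (N%:R + s - 1 - 1).
    by rewrite -mulrA !mulr_powRB1 ?(ltW z0)//; lra.
  move: IHN; rewrite /A (GammaS Ns1) !subrK.
  have -> : Gamma (N%:R + s) = (N%:R + s - 1) * Gamma (N%:R + s - 1) by rewrite -(GammaS Ns) subrK.
  have -> : z `^ (N%:R + s - 1) = z * z `^ (N%:R + s - 1 - 1) by rewrite mulr_powRB1 ?(ltW z0).
  have := Gamma_gt0 Ns; have rec := legendre_flip_coefS n N.
  move: ((L n)`_N.+1) ((L n)`_N) rec => a b rec.
  move: (Gamma (N%:R + s - 1)) (z `^ (N%:R + s - 1 - 1)) (N`!%:R : R) => g p f g0 IHN.
  have N1 : N.+1%:R != 0 :> R by rewrite pnatr_eq0.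
  have aE : a = (N%:R * N.+1%:R - n%:R * n.+1%:R) * b / (2 * N.+1%:R ^+ 2).
    by rewrite -rec mulrC mulKf// mulf_neq0 ?expf_neq0// pnatr_eq0.
  rewrite aE.
  have -> : z * (2 - z) * (S2 + b * (f / g) * p) - 2 * (s - 1) * (1 - z) * (S1 + b * (f / ((N%:R + s - 1) * g)) * (z * p)) +
    (n%:R - s + 1) * (n%:R + s) * (S0 + b * (f / ((N%:R + s) * ((N%:R + s - 1) * g))) * (z * z * p)) =
   (z * (2 - z) * S2 - 2 * (s - 1) * (1 - z) * S1 + (n%:R - s + 1) * (n%:R + s) * S0) +
   (z * (2 - z) * (b * (f / g) * p) - 2 * (s - 1) * (1 - z) * (b * (f / ((N%:R + s - 1) * g)) * (z * p)) +
    (n%:R - s + 1) * (n%:R + s) * (b * (f / ((N%:R + s) * ((N%:R + s - 1) * g))) * (z * z * p))) by ring.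
  rewrite IHN; move: N1; rewrite -[N.+1%:R]natr1 -[n.+1%:R]natr1.
  move: Ns Ns1; move: (N%:R : R) (n%:R : R) => x y Ns Ns1 N1.
  by field; rewrite N1 !gt_eqF.
by rewrite tele// /A nth_default ?size_legendre_flip// !mul0r mulr0 oppr0.
Qed.

End fractional_polynomials.

Section fractional_legendre_bound.
Context {R : realType}.
Implicit Types (n j : nat) (s z c : R) (p q : {poly R}).

Local Notation L := (@legendre_flip R).

Lemma frac_poly1_shift p q c s : 0 < s -> p`_0 = q`_0 ->
  (forall j, j.+1%:R * p`_j.+1 = j.+1%:R * q`_j.+1 + (c - j%:R) * q`_j) ->
  frac_poly (s - 1) p 1 = (s + c) * frac_poly s q 1.
Proof.
move=> s0 pq0 pq.
pose P (j : nat) : R := p`_j * (j`!%:R / Gamma (j%:R + s)).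
pose Q (j : nat) : R := q`_j * (j`!%:R / Gamma (j%:R + s + 1)).
have tele N : \sum_(j < N.+1) P j = (s + c) * \sum_(j < N) Q j + q`_N * (N`!%:R / Gamma (N%:R + s)).
  elim: N => [|N IH]; first by rewrite big_ord1 big_ord0 mulr0 add0r /P pq0.
  rewrite big_ord_recr IH [in RHS]big_ord_recr /= /P /Q.
  have Ns : 0 < N%:R + s by rewrite ltr_wpDl.
  rewrite -[in Gamma (N.+1%:R + s)]natr1 (addrAC N%:R 1 s) (GammaS Ns) factS natrM.
  have := Gamma_gt0 Ns; move: (\sum_(j < N) _) (Gamma _) => S g g0.
  rewrite !(mulrA _ (_ * _) _^-1) !(mulrA _ N.+1%:R) !(mulrC _ N.+1%:R) pq.
  move: (N.+1%:R * _) => b; move: (q`_N) (N`!%:R : R) Ns => a f; move: (N%:R : R) => x Ns.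
  by field; rewrite !gt_eqF.
pose N := maxn (size p) (size q).
rewrite (@frac_polyE _ N.+1 (s - 1) p) ; last exact: leqW (leq_maxl _ _).
rewrite (@frac_polyE _ N s q) ?leq_maxr//.
have := tele N; rewrite [q`_N]nth_default ?leq_maxr// mul0r addr0 => e.
under eq_bigr => j _ do rewrite powR1 mulr1 -addrA subrK.
by rewrite e; congr (_ * _); apply: eq_bigr => j _; rewrite powR1 mulr1.
Qed.

Definition frac_legendre1 n s : R := frac_poly s (L n) 1.
Local Notation M := frac_legendre1.

Lemma frac_legendre1_up n s : 0 < s -> M n.+1 (s - 1) = (s - n.+1%:R) * M n s.
Proof.
move=> s0; apply: (frac_poly1_shift s0); first by rewrite !legendre_flip_coef0.
by move=> j; rewrite legendre_flip_coef_up -mulNr opprD (addrC (- j%:R)).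
Qed.

Lemma frac_legendre1_down n s : 0 < s -> M n (s - 1) = (s + n.+1%:R) * M n.+1 s.
Proof.
move=> s0; apply: (frac_poly1_shift s0); first by rewrite !legendre_flip_coef0.
by move=> j; rewrite legendre_flip_coef_down.
Qed.

Lemma frac_legendre1_0 s : M 0 s = (Gamma (s + 1))^-1.
Proof.
have e : L 0 = 1.
  by rewrite /legendre_flip legendre0 -polyC1 comp_polyC.
by rewrite /M /frac_poly e size_poly1 big_ord1 coef1 powR1 add0r mul1r mulr1 fact0 div1r.
Qed.

Definition legendre_max n s : R :=
  2 `^ (- s) / Num.sqrt pi * (Gamma ((n%:R - s + 1) / 2) / Gamma ((n%:R + s) / 2 + 1)).
Local Notation K := legendre_max.

Lemma legendre_max_gt0 n s : -1 < s -> s < n.+1%:R -> 0 < K n s.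
Proof.
move=> s1 sn; have n0 : 0 <= n%:R :> R by [].
rewrite -natr1 in sn.
have h1 : 0 < (n%:R - s + 1) / 2 :> R by lra.
have h2 : 0 < (n%:R + s) / 2 + 1 :> R by lra.
by rewrite /K !mulr_gt0 ?invr_gt0 ?sqrtr_gt0 ?pi_gt0 ?powR_gt0 ?Gamma_gt0.
Qed.

Lemma legendre_max_down n s : -1 < n%:R + s ->
  K n (s - 1) = (n%:R + s + 1) * K n.+1 s.
Proof.
move=> ns.
rewrite /K -[n.+1%:R]natr1.
have -> : (n%:R - (s - 1) + 1) / 2 = (n%:R + 1 - s + 1) / 2 by field.
have -> : (n%:R + (s - 1)) / 2 + 1 = (n%:R + s + 1) / 2 by field.
have -> : (n%:R + 1 + s) / 2 + 1 = (n%:R + s + 1) / 2 + 1 by field.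
have h : 0 < (n%:R + s + 1) / 2 by lra.
have -> : 2 `^ (- (s - 1)) = 2 * 2 `^ (- s) :> R.
  rewrite opprB powRD ?powRr1//; apply/implyP => _; by rewrite pnatr_eq0.
rewrite (GammaS h); have := Gamma_gt0 h; have := @pi_gt0 R; rewrite -sqrtr_gt0.
move: (Gamma _) (Gamma _) (Num.sqrt _) (2 `^ _) => a g p t p0 g0.
by field; rewrite !gt_eqF//; lra.
Qed.

Lemma legendre_max_up n s : s < n.+1%:R -> K n.+1 (s - 1) = (n.+1%:R - s) * K n s.
Proof.
rewrite /K -[n.+1%:R]natr1; move: (n%:R : R) => x sx.
have -> : (x + 1 - (s - 1) + 1) / 2 = (x - s + 1) / 2 + 1 by field.
have -> : (x + 1 + (s - 1)) / 2 + 1 = (x + s) / 2 + 1 by field.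
have h' : 0 < (x - s + 1) / 2 by lra.
have -> : 2 `^ (- (s - 1)) = 2 * 2 `^ (- s) :> R.
  rewrite opprB powRD ?powRr1//; apply/implyP => _; by rewrite pnatr_eq0.
rewrite (GammaS h').
move: (Gamma _) (Gamma _)^-1 (Num.sqrt _)^-1 (2 `^ _) => a g p t.
by field.
Qed.

Let reflection (w : R) : 0 < w < 1 -> sin (pi * w) * (Gamma w * Gamma (1 - w)) = pi.
Proof.
move=> /andP[w0 w1].
have h : 0 <= w < 1 by rewrite ltW.
have := Gamma_reflection h; rewrite (addrC 1 w) (GammaS w0) -mulrA mulrCA (mulrC pi).
by apply: mulfI; rewrite gt_eqF.
Qed.

Let sqrtpi_Gamma : Gamma 2^-1 = Num.sqrt pi :> R.
Proof. by rewrite -Gamma_half sqrtr_sqr ger0_norm// Gamma_ge0. Qed.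

(* M / K turns into a reflection product by the duplication formula at s + 1. *)
Let max0_sin s : 0 < s < 2 -> M 0 (s - 1) = sin (pi * (s / 2)) * K 0 (s - 1).
Proof.
move=> /andP[s0 s2].
have s01 : 0 < s / 2 < 1 by lra.
have g1 : 0 < Gamma ((s + 1) / 2) by apply: Gamma_gt0; lra.
have g2 : 0 < Gamma (1 - s / 2) by apply: Gamma_gt0; lra.
have g3 : 0 < Gamma (s / 2) by apply: Gamma_gt0; lra.
rewrite frac_legendre1_0 /K !add0r subrK.
have := reflection s01; have := Gamma_duplication s0; rewrite sqrtpi_Gamma.
have -> : (- (s - 1) + 1) / 2 = 1 - s / 2 by field.
have -> : (s - 1) / 2 + 1 = (s + 1) / 2 by field.
have g0 := Gamma_gt0 s0.
have t0 : 0 < 2 `^ (s - 1) :> R by exact: powR_gt0.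
have p0 : 0 < Num.sqrt pi :> R by rewrite sqrtr_gt0 pi_gt0.
have pE : pi = Num.sqrt pi ^+ 2 :> R by rewrite sqr_sqrtr// pi_ge0.
rewrite powRN => e h; clear s01; rewrite [X in _ = X]pE in h; move: h.
move: (Gamma s) (Gamma ((s + 1) / 2)) (Gamma (1 - s / 2)) (Gamma (s / 2)) (2 `^ (s - 1)) (Num.sqrt pi) (sin _) e g0 g1 g2 g3 t0 p0 => a b c d t p x e a0 b0 c0 d0 t0 p0 h.
have -> : x = p ^+ 2 / (d * c) by rewrite -h mulfK// mulf_neq0// gt_eqF.
have -> : a = t * d * b / p by rewrite -e mulfK// gt_eqF.
by field; rewrite !gt_eqF.
Qed.

Lemma frac_legendre1_angle n s : 0 < s -> s < n.+1%:R ->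
  exists x y, [/\ x ^+ 2 + y ^+ 2 = 1, M n s = x * K n s & M n (s - 1) = y * K n (s - 1)].
Proof.
have n0 m : 0 <= m%:R :> R by [].
elim: n s => [|n IH] s s0 sn.
  exists (cos (pi * (s / 2))), (sin (pi * (s / 2))); split; first by rewrite cos2Dsin2.
  - have s01 : 0 < s + 1 < 2 by lra.
    have := max0_sin s01; rewrite addrK => ->.
    rewrite (_ : pi * ((s + 1) / 2) = pi * (s / 2) + pi / 2); last by field.
    by rewrite sinDpihalf.
  - by apply: max0_sin; lra.
have ns1 : -1 < n%:R + s by have := n0 n; lra.
have ns0 : s + n.+1%:R != 0 by rewrite gt_eqF ?ltr_wpDr.
have [sn1|sn1] := ltP s n.+1%:R.
  have [x [y [xy ex ey]]] := IH s s0 sn1.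
  exists y, (- x); split; first by rewrite sqrrN addrC.
  - apply: (mulfI ns0); rewrite -(frac_legendre1_down _ s0) ey (legendre_max_down ns1).
    rewrite -[n.+1%:R]natr1; move: (K _ _) (n%:R : R) => a b; ring.
  - rewrite (frac_legendre1_up _ s0) (legendre_max_up sn1) ex.
    move: (K _ _) (n.+1%:R : R) => a b; ring.
have [s1|s1] := ltP 1 s.
  have s10 : 0 < s - 1 by lra.
  have sn1' : s - 1 < n.+1%:R by move: sn; rewrite -[n.+2%:R]natr1; lra.
  have ns0' : s - 1 + n.+1%:R != 0 by apply: lt0r_neq0; have := n0 n.+1; lra.
  have ns1' : -1 < n%:R + (s - 1) by have := n0 n; lra.
  have [x [y [xy ex ey]]] := IH _ s10 sn1'.
  exists x, y; split; first exact: xy.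
  - apply: (mulfI ns0); rewrite -(frac_legendre1_down _ s0) ex (legendre_max_down ns1).
    rewrite -[n.+1%:R]natr1; move: (K _ _) (n%:R : R) => a b; ring.
  - apply: (mulfI ns0'); rewrite -(frac_legendre1_down _ s10) ey (legendre_max_down ns1').
    rewrite -[n.+1%:R]natr1; move: (K _ _) (n%:R : R) => a b; ring.
have n00 : n = 0%N.
  by apply/eqP; rewrite -leqn0 -ltnS -(ler_nat R); exact: le_trans s1.
rewrite {}n00 in ns0 ns1 sn1 *.
have s1E : s = 1 by apply/eqP; rewrite eq_le s1.
exists 1, 0; split; first by rewrite expr0n expr1n addr0.
- have s02 : 0 < s < 2 by lra.
  apply: (mulfI ns0); rewrite -(frac_legendre1_down _ s0) (max0_sin s02) (legendre_max_down ns1).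
  rewrite s1E div1r sin_pihalf; move: (K _ _) => a; ring.
- by rewrite (frac_legendre1_up _ s0) s1E subrr !mul0r.
Qed.

Lemma legendre_max_sqr_le n s : 1 <= s -> s < n.+1%:R ->
  K n (s - 1) ^+ 2 <= (n%:R - s + 1) * (n%:R + s) * K n s ^+ 2.
Proof.
move=> s1; rewrite -[n.+1%:R]natr1 => sn.
pose a : R := (n%:R - s + 1) / 2; pose b : R := (n%:R + s + 1) / 2.
have a0 : 0 < a by rewrite /a; lra.
have ba : a + 1 <= b by rewrite /a /b; lra.
have b0 : 0 < b by lra.
have -> : (n%:R - s + 1) * (n%:R + s) = 2 * a * (2 * b - 1) by rewrite /a /b; field.
have ba' : 0 < b + 2^-1 by lra.
have e1 : (n%:R - (s - 1) + 1) / 2 = a + 2^-1 by rewrite /a; field.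
have e2 : (n%:R + (s - 1)) / 2 + 1 = b by rewrite /b; field.
have e3 : (n%:R + s) / 2 + 1 = b + 2^-1 by rewrite /b; field.
have e4 : 2 `^ (- (s - 1)) = 2 * 2 `^ (- s) :> R.
  by rewrite opprB powRD ?powRr1; [|exact: ler0n|apply/implyP => _; rewrite pnatr_eq0].
rewrite /K e1 e2 e3 e4 -/a.
have := Gamma_watson (ltW a0); have := Gamma_watson (ltW b0).
rewrite (GammaS a0) (GammaS b0).
have := Gamma_gt0 b0; have := Gamma_gt0 ba'.
move: (Gamma (b + 2^-1)) (Gamma b) (Gamma (a + 2^-1)) (Gamma a) => B' B A' A B'0 B0 hb ha.
rewrite -(mulrA 2); move: (_ / Num.sqrt _) => e.
clear e1 e2 e3 e4.
have -> : (2 * e * (A' / B)) ^+ 2 = (2 * e / (B * B')) ^+ 2 * (A' ^+ 2 * B' ^+ 2).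
  by field; rewrite !gt_eqF.
have -> : 2 * a * (2 * b - 1) * (e * (A / B')) ^+ 2 = (2 * e / (B * B')) ^+ 2 * (a * (b - 2^-1) * (A ^+ 2 * B ^+ 2)).
  by field; rewrite !gt_eqF.
apply: ler_wpM2l; first exact: sqr_ge0.
have hab := ler_pM (mulr_ge0 (ltW (_ : 0 < a + 4^-1)) (sqr_ge0 A')) (mulr_ge0 (ltW (_ : 0 < b + 4^-1)) (sqr_ge0 B')) ha hb.
have a4 : 0 < a + 4^-1 by lra.
have b4 : 0 < b + 4^-1 by lra.
have key : a * b ^+ 2 <= (a + 4^-1) * (b + 4^-1) * (b - 2^-1).
  rewrite -subr_ge0.
  have -> : (a + 4^-1) * (b + 4^-1) * (b - 2^-1) - a * b ^+ 2 = (b / 4 + 8^-1) * (b - a - 1) + b / 16 + 3 / 32 by field.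
  by rewrite !addr_ge0 ?mulr_ge0//; lra.
have {}hab := hab a4 b4.
rewrite -(ler_pM2l (mulr_gt0 a4 b4)).
have -> : (a + 4^-1) * (b + 4^-1) * (A' ^+ 2 * B' ^+ 2) = (a + 4^-1) * A' ^+ 2 * ((b + 4^-1) * B' ^+ 2) by ring.
apply: (le_trans hab).
have -> : (a * A) ^+ 2 * (b * B) ^+ 2 = (a * b ^+ 2) * (a * (A ^+ 2 * B ^+ 2)) by ring.
have -> : (a + 4^-1) * (b + 4^-1) * (a * (b - 2^-1) * (A ^+ 2 * B ^+ 2)) = ((a + 4^-1) * (b + 4^-1) * (b - 2^-1)) * (a * (A ^+ 2 * B ^+ 2)) by ring.
by apply: (ler_wpM2r _ key); rewrite mulr_ge0 ?(ltW a0)// mulr_ge0 ?sqr_ge0.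
Qed.

(* The Sonin function of W increases up to the centre z = 1 and decreases after it. *)
Lemma frac_legendre_le n s z : 1 < s -> s < n.+1%:R -> 0 <= z <= 2 ->
  `|frac_poly s (L n) z| <= K n s.
Proof.
move=> s1 sn /andP[z0 z2].
have s0 : 0 < s by exact: lt_trans s1.
have s10 : 0 < s - 1 by rewrite subr_gt0.
pose c := (n%:R - s + 1) * (n%:R + s).
have c0 : 0 < c.
  by move: sn; rewrite /c -[n.+1%:R]natr1 => sn; apply: mulr_gt0; [lra|rewrite ltr_wpDl].
pose W := frac_poly s (L n); pose W' := frac_poly (s - 1) (L n).
pose S (t : R) := W t ^+ 2 + c^-1 * (t * (2 - t) * W' t ^+ 2).
pose dS (t : R) := c^-1 * (2 * (2 * s - 1) * (1 - t) * W' t ^+ 2).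
have dSE (t : R) : 0 < t -> has_derivative S t (dS t).
  move=> t0; have hW := has_derivative_frac_poly (L n) s0 t0.
  have hW' := has_derivative_frac_poly (L n) s10 t0.
  have ode := frac_legendre_ode n s1 t0.
  rewrite /S /dS; apply: has_derivative_eq.
    apply: has_derivativeD; first by apply: has_derivativeX; exact: hW.
    apply: has_derivativeM; first exact: has_derivative_cst.
    apply: has_derivativeM; last by apply: has_derivativeX; exact: hW'.
    by apply: has_derivativeM; [exact: has_derivative_id|apply: has_derivativeD; [exact: has_derivative_cst|apply: has_derivativeN; exact: has_derivative_id]].
  rewrite /=; move: ode; rewrite -/W -/W' -/c.
  move: (frac_poly (s - 1 - 1) (L n) t) (W t) (W' t) => w'' w w' ode.
  have cw : c * w = 2 * (s - 1) * (1 - t) * w' - t * (2 - t) * w''.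
    by apply/eqP; rewrite -subr_eq0 -[X in _ == X]ode; apply/eqP; ring.
  have -> : w = c^-1 * (2 * (s - 1) * (1 - t) * w' - t * (2 - t) * w'').
    by rewrite -cw mulKf// gt_eqF.
  by move: c^-1 => d; rewrite !expr1; ring.
have cS (a b : R) : 0 <= a -> b <= 2 -> {within `[a, b], continuous S}.
  move=> a0 b2.
  have sub : `[a, b] `<=` `[0, 2] by move=> t /=; rewrite !in_itv/= => /andP[at_ tb]; rewrite (le_trans a0)// (le_trans tb).
  apply: (continuous_subspaceW sub).
  have cW := @frac_poly_continuous _ s (L n) 2 s0; have cW' := @frac_poly_continuous _ (s - 1) (L n) 2 s10.
  have cid : {within `[0, 2], continuous (fun t : R => t)} by apply: continuous_subspaceT => ?; exact: cvg_id.
  move=> t; apply: cvgD; first by apply: (cvgM (cW t) (cW t)).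
  apply: cvgM; first exact: cvg_cst.
  apply: cvgM; last by apply: (cvgM (cW' t) (cW' t)).
  by apply: cvgM; [exact: cid|apply: cvgD; [exact: cvg_cst|apply: cvgN; exact: cid]].
have S1 : S z <= S 1.
  have [z1|z1] := leP z 1.
    apply: (@ge0_derive_le _ S dS z 1 z1); first by apply: cS => //; rewrite ler1n.
      by move=> t /andP[zt t1]; apply: dSE; exact: le_lt_trans zt.
    move=> t /andP[zt t1]; rewrite /dS mulr_ge0 ?invr_ge0 ?(ltW c0)//.
    by rewrite mulr_ge0 ?sqr_ge0// mulr_ge0; lra.
  rewrite -lerN2; apply: (@ge0_derive_le _ (\- S) (fun t => - dS t) 1 z (ltW z1)).
  - by move=> t; apply: cvgN; apply: cS.
  - by move=> t /andP[t1 _]; apply: has_derivativeN; apply: dSE; exact: lt_trans t1.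
  - move=> t /andP[t1 tz]; rewrite /dS -mulrN mulr_ge0 ?invr_ge0 ?(ltW c0)//.
    by rewrite -mulNr mulr_ge0 ?sqr_ge0// -mulrN mulr_ge0; lra.
have K0 : 0 <= K n s by apply/ltW/legendre_max_gt0 => //; rewrite (lt_trans _ s0).
rewrite -ler_sqr ?nnegrE ?normr_ge0 ?K0// real_normK ?num_real//.
have WS : W z ^+ 2 <= S z.
  rewrite lerDl mulr_ge0 ?invr_ge0 ?(ltW c0)// mulr_ge0 ?sqr_ge0// mulr_ge0//; lra.
apply: (le_trans WS); apply: (le_trans S1).
have [x [y [xy ex ey]]] := frac_legendre1_angle s0 sn.
rewrite /S /W /W' -/(M n s) -/(M n (s - 1)) ex ey.
have hK := legendre_max_sqr_le (ltW s1) sn.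
move: hK; rewrite -/c; move: (K n s) (K n (s - 1)) => k k' hK.
have -> : k ^+ 2 = (x * k) ^+ 2 + (y * k) ^+ 2 by rewrite !exprMn -mulrDl xy mul1r.
rewrite lerD2l (_ : 1 * (2 - 1) * (y * k') ^+ 2 = y ^+ 2 * k' ^+ 2); last by ring.
by rewrite mulrCA exprMn ler_wpM2l ?sqr_ge0// mulrC ler_pdivrMr// mulrC.
Qed.

End fractional_legendre_bound.

Section tail_bounds.
Context {R : realType}.
Implicit Types (n N : nat) (mu x y z : R).

Definition uniform_bound mu N : R :=
  1 / (2 `^ (mu - 1) * (mu - 1 / 2) * Num.sqrt pi) *
  (Gamma ((N%:R - mu + 1) / 2) / Gamma ((N%:R + mu) / 2)).

Definition weighted_bound mu N : R :=
  1 / (2 `^ (mu - 1) * mu * pi) *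
  (Gamma ((N%:R - mu + 1) / 2) / Gamma ((N%:R + mu + 1) / 2)).

Let ratio_bound x y : 0 < x -> x <= y ->
  Gamma (x + 2^-1) * Gamma y / (Gamma x * Gamma (y + 2^-1)) <= (1 + x / y) / 2.
Proof.
move=> x0 xy; have y0 : 0 < y by exact: lt_le_trans xy.
have x0' : 0 < x + 2^-1 by lra.
have y0' : 0 < y + 2^-1 by lra.
have := Gamma_addhalf_ratio x0 xy.
have := Gamma_gt0 x0; have := Gamma_gt0 y0; have := Gamma_gt0 x0'; have := Gamma_gt0 y0'.
move: (Gamma (x + 2^-1)) (Gamma x) (Gamma (y + 2^-1)) (Gamma y) => x' gx y' gy y'0 x'0 gy0 gx0 h.
set r := (_ / _); have r2 : r ^+ 2 <= x / y.
  rewrite ler_pdivlMr// /r expr_div_n mulrAC ler_pdivrMr ?exprn_gt0 ?mulr_gt0//.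
  rewrite (_ : (x' * gy) ^+ 2 * y = y * x' ^+ 2 * gy ^+ 2); last by ring.
  by apply: (le_trans h); rewrite (_ : _ * _ * _ = x * (gx * y') ^+ 2) //; ring.
have : 0 <= (r - 1) ^+ 2 by exact: sqr_ge0.
by rewrite sqrrB expr1n mulr1; lra.
Qed.

Let powR2 mu : 2 `^ (- (mu + 1)) = (4 * 2 `^ (mu - 1))^-1 :> R.
Proof.
rewrite powRN; congr (_^-1).
have -> : mu + 1 = 2 + (mu - 1) by ring.
rewrite (@powRD _ 2 2 (mu - 1)); last by apply/implyP => _; rewrite pnatr_eq0.
by rewrite powR_mulrn// -natrX.
Qed.

Lemma uniform_bound_step mu n : 1 / 2 < mu -> mu <= n%:R ->
  (n.+1%:R + 2^-1) * legendre_max n.+1 (mu + 1) <= uniform_bound mu n - uniform_bound mu n.+1.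
Proof.
move=> mu2 mun.
pose x : R := (n%:R - mu + 1) / 2; pose y : R := (n%:R + mu) / 2.
have x0 : 0 < x by rewrite /x; lra.
have xy : x < y by rewrite /x /y; lra.
have y0 : 0 < y by exact: lt_trans xy.
have y10 : 0 < y + 1 by lra.
have x0' : 0 < x + 2^-1 by lra.
have y0' : 0 < y + 2^-1 by lra.
have := ratio_bound x0 (ltW xy).
rewrite /legendre_max /uniform_bound powR2 -[n.+1%:R]natr1 -/x -/y.
have -> : (n%:R + 1 - (mu + 1) + 1) / 2 = x by rewrite /x; field.
have -> : (n%:R + 1 + (mu + 1)) / 2 + 1 = y + 1 + 1 by rewrite /y; field.
have -> : (n%:R + 1 - mu + 1) / 2 = x + 2^-1 by rewrite /x; field.
have -> : (n%:R + 1 + mu) / 2 = y + 2^-1 by rewrite /y; field.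
have -> : n%:R + 1 + 2^-1 = x + y + 1 by rewrite /x /y; field.
have -> : mu - 1 / 2 = y - x by rewrite /x /y; field.
rewrite (GammaS y10) (GammaS y0).
have : 0 < 2 `^ (mu - 1) :> R by exact: powR_gt0.
have : 0 < Num.sqrt pi :> R by rewrite sqrtr_gt0 pi_gt0.
have := Gamma_gt0 x0; have := Gamma_gt0 y0; have := Gamma_gt0 x0'; have := Gamma_gt0 y0'.
move: (Gamma (x + 2^-1)) (Gamma x) (Gamma (y + 2^-1)) (Gamma y) (2 `^ _) (Num.sqrt _) => x' gx y' gy t p y'0 x'0 gy0 gx0 p0 t0.
move: x y x0 xy y0 y10 {x0' y0' mun mu2} => x y x0 xy y0 y10.
have yx0 : 0 < y - x by rewrite subr_gt0.
set r := x' * gy / _ => hr.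
have -> : (x + y + 1) * ((4 * t)^-1 / p * (gx / ((y + 1) * (y * gy)))) =
    gx / (gy * t * p * (y - x)) * ((x + y + 1) * (y - x) / (4 * y * (y + 1))).
  by field; rewrite !gt_eqF.
have -> : 1 / (t * (y - x) * p) * (gx / gy) - 1 / (t * (y - x) * p) * (x' / y') =
    gx / (gy * t * p * (y - x)) * (1 - r).
  by rewrite /r; field; rewrite !gt_eqF.
apply: ler_wpM2l; first by rewrite ltW// divr_gt0// !mulr_gt0.
rewrite lerBrDr -lerBrDl; apply: (le_trans hr).
have -> : 1 - (x + y + 1) * (y - x) / (4 * y * (y + 1)) = (1 + x / y) / 2 + (y - x) * (y - x + 1) / (4 * y * (y + 1)).
  by field; rewrite !gt_eqF.
by rewrite lerDl ltW// divr_gt0// !mulr_gt0// addr_gt0.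
Qed.

Lemma weighted_bound_step mu n : 0 < mu -> mu <= n%:R ->
  (n.+1%:R + 2^-1) * legendre_max n.+1 (mu + 1) * Num.sqrt (2 / (pi * (n.+1%:R + 2^-1)))
  <= weighted_bound mu n - weighted_bound mu n.+1.
Proof.
move=> mu0 mun.
pose x : R := (n%:R - mu + 1) / 2; pose z : R := (n%:R + mu + 1) / 2.
have x0 : 0 < x by rewrite /x; lra.
have xz : x < z by rewrite /x /z; lra.
have z0 : 0 < z by exact: lt_trans xz.
have x0' : 0 < x + 2^-1 by lra.
have z0' : 0 < z + 2^-1 by lra.
have := ratio_bound x0 (ltW xz); have := Gamma_addhalf_ge z0.
rewrite /legendre_max /weighted_bound powR2 -[n.+1%:R]natr1 -/x -/z.
have -> : (n%:R + 1 - (mu + 1) + 1) / 2 = x by rewrite /x; field.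
have -> : (n%:R + 1 + (mu + 1)) / 2 + 1 = z + 2^-1 + 1 by rewrite /z; field.
have -> : (n%:R + 1 - mu + 1) / 2 = x + 2^-1 by rewrite /x; field.
have -> : (n%:R + 1 + mu + 1) / 2 = z + 2^-1 by rewrite /z; field.
have -> : n%:R + 1 + 2^-1 = x + z + 2^-1 by rewrite /x /z; field.
have -> : mu = z - x by rewrite /x /z; field.
rewrite (GammaS z0').
have : 0 < 2 `^ (z - x - 1) :> R by exact: powR_gt0.
have : 0 < Num.sqrt pi :> R by rewrite sqrtr_gt0 pi_gt0.
have pE : pi = Num.sqrt pi ^+ 2 :> R by rewrite sqr_sqrtr// pi_ge0.
have w0 : 0 < x + z + 2^-1 by lra.
have -> : Num.sqrt (2 / (pi * (x + z + 2^-1))) = Num.sqrt 2 / (Num.sqrt pi * Num.sqrt (x + z + 2^-1)).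
  by rewrite sqrtrM ?sqrtrV ?sqrtrM// ?mulr_ge0 ?pi_ge0// ltW.
have wE : x + z + 2^-1 = Num.sqrt (x + z + 2^-1) ^+ 2 by rewrite sqr_sqrtr// ltW.
have : 0 < Num.sqrt 2 :> R by rewrite sqrtr_gt0.
have := sqr_sqrtr (ler0n R 2).
have : 0 < Num.sqrt (x + z + 2^-1) by rewrite sqrtr_gt0.
move: wE pE; clear mun mu0.
have := Gamma_gt0 x0; have := Gamma_gt0 z0; have := Gamma_gt0 x0'; have := Gamma_gt0 z0'.
move: (Gamma (x + 2^-1)) (Gamma x) (Gamma (z + 2^-1)) (Gamma z) (2 `^ _) (Num.sqrt pi) (Num.sqrt 2) (Num.sqrt (x + z + 2^-1)) => x' gx z' gz t p q w z'0 x'0 gz0 gx0 wE pE w00 q2 q0 p0 t0 hz.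
rewrite pE.
move: x z x0 xz z0 x0' z0' w0 wE hz => x z x0 xz z0 x0' z0' w0 wE hz.
have zx0 : 0 < z - x by rewrite subr_gt0.
set r := x' * gz / _ => hr.
rewrite [in leLHS]wE.
have -> : w ^+ 2 * ((4 * t)^-1 / p * (gx / ((z + 2^-1) * z'))) * (q / (p * w)) =
    gx / (gz * t * p ^+ 2 * (z - x)) * (q * w * (z - x) * gz / (4 * (z + 2^-1) * z')).
  by field; rewrite ?gt_eqF//; lra.
have -> : 1 / (t * (z - x) * p ^+ 2) * (gx / gz) - 1 / (t * (z - x) * p ^+ 2) * (x' / z') =
    gx / (gz * t * p ^+ 2 * (z - x)) * (1 - r).
  by rewrite /r; field; rewrite !gt_eqF.
apply: ler_wpM2l; first by rewrite ltW// divr_gt0// !mulr_gt0// exprn_gt0.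
have {}hr : (z - x) / (2 * z) <= 1 - r.
  rewrite lerBrDr -lerBrDl; apply: (le_trans hr); rewrite le_eqVlt; apply/orP; left; apply/eqP.
  by field; rewrite ?gt_eqF//; lra.
apply: le_trans hr.
have -> : q * w * (z - x) * gz / (4 * (z + 2^-1) * z') = (z - x) / (2 * z) * (q * w * z * gz / (2 * (z + 2^-1) * z')).
  by field; rewrite ?gt_eqF//; lra.
rewrite ler_piMr//; first by rewrite ltW// divr_gt0// mulr_gt0.
have h1 : 0 < q * w * z * gz by rewrite !mulr_gt0.
have h2 : 0 < 2 * (z + 2^-1) * z' by rewrite !mulr_gt0.
rewrite ler_pdivrMr// mul1r -ler_sqr; [|exact: ltW h1|exact: ltW h2].
have -> : (q * w * z * gz) ^+ 2 = q ^+ 2 * w ^+ 2 * (z ^+ 2 * gz ^+ 2) by ring.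
rewrite q2 -wE; apply: (@le_trans _ _ (2 * (x + z + 2^-1) * ((z + 2^-1) * z' ^+ 2))).
  by rewrite ler_wpM2l// ltW// mulr_gt0.
rewrite -subr_ge0.
have -> : (2 * (z + 2^-1) * z') ^+ 2 - 2 * (x + z + 2^-1) * ((z + 2^-1) * z' ^+ 2) = 2 * ((z - x) + 2^-1) * (z + 2^-1) * z' ^+ 2.
  by field.
by rewrite ltW// !mulr_gt0 ?exprn_gt0// addr_gt0.
Qed.

Lemma uniform_bound_gt0 mu N : 1 / 2 < mu -> mu <= N%:R -> 0 < uniform_bound mu N.
Proof.
move=> mu0 muN.
have h1 : 0 < (N%:R - mu + 1) / 2 :> R by lra.
have h2 : 0 < (N%:R + mu) / 2 :> R by lra.
have h3 : 0 < mu - 1 / 2 by lra.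
by rewrite /uniform_bound mulr_gt0 ?divr_gt0 ?mulr_gt0 ?powR_gt0 ?sqrtr_gt0 ?pi_gt0 ?Gamma_gt0.
Qed.

Lemma weighted_bound_gt0 mu N : 0 < mu -> mu <= N%:R -> 0 < weighted_bound mu N.
Proof.
move=> mu0 muN.
have h1 : 0 < (N%:R - mu + 1) / 2 :> R by lra.
have h2 : 0 < (N%:R + mu + 1) / 2 :> R by lra.
by rewrite /weighted_bound mulr_gt0 ?divr_gt0 ?mulr_gt0 ?powR_gt0 ?pi_gt0 ?Gamma_gt0.
Qed.

End tail_bounds.

Section monotone_density.
Context {R : realType}.
Implicit Types (a b x y : R) (n i : nat).
Local Notation mu := (@lebesgue_measure R).

Definition grid a b n i : R := a + (b - a) * (i%:R / n%:R).

Lemma grid0 a b n : grid a b n 0 = a.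
Proof. by rewrite /grid mul0r mulr0 addr0. Qed.

Lemma gridn a b n : (0 < n)%N -> grid a b n n = b.
Proof.
by move=> n0; rewrite /grid divff ?pnatr_eq0 -?lt0n// mulr1 addrC subrK.
Qed.

Lemma gridS a b n i : grid a b n i.+1 - grid a b n i = (b - a) / n%:R.
Proof. by rewrite /grid -[i.+1%:R]natr1; move: n%:R^-1 => c; ring. Qed.

Lemma grid_le a b n i j : a <= b -> (i <= j)%N -> grid a b n i <= grid a b n j.
Proof.
move=> ab ij; rewrite lerD2l ler_wpM2l ?subr_ge0//.
by rewrite ler_wpM2r ?invr_ge0// ler_nat.
Qed.

Lemma grid_cell (x_ : nat -> R) n y : x_ 0%N < y -> y <= x_ n ->
  exists2 i, (i < n)%N & x_ i < y <= x_ i.+1.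
Proof.
move=> x0y; elim: n => [|n IH] yn; first by have := lt_le_trans x0y yn; rewrite ltxx.
have [/IH[i i_n iy]|ny] := leP y (x_ n); first by exists i => //; exact: ltnW.
by exists n => //; rewrite ny.
Qed.

Lemma lebesgue_stieltjes_itvoc (H : cumulative R R) x y : x <= y ->
  lebesgue_stieltjes_measure H `]x, y]%classic = (H y - H x)%:E.
Proof.
move=> xy; rewrite /lebesgue_stieltjes_measure /measure_extension/=.
by rewrite measurable_mu_extE/= ?wlength_itv_bnd//; exact: is_ocitv.
Qed.

Lemma monotone_density a b (H : cumulative R R) : a < b ->
  (forall e : R, 0 < e -> exists2 d : R, 0 < d & forall n (S : pred nat),
     \sum_(i < n.+1 | S i) ((b - a) / n.+1%:R) < d ->
     \sum_(i < n.+1 | S i) (H (grid a b n.+1 i.+1) - H (grid a b n.+1 i)) <= e) ->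
  exists h : R -> R, [/\ forall x, 0 <= h x,
    mu.-integrable setT (EFin \o h) &
    forall x, a <= x <= b -> (\int[mu]_(t in `]a, x]) (h t)%:E = (H x - H a)%:E)%E].
Proof.
move=> ab acH.
pose ls := lebesgue_stieltjes_measure H.
have lsE := lebesgue_stieltjes_itvoc H.
have mab : measurable (`]a, b]%classic : set (measurableTypeR R)) by exact: measurable_itv.
have lsab : (ls `]a, b]%classic < +oo)%E by rewrite /ls lsE ?ltry// ltW.
pose nu : {finite_measure set (measurableTypeR R) -> \bar R} := mfrestr mab lsab.
have nuE (x y : R) : a <= x -> x <= y -> y <= b -> nu `]x, y]%classic = (H y - H x)%:E.
  move=> ax xy yb; rewrite /nu/= /mfrestr/= /mrestr setIidl; first exact: lsE.
  by move=> t /=; rewrite !in_itv/= => /andP[xt ty]; rewrite (le_lt_trans ax)// (le_trans ty).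
have dom : nu `<< mu.
  apply/null_content_dominatesP => N mN N0.
  apply/eqP; rewrite -measure_le0; apply/lee_addgt0Pr => e e0; rewrite add0e.
  have muN : (mu N <= 0)%E by rewrite le_eqVlt; apply/orP; left; apply/eqP; exact: N0.
  have [d d0 hd] := acH _ e0.
  have [U [oU NU Ud]] : exists U : set R, [/\ open U, N `<=` U & (mu (U `\` N) < d%:E)%E].
    by apply: lebesgue_regularity_outer => //; exact: le_lt_trans muN (ltry _).
  have mU : measurable (U : set (measurableTypeR R)) by exact: open_measurable.
  have {}Ud : (mu U < d%:E)%E.
    apply: le_lt_trans Ud; rewrite -(setDUK NU) (le_trans (measureU2 _ _ _))//; first exact: measurableD.
    by rewrite setDUK// -[leRHS]add0e; apply: leeD.
  pose cell n i : set R := `]grid a b n.+1 i, grid a b n.+1 i.+1]%classic.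
  have mcell n i : measurable (cell n i : set (measurableTypeR R)) by exact: measurable_itv.
  pose S n : pred nat := fun i => `[< cell n i `<=` U >].
  pose V n : set R := \big[setU/set0]_(i < n.+1 | S n i) cell n i.
  have mV n : measurable (V n : set (measurableTypeR R)) by apply: bigsetU_measurable => i _; exact: mcell.
  have tcell n : trivIset [set: 'I_n.+1] (fun i : 'I_n.+1 => cell n i).
    have disj i j : (i < j)%N -> cell n i `&` cell n j = set0.
      move=> ij; rewrite -subset0 => t []; rewrite /cell /= !in_itv/= => /andP[_ t1] /andP[t2 _].
      by have := le_lt_trans t1 (le_lt_trans (grid_le _ (ltW ab) ij) t2); rewrite ltxx.
    apply/trivIsetP => i j _ _; rewrite -(inj_eq val_inj) neq_ltn => /orP[|] ij.
      exact: disj.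
    by rewrite setIC; exact: disj.
  have Ve n : (nu (V n) <= e%:E)%E.
    have c0 : 0 <= (b - a) / n.+1%:R by rewrite divr_ge0// subr_ge0 ltW.
    have gS i : grid a b n.+1 i <= grid a b n.+1 i.+1 by rewrite -subr_ge0 gridS.
    rewrite /V measure_bigsetU_ord//.
    rewrite (eq_bigr (fun i : 'I_n.+1 => (H (grid a b n.+1 i.+1) - H (grid a b n.+1 i))%:E)).
      rewrite sumEFin lee_fin; apply: hd; rewrite -lte_fin -sumEFin.
      rewrite (eq_bigr (fun i : 'I_n.+1 => mu (cell n i))); last first.
        move=> i _; rewrite /cell lebesgue_measure_itv/= lte_fin -EFinB gridS.
        case: ltP => // h; congr EFin; rewrite -(gridS a b n.+1 i).
        by apply/eqP; rewrite subr_eq0 eq_le h gS.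
      rewrite -measure_bigsetU_ord//; apply: le_lt_trans Ud; apply: le_measure.
      - by rewrite inE; exact: mV.
      - by rewrite inE.
      - by rewrite /V => t; rewrite -bigcup_seq_cond => -[i /= /andP[_ /asboolP iU] it]; exact: iU.
    move=> i _; apply: nuE => //.
      by rewrite -{1}(grid0 a b n.+1) grid_le// ltW.
    by rewrite -{2}(@gridn a b n.+1)// grid_le// ltW.
  pose W n : set R := \bigcap_(j in [set j | (n <= j)%N]) V j.
  have mW n : measurable (W n : set (measurableTypeR R)) by apply: bigcap_measurable => [|j _]; [exists n => /=|exact: mV].
  have cvW : nu \o W @ \oo --> nu (\bigcup_n W n).
    apply: nondecreasing_cvg_mu => //; first exact: bigcup_measurable.
    move=> m n mn; apply/subsetPset => t Wt j /= nj; apply: Wt => /=; exact: leq_trans nj.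
  have NW : N `&` `]a, b]%classic `<=` \bigcup_n W n.
    move=> y [/NU Uy] /=; rewrite in_itv/= => /andP[ay yb].
    have [r /= r0 yr] : nbhs_ball y U by apply/nbhs_ballP; exact: open_nbhs_nbhs.
    exists (Num.truncn ((b - a) / r)) => // j /= hj.
    have [i ij /andP[yi iy]] : exists2 i, (i < j.+1)%N & grid a b j.+1 i < y <= grid a b j.+1 i.+1.
      by apply: grid_cell; rewrite ?grid0 ?gridn.
    rewrite /V -bigcup_seq_cond; exists (Ordinal ij) => /=; last by rewrite /cell/= in_itv/= yi.
    rewrite mem_index_enum/=; apply/asboolP => t; rewrite /cell/= in_itv/= => /andP[it ti].
    apply: yr; rewrite /ball/= ltr_norml.
    have : (b - a) / j.+1%:R < r.
      rewrite ltr_pdivrMr// mulrC -ltr_pdivrMr//; apply: (lt_le_trans (truncnS_gt _)).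
      by rewrite ler_nat.
    rewrite -(gridS a b j.+1 i) => h; move: yi iy it ti h.
    by move: (grid _ _ _ _) (grid _ _ _ _) => x1 x2; lra.
  have NE : (nu N <= nu (N `&` `]a, b]%classic))%E.
    by rewrite /nu/= /mfrestr /mrestr -setIA setIid.
  apply: (le_trans NE); have mNab : measurable (N `&` `]a, b]%classic : set (measurableTypeR R)) by exact: measurableI.
  apply: (@le_trans _ _ (nu (\bigcup_n W n))).
    apply: le_measure => //; [by rewrite inE|by rewrite inE; exact: bigcup_measurable].
  rewrite -(cvg_lim _ cvW)//; apply: lime_le; first by apply/cvg_ex; eexists; exact: cvW.
  near=> n; apply: le_trans (Ve n); apply: le_measure.
  - by rewrite inE; exact: mW.
  - by rewrite inE; exact: mV.
  - by move=> t; apply => /=.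
have [f [f0 ffin intf fE]] := radon_nikodym_sigma_finite dom.
exists (fine \o f); split.
- by move=> x; exact: fine_ge0.
- by apply: eq_integrable intf => // x _ /=; rewrite fineK.
- move=> x /andP[ax xb]; rewrite -(nuE a x)// (fE _ (measurable_itv _)).
  by apply: eq_integral => t _; rewrite /= fineK.
Unshelve. all: by end_near. Qed.

End monotone_density.

Section absolutely_continuous_density.
Context {R : realType}.
Implicit Types (a b c d e x y : R) (n i : nat) (g : R -> R) (L : seq (R * R)).
Local Notation mu := (@lebesgue_measure R).
Local Notation TV := total_variation.

Lemma grid_itv a b n i : a <= b -> (i <= n)%N -> (0 < n)%N -> a <= grid a b n i <= b.
Proof.
move=> ab i_n n0; have := grid_le n ab (leq0n i); have := grid_le n ab i_n.
by rewrite grid0 gridn// => -> ->.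
Qed.

(* A finite family of nonoverlapping intervals (p.2, p.1), listed from left to right. *)
Let chain a b L := all (fun p => [&& a <= p.2, p.2 < p.1 & p.1 <= b]) L &&
  pairwise (fun p q : R * R => p.1 <= q.2) L.

Let chainW a c d b L : a <= c -> d <= b -> chain c d L -> chain a b L.
Proof.
move=> ac db /andP[/allP La Lp]; rewrite /chain Lp andbT.
by apply/allP => p /La /and3P[cp -> pd]; rewrite (le_trans ac cp) (le_trans pd db).
Qed.

Let chain_cat a c b L M : a <= c -> c <= b -> chain a c L -> chain c b M -> chain a b (L ++ M).
Proof.
move=> ac cb /andP[/allP La Lp] /andP[/allP Ma Mp]; rewrite /chain all_cat pairwise_cat Lp Mp !andbT.
rewrite -andbA; apply/and3P; split.
- by apply/allP => p /La /and3P[-> ->] /le_trans ->.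
- by apply/allP => p /Ma /and3P[h -> ->]; rewrite (le_trans ac).
- apply/allrelP => p q /La /and3P[_ _ pc] /Ma /and3P[cq _ _]; exact: le_trans pc cq.
Qed.

Let chain_partition c d l : itv_partition c d l ->
  chain c d (zip l (c :: l)) /\ \sum_(p <- zip l (c :: l)) (p.1 - p.2) = d - c.
Proof.
elim: l c => [|x l IH] c cl.
  by rewrite /= big_nil (itv_partition_nil cl) subrr.
have xl := itv_partition_cons cl; have cx : c < x by case: cl => /= /andP[].
have xd := itv_partition_le xl; have [ch sm] := IH _ xl.
rewrite /= big_cons sm /=; split; last by ring.
rewrite -cat1s; apply: (chain_cat (ltW cx) xd) => //.
by rewrite /chain /= lexx cx lexx.
Qed.

Let ac_chain a b g : absolutely_continuous a b g -> forall e, 0 < e ->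
  exists2 d : R, 0 < d & forall L, chain a b L ->
    \sum_(p <- L) (p.1 - p.2) < d -> \sum_(p <- L) `|g p.1 - g p.2| < e.
Proof.
move=> acg e /acg[d d0 hd]; exists d => // L /andP[/allP La /(pairwiseP (0, 0)) Lp].
rewrite !(big_nth (0, 0)) !big_mkord => Ld.
apply: (hd (size L) (fun i : 'I__ => (nth (0, 0) L i).2) (fun i : 'I__ => (nth (0, 0) L i).1)) => //.
  by move=> i; have /and3P[] := La _ (mem_nth (0, 0) (ltn_ord i)).
have disj (i j : 'I_(size L)) : (i < j)%N ->
    `](nth (0, 0) L i).2, (nth (0, 0) L i).1[%classic `&` `](nth (0, 0) L j).2, (nth (0, 0) L j).1[%classic = set0.
  move=> ij; rewrite -subset0 => t [] /=; rewrite !in_itv/= => /andP[_ ti] /andP[tj _].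
  by have := lt_trans tj (lt_le_trans ti (Lp i j (ltn_ord i) (ltn_ord j) ij)); rewrite ltxx.
apply/trivIsetP => i j _ _; rewrite -(inj_eq val_inj) neq_ltn => /orP[|] ij; first exact: disj.
by rewrite setIC; exact: disj.
Qed.

Let tv_chain g (x_ : nat -> R) (S : pred nat) n e : 0 < e ->
  (forall i, x_ i <= x_ i.+1) ->
  (forall i, (i < n)%N -> TV (x_ i) (x_ i.+1) g \is a fin_num) ->
  exists L, [/\ chain (x_ 0%N) (x_ n) L,
    \sum_(p <- L) (p.1 - p.2) = \sum_(i < n | S i) (x_ i.+1 - x_ i) &
    \sum_(i < n | S i) (fine (TV (x_ i) (x_ i.+1) g) - e) <= \sum_(p <- L) `|g p.1 - g p.2|].
Proof.
move=> e0 ndx; elim: n => [|n IH] fin; first by exists [::]; rewrite !big_ord0 !big_nil.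
have [L [cL dL vL]] := IH (fun i i_n => fin i (ltnW i_n)).
have x0n : x_ 0%N <= x_ n by elim: (n) => // k /le_trans ->.
have recS (F : nat -> R) : \sum_(i < n.+1 | S i) F i = \sum_(i < n | S i) F i + (if S n then F n else 0).
  by rewrite big_mkcond big_ord_recr /= -big_mkcond.
rewrite (recS (fun i => x_ i.+1 - x_ i)) (recS (fun i => fine (TV (x_ i) (x_ i.+1) g) - e)).
case: (S n); last first.
  by exists L; rewrite !addr0; split => //; exact: chainW cL.
have [_ [_ [l pl <-] <-] hl] := ub_ereal_sup_adherent e0 (fin n (ltnSn n)).
have [cl dl] := chain_partition pl.
exists (L ++ zip l (x_ n :: l)); rewrite !big_cat /= dL dl; split; [exact: chain_cat cl|by []|].
apply: lerD => //; rewrite -(@variation_zip _ _ _ g _ pl) -lee_fin EFinB fineK; [exact: ltW|exact: fin].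
Qed.

Lemma absolutely_continuous_bounded_variation a b g : a <= b ->
  absolutely_continuous a b g -> bounded_variation a b g.
Proof.
rewrite le_eqVlt => /predU1P[<- _|ab acg]; first exact: bounded_variationxx.
have [d d0 hd] := ac_chain acg ltr01.
pose n := Num.truncn ((b - a) / d).
have nd : (b - a) / n.+1%:R < d.
  by rewrite ltr_pdivrMr// mulrC -ltr_pdivrMr//; exact: truncnS_gt.
pose x_ := grid a b n.+1.
have nx i j : (i <= j)%N -> x_ i <= x_ j by move=> ij; rewrite grid_le// ltW.
have cell i : (i < n.+1)%N -> (TV (x_ i) (x_ i.+1) g <= 1%:E)%E.
  move=> i_n; apply: ge_ereal_sup => _ [_ [l pl <-] <-]; rewrite lee_fin.
  have [cl dl] := chain_partition pl.
  rewrite (@variation_zip _ _ _ g _ pl) ltW// hd//; last by rewrite dl gridS.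
  have ax : a <= x_ i by rewrite -[leLHS](grid0 a b n.+1) nx.
  have xb : x_ i.+1 <= b by rewrite -[leRHS](@gridn _ a b n.+1) ?nx.
  exact: chainW cl.
apply/(bounded_variationP _ (ltW ab)).
suff H i : (i <= n.+1)%N -> TV a (x_ i) g \is a fin_num by have := H _ (leqnn n.+1); rewrite /x_ gridn.
elim: i => [_|i IH i_n]; first by rewrite /x_ grid0 total_variationxx.
have ax : a <= x_ i by rewrite -[leLHS](grid0 a b n.+1) nx.
rewrite (total_variationD g ax (nx _ _ (leqnSn i))) fin_numD (IH (ltnW i_n)) /=.
rewrite ge0_fin_numE ?(le_lt_trans (cell i i_n)) ?ltry//.
by apply: total_variation_ge0; exact: nx.
Qed.

Lemma absolutely_continuous_continuous a b g x : absolutely_continuous a b g ->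
  a <= x <= b -> forall e, 0 < e -> exists2 d, 0 < d & forall y, a <= y <= b -> `|y - x| < d -> `|g y - g x| < e.
Proof.
move=> acg /andP[ax xb] e e0; have [d d0 hd] := ac_chain acg e0.
exists d => // y /andP[ay yb] yx.
have [yltx|xlty|->] := ltgtP y x; last by rewrite subrr normr0.
- have := hd [:: (x, y)]; rewrite /chain/= !big_cons !big_nil !addr0 /= ay yltx xb distrC; apply => //.
  by rewrite distrC ger0_norm// subr_ge0 ltW in yx.
- have := hd [:: (y, x)]; rewrite /chain/= !big_cons !big_nil !addr0 /= ax xlty yb; apply => //.
  by rewrite ger0_norm// subr_ge0 ltW in yx.
Qed.

Let clamp a b F x : R := F (Num.max a (Num.min b x)).

Let clamp_density a b (F : R -> R) : a < b ->
  (forall x y, a <= x -> x <= y -> y <= b -> F x <= F y) ->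
  (forall x e, a <= x <= b -> 0 < e -> exists2 d, 0 < d & forall y, a <= y <= b -> `|y - x| < d -> `|F y - F x| < e) ->
  (forall e, 0 < e -> exists2 d, 0 < d & forall n (S : pred nat),
     \sum_(i < n.+1 | S i) ((b - a) / n.+1%:R) < d ->
     \sum_(i < n.+1 | S i) (F (grid a b n.+1 i.+1) - F (grid a b n.+1 i)) <= e) ->
  exists h : R -> R,
    mu.-integrable setT (EFin \o h) /\
    forall x, a <= x <= b -> \int[mu]_(t in `[a, x]) h t = F x - F a.
Proof.
move=> ab ndF cF acF.
pose H := clamp a b F.
have clampE x : a <= x <= b -> H x = F x.
  by move=> /andP[ax xb]; rewrite /H /clamp (min_idPr xb) (max_idPr ax).
have ndH : {homo H : x y / x <= y}.
  move=> x y xy; apply: ndF.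
  - by rewrite le_max lexx.
  - by rewrite ge_max !le_max lexx /= le_min !ge_min lexx xy !orbT.
  - by rewrite ge_max ge_min (ltW ab) lexx.
have lip x y : `|Num.max a (Num.min b y) - Num.max a (Num.min b x)| <= `|y - x|.
  have := ler_norm (y - x); have := ler_norm (- (y - x)); rewrite normrN ler_norml.
  move: (normr_ge0 (y - x)); move: `|y - x| ab => m ab m0 h1 h2.
  by case: (leP b y) => h3; case: (leP b x) => h4; case: (leP a b) => h5;
     case: (leP a x) => h6; case: (leP a y) => h7; lra.
have rcH : right_continuous H.
  apply: right_continuousW => x; apply/cvgrPdist_lt => e e0.
  have cab y : a <= Num.max a (Num.min b y) <= b by rewrite le_max lexx ge_max ge_min (ltW ab) lexx.
  have [d d0 hd] := cF _ _ (cab x) e0.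
  near=> y; rewrite distrC; apply: hd; first exact: cab.
  have : `|y - x| < d by rewrite distrC; near: y; exact: cvgr_dist_lt.
  exact: le_lt_trans (lip _ _).
pose Hc : cumulative R R := HB.pack H (isCumulative.Build R _ R H ndH rcH).
have [e e0|h [_ ih hE]] := @monotone_density R a b Hc ab.
  have [d d0 hd] := acF _ e0; exists d => // n S /hd; apply: le_trans.
  rewrite le_eqVlt; apply/orP; left; apply/eqP; apply: eq_bigr => i _.
  by rewrite /= !clampE// grid_itv// ?(ltW ab)// ltnW.
exists h; split => // x /[dup] xab /andP[ax xb].
have ih' : mu.-integrable `]a, x] (EFin \o h) by apply: integrableS ih.
rewrite -(Rintegral_itv_obnd_cbnd ih') /Rintegral (hE _ xab) /= !clampE// lexx ltW//.
Unshelve. all: by end_near. Qed.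

Lemma absolutely_continuous_density a b g : a < b -> absolutely_continuous a b g ->
  exists h : R -> R,
    mu.-integrable setT (EFin \o h) /\
    forall x, a <= x <= b -> \int[mu]_(t in `[a, x]) h t = g x - g a.
Proof.
move=> ab acg; have bvg := absolutely_continuous_bounded_variation (ltW ab) acg.
have fin c d : a <= c -> c <= d -> d <= b -> TV c d g \is a fin_num.
  move=> ac cd db; have := bounded_variationl (le_trans ac cd) db bvg.
  by move/(bounded_variationP _ (le_trans ac cd)); rewrite (total_variationD _ ac cd) fin_numD => /andP[].
pose F x := fine (TV a x g).
have FB c d : a <= c -> c <= d -> d <= b -> F d - F c = fine (TV c d g).
  move=> ac cd db; rewrite /F (total_variationD g ac cd) fineD ?fin//; last exact: le_trans db.
  by rewrite addrC addKr.
have Fle c d : a <= c -> c <= d -> d <= b -> `|g d - g c| <= F d - F c.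
  by move=> ac cd db; rewrite FB// -lee_fin fineK ?fin// total_variation_ge.
have acF e : 0 < e -> exists2 d, 0 < d & forall n (S : pred nat) x y, a <= x -> x <= y -> y <= b ->
     \sum_(i < n.+1 | S i) ((y - x) / n.+1%:R) < d ->
     \sum_(i < n.+1 | S i) (F (grid x y n.+1 i.+1) - F (grid x y n.+1 i)) <= e.
  move=> e0; have [d d0 hd] := ac_chain acg e0; exists d => // n S x y ax xy yb Sd.
  pose x_ := grid x y n.+1.
  have nx i j : (i <= j)%N -> x_ i <= x_ j by move=> ij; rewrite grid_le.
  have ax_ i : a <= x_ i by rewrite (le_trans ax)// -[leLHS](grid0 x y n.+1) nx.
  have xb_ i : (i <= n.+1)%N -> x_ i <= b by move=> i_n; rewrite (le_trans _ yb)// -[leRHS](@gridn R x y n.+1) ?nx.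
  have fin_ i : (i < n.+1)%N -> TV (x_ i) (x_ i.+1) g \is a fin_num by move=> i_n; rewrite fin ?nx ?xb_.
  apply/ler_addgt0Pr => z z0.
  have zn0 : 0 < z / n.+1%:R by rewrite divr_gt0.
  have [L [cL dL vL]] := tv_chain S zn0 (fun i => nx _ _ (leqnSn i)) fin_.
  have {}Sd : \sum_(p <- L) (p.1 - p.2) < d.
    by rewrite dL; under eq_bigr do rewrite gridS.
  have cL' : chain a b L by apply: chainW cL; [exact: ax_|exact: xb_].
  have := le_lt_trans vL (hd _ cL' Sd); rewrite sumrB => h.
  rewrite (eq_bigr (fun i : 'I_n.+1 => fine (TV (x_ i) (x_ i.+1) g))); last first.
    by move=> i _; rewrite FB ?ax_ ?nx ?xb_.
  have : \sum_(i < n.+1 | S i) z / n.+1%:R <= z.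
    apply: (@le_trans _ _ (\sum_(i < n.+1) z / n.+1%:R)).
      by rewrite [leRHS](bigID (fun i : 'I_n.+1 => S i))/= lerDl sumr_ge0// => i _; exact: ltW.
    by rewrite sumr_const card_ord -(mulr_natr (z / _)) divfK ?pnatr_eq0.
  by move: h; move: (\sum_(i < n.+1 | S i) _) (\sum_(i < n.+1 | S i) _) => s1 s2; lra.
have cF x e : a <= x <= b -> 0 < e -> exists2 d, 0 < d & forall y, a <= y <= b -> `|y - x| < d -> `|F y - F x| < e.
  move=> /andP[ax xb] e0.
  have e20 : 0 < e / 2 by rewrite divr_gt0.
  have [d d0 hd] := acF _ e20; exists d => // y /andP[ay yb] yx.
  apply: le_lt_trans (_ : e / 2 < e); last by lra.
  have step c c' : a <= c -> c <= c' -> c' <= b -> c' - c < d -> F c' - F c <= e / 2.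
    move=> ac cc' c'b cd; have := hd 0%N xpredT c c' ac cc' c'b.
    by rewrite !big_ord1 divr1 grid0 gridn//; apply.
  have [xy|yx'] := lerP x y.
    rewrite ger0_norm ?subr_ge0 in yx => //; rewrite ger0_norm ?step//.
    exact: le_trans (Fle _ _ ax xy yb).
  rewrite distrC ger0_norm ?subr_ge0 ?(ltW yx') in yx => //.
  rewrite distrC ger0_norm ?step ?(ltW yx')//.
  exact: le_trans (Fle _ _ ay (ltW yx') xb).
have [|x e xab e0|e e0|h1 [ih1 h1E]] := @clamp_density a b F ab.
- by move=> x y ax xy yb; rewrite -subr_ge0; exact: le_trans (Fle _ _ ax xy yb).
- exact: cF.
- by have [d d0 hd] := acF _ e0; exists d => // n S; apply: hd => //; exact: ltW.
have [|x e xab e0|e e0|h2 [ih2 h2E]] := @clamp_density a b (fun x => F x - g x) ab.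
- move=> x y ax xy yb; have := Fle _ _ ax xy yb; rewrite ler_norml => /andP[_].
  by move: (F x) (F y) (g x) (g y) => p q r s; lra.
- have e20 : 0 < e / 2 by rewrite divr_gt0.
  have [d1 d10 hd1] := cF _ _ xab e20; have [d2 d20 hd2] := absolutely_continuous_continuous acg xab e20.
  exists (Num.min d1 d2); first by rewrite lt_min d10.
  move=> y yab; rewrite lt_min => /andP[/hd1 -/(_ yab) h1' /hd2 -/(_ yab) h2'].
  move: h1' h2'; rewrite !ltr_norml; move: (F x) (F y) (g x) (g y) => p q r s; lra.
- have e20 : 0 < e / 2 by rewrite divr_gt0.
  have [d d0 hd] := acF _ e20; exists d => // n S Sd.
  have := hd _ S _ _ (lexx a) (ltW ab) (lexx b) Sd => h.
  apply: (@le_trans _ _ (\sum_(i < n.+1 | S i) 2 * (F (grid a b n.+1 i.+1) - F (grid a b n.+1 i)))).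
    apply: ler_sum => i _.
    have := @Fle (grid a b n.+1 i) (grid a b n.+1 i.+1).
    have /andP[-> _] := @grid_itv a b n.+1 i (ltW ab) (ltnW (ltn_ord i)) isT.
    have /andP[_ ->] := @grid_itv a b n.+1 i.+1 (ltW ab) (ltn_ord i) isT.
    rewrite grid_le ?(ltW ab)// => /(_ isT isT isT).
    rewrite ler_norml => /andP[+ _]; move: (F _) (F _) (g _) (g _) => p q r s; lra.
  by rewrite -mulr_sumr -ler_pdivlMl// mulrC.
exists (fun x => h1 x - h2 x); split.
  exact: (integrableB measurableT ih1 ih2).
move=> x xab; rewrite RintegralB// ?h1E// ?h2E//.
- by ring.
- exact: integrableS ih1.
- exact: integrableS ih2.
Qed.

End absolutely_continuous_density.

Section ae_eq_integral.
Context d (T : measurableType d) (R : realType) (mu : {measure set T -> \bar R}).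
Local Open Scope ereal_scope.

Import HBNNSimple.

Let ge0_ae_le (f g : T -> \bar R) : (forall x, 0 <= f x) -> (forall x, 0 <= g x) ->
  (\forall x \ae mu, f x = g x) -> \int[mu]_x f x <= \int[mu]_x g x.
Proof.
move=> f0 g0 [N [mN N0 fgN]].
rewrite (ge0_integralTE _ f0) (ge0_integralTE _ g0).
apply: ge_ereal_sup => _ [h /= hf <-].
pose k := proj_nnsfun h (measurableC mN).
apply: ereal_sup_ubound; exists k => /=.
  move=> x; rewrite /k /proj_nnsfun /= mindicE.
  have [xN|xN] := boolP (x \in ~` N); rewrite ?mulr0// mulr1.
  apply: (le_trans (hf x)); rewrite (_ : f x = g x)//.
  by apply: contrapT => fgx; move: xN; rewrite inE; apply; exact: fgN.
rewrite -(integralT_nnsfun mu k) -(integralT_nnsfun mu h).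
apply: ae_eq_integral => //; first exact/measurable_EFinP; first exact/measurable_EFinP.
exists N; split => // x /= /not_implyP[_]; apply: contra_notP => xN.
by rewrite /k /proj_nnsfun /= mindicE mem_set ?mulr1.
Qed.

(* Neither function has to be measurable, the integral being a supremum over simple functions. *)
Lemma ae_eq_integralW (D : set T) (f g : T -> \bar R) : ae_eq mu D f g ->
  \int[mu]_(x in D) f x = \int[mu]_(x in D) g x.
Proof.
move=> fg; rewrite integral_mkcond [RHS]integral_mkcond.
have {}fg : \forall x \ae mu, (f \_ D) x = (g \_ D) x.
  apply: filterS fg => x fgx; rewrite /patch; case: ifPn => // /set_mem; exact: fgx.
rewrite integralE [RHS]integralE; congr (_ - _); apply/le_anti/andP; split; apply: ge0_ae_le => //;
  by apply: filterS fg => x; rewrite ?(funeposE, funenegE) => ->.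
Qed.

End ae_eq_integral.

Lemma is_derive_near_eq {R : realType} (f g : R -> R) (x d : R) :
  (\forall y \near x, f y = g y) -> has_derivative f x d -> has_derivative g x d.
Proof.
move=> fg; rewrite /has_derivative; exact: near_eq_is_derive.
Qed.

Lemma absolutely_continuous_derive {R : realType} (a b : R) (g : R -> R) : a < b ->
  absolutely_continuous a b g ->
  exists h : R -> R, [/\ (@lebesgue_measure R).-integrable setT (EFin \o h),
    forall x, a <= x <= b -> \int[@lebesgue_measure R]_(t in `[a, x]) h t = g x - g a &
    {ae @lebesgue_measure R, forall x, a < x < b -> has_derivative g x (h x)}].
Proof.
move=> ab acg; have [h [ih hE]] := absolutely_continuous_density ab acg.
exists h; split => //.
have lh : locally_integrable setT h by apply: open_integrable_locally => //; exact: openT.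
have ihy y : (@lebesgue_measure R).-integrable [set` Interval (BLeft a) (BRight y)] (EFin \o h).
  by apply: integrableS ih.
have := @FTC1 R h (BLeft a) ihy lh.
apply: filterS; first exact: (ae_filter_ringOfSetsType (@lebesgue_measure R)).
move=> x /= H /andP[ax xb].
have [dF FE] := H ax.
have : has_derivative (fun y => \int[@lebesgue_measure R]_(t in `[a, y]) h t + g a) x (h x).
  apply: has_derivative_eq; first by apply: has_derivativeD; [apply: DeriveDef dF _; exact: erefl|exact: has_derivative_cst].
  by rewrite addr0 -derive1E.
apply: is_derive_near_eq; near=> y; rewrite hE ?subrK//.
have : y \in `]a, b[ by near: y; apply: near_in_itvoo; rewrite in_itv/= ax.
by rewrite in_itv/= => /andP[ay yb]; rewrite !ltW.
Unshelve. all: by end_near. Qed.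

Section fubini_triangle.
Context {R : realType}.
Implicit Types (a b r x y C : R) (h phi : R -> R).
Local Notation mu := (@lebesgue_measure R).

Lemma integral_sub_powR a b r : a <= b -> 0 < r ->
  (\int[mu]_(x in `[a, b]) ((x - a) `^ (r - 1))%:E = ((b - a) `^ r / r)%:E)%E.
Proof.
rewrite le_eqVlt => /predU1P[<- r0|ab r0].
  by rewrite set_itv1 integral_set1 ?subrr ?powR0 ?gt_eqF ?mul0r.
have d (x : R) : a < x -> has_derivative (fun x => r^-1 * (x - a) `^ r) x ((x - a) `^ (r - 1)).
  move=> ax; apply: has_derivative_eq; first by apply: has_derivativeM; [exact: has_derivative_cst|apply: has_derivative_powR; [rewrite subr_gt0|apply: has_derivativeD; [exact: has_derivative_id|exact: has_derivative_cst]]].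
  by rewrite /= mul0r add0r addr0 mulr1 mulrA mulVf ?mul1r// gt_eqF.
have d' (x : R) : a < x -> has_derivative (fun x => (x - a) `^ (r - 1)) x ((r - 1) * (x - a) `^ (r - 1 - 1) * (1 + 0)).
  by move=> ax; apply: has_derivative_powR; [rewrite subr_gt0|apply: has_derivativeD; [exact: has_derivative_id|exact: has_derivative_cst]].
have c (x : R) : x \in `]a, b[ -> {for x, continuous (fun x => (x - a) `^ (r - 1))}.
  by rewrite in_itv/= => /andP[ax _]; exact: is_derive_continuous (d' _ ax).
have C : {within `[a, b], continuous (fun x => r^-1 * (x - a) `^ r)}.
  have C' : {within `[a, b], continuous (fun x => (x - a) `^ r)}.
    apply: within_continuous_powR => //.
      by move=> x; rewrite /= in_itv/= subr_ge0 => /andP[].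
    by apply: continuous_subspaceT => x; apply: cvgB; [exact: cvg_id|exact: cvg_cst].
  by move=> x; apply: cvgM; [exact: cvg_cst|exact: C'].
have D (x : R) : x \in `]a, b[ -> is_derive x 1 (fun x => r^-1 * (x - a) `^ r) ((x - a) `^ (r - 1)).
  by rewrite in_itv/= => /andP[ax _]; exact: d.
have ii : mu.-integrable `[a, b] (EFin \o (fun x => (x - a) `^ (r - 1))).
  by apply: ge0_FTC2_integrable ab _ c C D => x _; exact: powR_ge0.
have := FTC2_integrable ab ii c C D; rewrite /Rintegral => e.
rewrite -[LHS]fineK; last exact: integrable_fin_num.
by rewrite e subrr powR0 ?gt_eqF// mulr0 subr0 mulrC.
Qed.

Let ker r (t : R) := if 0 <= t then t `^ (r - 1) else 0.

Let measurable_ker r : measurable_fun setT (ker r).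
Proof.
have -> : ker r = (fun t => t `^ (r - 1)) \_ `[0, +oo[.
  by apply/funext => t; rewrite /ker patchE; case: ifPn => t0; [rewrite mem_set//= in_itv/= t0|rewrite memNset//= in_itv/= andbT; exact/negP].
by apply/(measurable_restrictT _ (measurable_itv _)); apply: measurable_funTS; exact: measurable_powR.
Qed.

Let f a b r h phi (z : R * R) : R := (phi \_ `[a, b]) z.1 * ((h \_ `[a, b]) z.2 * ker r (z.1 - z.2)).

Let measurable_f a b r h phi : measurable_fun setT h -> measurable_fun setT phi ->
  measurable_fun setT (f a b r h phi).
Proof.
have m (g : R -> R) : measurable_fun setT g -> measurable_fun setT (g \_ `[a, b]).
  by move=> mg; apply/(measurable_restrictT _ (measurable_itv _)); exact: measurable_funTS.
move=> mh mphi; apply: measurable_funM; first by apply: (measurableT_comp (m _ mphi)); exact: measurable_fst.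
apply: measurable_funM; first by apply: (measurableT_comp (m _ mh)); exact: measurable_snd.
by apply: (measurableT_comp (measurable_ker r)); apply: measurable_funB; [exact: measurable_fst|exact: measurable_snd].
Qed.

Let ker_restrict r a b y x : a <= y -> `[a, b]%classic x ->
  ker r (x - y) = ((fun x => (x - y) `^ (r - 1)) \_ `[y, b]) x.
Proof.
rewrite /= in_itv/= => ay /andP[ax xb].
rewrite /ker patchE subr_ge0; case: ifPn => yx; first by rewrite mem_set//= in_itv/= yx.
by rewrite memNset//= in_itv/= xb andbT; exact/negP.
Qed.

Let integrable_f a b r h phi C : a < b -> 0 < r -> mu.-integrable setT (EFin \o h) ->
  measurable_fun setT phi -> (forall x, a <= x <= b -> `|phi x| <= C) ->
  (mu \x mu)%E.-integrable setT (EFin \o f a b r h phi).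
Proof.
move=> ab r0 ih mphi phiC.
have mh : measurable_fun setT h by apply/measurable_EFinP; exact: measurable_int ih.
have C0 : 0 <= C by have := phiC a; rewrite lexx (ltW ab) => /(_ isT); apply: le_trans.
have mf := measurable_f a b r mh mphi.
apply/integrable21ltyP; first exact/measurable_EFinP.
have ba0 : 0 <= (b - a) `^ r / r by rewrite divr_ge0 ?powR_ge0// ltW.
apply: (@le_lt_trans _ _ (\int[mu]_y (`|h y|%:E * (C * ((b - a) `^ r / r))%:E))%E).
  apply: ge0_le_integral => //.
  - by move=> y _; exact: integral_ge0.
  - apply: (@measurable_fun_fubini_tonelli_G _ _ _ _ _ mu (fun z => `|(EFin \o f a b r h phi) z|%E)) => //=.
    by apply: measurableT_comp => //; apply: measurableT_comp.
  - apply/measurable_EFinP; apply: measurable_funM; last exact: measurable_cst.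
    by apply: measurableT_comp.
  - move=> y _; have [yab|yab] := boolP (y \in `[a, b]); last first.
    rewrite integral0_eq; first by rewrite mule_ge0// lee_fin mulr_ge0.
    move=> x _; rewrite /f/= [(h \_ _) y]patchE memNset ?mul0r ?mulr0 ?normr0//.
    by rewrite /=; exact/negP.
  have /andP[ay yb] : a <= y <= b by move: yab; rewrite in_itv.
  pose k x := (x - y) `^ (r - 1).
  have mk (D : set R) : measurable_fun D k.
    by apply: measurable_funTS; apply: (measurableT_comp (measurable_powR (r - 1))); exact: measurable_funB.
  have k0 x : (0 <= ((EFin \o k) \_ `[y, b]) x)%E.
    by rewrite patchE; case: ifPn => //= _; rewrite lee_fin powR_ge0.
  have mk' : measurable_fun setT ((EFin \o k) \_ `[y, b]).
    by apply/(measurable_restrictT _ (measurable_itv _)); exact/measurable_EFinP.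
  apply: (@le_trans _ _ (\int[mu]_x ((`|h y| * C)%:E * ((EFin \o k) \_ `[y, b]) x))%E).
    apply: ge0_le_integral => //.
    - apply: measurableT_comp => //; apply/measurable_EFinP.
      by apply: (measurableT_comp mf); exact: pair2_measurable.
    - by apply: emeasurable_funM.
    move=> x _; rewrite /f /= [(h \_ _) y]patchE mem_set//=.
    have [xab|xab] := boolP (x \in `[a, b]); last first.
      by rewrite [(phi \_ _) x]patchE memNset ?mul0r ?normr0 ?mule_ge0 ?lee_fin ?mulr_ge0//=; exact/negP.
    rewrite [(phi \_ _) x]patchE mem_set//= (ker_restrict r ay xab) restrict_EFin -EFinM lee_fin.
    have kx0 : 0 <= (k \_ `[y, b]) x by rewrite patchE; case: ifPn => // _; exact: powR_ge0.
    have {}phiC : `|phi x| <= C by apply: phiC; move: xab; rewrite in_itv.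
    rewrite -/k; move: ((k \_ `[y, b]) x) kx0 => kx kx0.
    by rewrite !normrM (ger0_norm kx0) mulrCA -mulrA ler_wpM2l// ler_wpM2r.
  rewrite ge0_integralZl ?lee_fin ?mulr_ge0// -integral_mkcond.
  rewrite (integral_sub_powR yb r0) -!EFinM lee_fin -mulrA !ler_wpM2l//.
  rewrite ler_wpM2r ?invr_ge0 ?(ltW r0)// ge0_ler_powR ?nnegrE ?subr_ge0 ?(ltW ab) ?(ltW r0)//.
  by rewrite lerD2l lerN2.
have /integrableP[_] := integrableZr measurableT (C * ((b - a) `^ r / r)) ih.
apply: le_lt_trans; apply: ge0_le_integral => //.
- by move=> y _; rewrite mule_ge0// lee_fin mulr_ge0.
- by apply: emeasurable_funM => //; exact/measurable_EFinP/measurableT_comp.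
- apply: measurableT_comp => //; apply: emeasurable_funM => //; exact/measurable_EFinP.
- by move=> y _; rewrite /= lee_fin normrM (ger0_norm (mulr_ge0 C0 ba0)).
Qed.

Let integral_scale c (g : R -> R) : mu.-integrable setT (fun y => (c * g y)%:E) ->
  (\int[mu]_y (c * g y)%:E = (c * fine (\int[mu]_y (g y)%:E))%:E)%E.
Proof.
have [->|c0] := eqVneq c 0.
  by move=> _; rewrite mul0r integral0_eq// => y _; rewrite mul0r.
move=> icg; have ig : mu.-integrable setT (EFin \o g).
  have := integrableZl measurableT c^-1 icg; apply: eq_integrable => // y _.
  by rewrite -EFinM mulKf.
by rewrite (integralZl measurableT ig) EFinM fineK// integrable_fin_num.
Qed.

Lemma fubini_triangle a b r h phi C : a < b -> 0 < r -> mu.-integrable setT (EFin \o h) ->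
  measurable_fun setT phi -> (forall x, a <= x <= b -> `|phi x| <= C) ->
  \int[mu]_(x in `[a, b]) (phi x * \int[mu]_(y in `[a, x]) (h y * (x - y) `^ (r - 1))) =
  \int[mu]_(y in `[a, b]) (h y * \int[mu]_(x in `[y, b]) (phi x * (x - y) `^ (r - 1))).
Proof.
move=> ab r0 ih mphi phiC.
have i1 := integrable_f ab r0 ih mphi phiC.
have inner1 x : x \in `[a, b] -> mu.-integrable setT (fun y => (EFin \o f a b r h phi) (x, y)) ->
    (\int[mu]_y (EFin \o f a b r h phi) (x, y) =
     (phi x * \int[mu]_(y in `[a, x]) (h y * (x - y) `^ (r - 1)))%:E)%E.
  move=> xab; have := xab; rewrite in_itv/= => /andP[ax xb].
  rewrite /= /f /= [(phi \_ _) x]patchE mem_set//= => ixy.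
  rewrite (integral_scale ixy) /Rintegral; congr (_ * fine _)%:E.
  rewrite [RHS]integral_mkcond; apply: eq_integral => y _.
  rewrite !patchE /ker subr_ge0; have [yx|xy] := leP y x; last first.
    by rewrite mulr0 [in RHS]memNset//= in_itv/= => /andP[_ /(lt_le_trans xy)]; rewrite ltxx.
  have [ay|ya] := leP a y; last by rewrite !memNset ?mul0r//= in_itv/= => /andP[/(lt_le_trans ya)]; rewrite ltxx.
  by rewrite !mem_set//= in_itv/= ay//= (le_trans yx).
have inner2 y : y \in `[a, b] -> mu.-integrable setT (fun x => (EFin \o f a b r h phi) (x, y)) ->
    (\int[mu]_x (EFin \o f a b r h phi) (x, y) =
     (h y * \int[mu]_(x in `[y, b]) (phi x * (x - y) `^ (r - 1)))%:E)%E.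
  move=> yab; have := yab; rewrite in_itv/= => /andP[ay yb].
  have -> : (fun x => (EFin \o f a b r h phi) (x, y)) = (fun x => (h y * ((phi \_ `[a, b]) x * ker r (x - y)))%:E).
    by apply/funext => x; rewrite /= /f /= [(h \_ _) y]patchE mem_set//= mulrCA.
  move=> ixy; rewrite (integral_scale ixy) /Rintegral; congr (_ * fine _)%:E.
  rewrite [RHS]integral_mkcond; apply: eq_integral => x _.
  rewrite !patchE /ker subr_ge0; have [yx|xy] := leP y x; last first.
    by rewrite mulr0 [in RHS]memNset//= in_itv/= => /andP[/(lt_le_trans xy)]; rewrite ltxx.
  have [xb|bx] := leP x b; last by rewrite !memNset ?mul0r//= in_itv/= => /andP[_ /(lt_le_trans bx)]; rewrite ltxx.
  by rewrite !mem_set//= in_itv/= ?yx ?xb// (le_trans ay).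
rewrite [LHS]/Rintegral [RHS]/Rintegral; apply: (congr1 fine).
have aefilter := ae_filter_ringOfSetsType mu.
transitivity (\int[mu]_x \int[mu]_y (EFin \o f a b r h phi) (x, y))%E.
  rewrite integral_mkcond; apply: ae_eq_integralW.
  have := ae_integrable1 i1; apply: filterS => x /= ix _.
  rewrite patchE; have [xab|xab] := boolP (x \in `[a, b]); first by rewrite mem_set// (inner1 _ xab ix).
  rewrite memNset; last by rewrite /=; exact/negP.
  by rewrite integral0_eq// => y _; rewrite /f/= [(phi \_ _) x]patchE memNset ?mul0r//=; exact/negP.
rewrite (Fubini i1); apply/esym.
rewrite integral_mkcond; apply: ae_eq_integralW.
have := ae_integrable2 i1; apply: filterS => y /= iy _.
rewrite patchE; have [yab|yab] := boolP (y \in `[a, b]); first by rewrite mem_set// (inner2 _ yab iy).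
rewrite memNset; last by rewrite /=; exact/negP.
by rewrite integral0_eq// => x _; rewrite /f/= [(h \_ _) y]patchE memNset ?mul0r ?mulr0//=; exact/negP.
Qed.

End fubini_triangle.

Section bounded_variation_parts.
Context {R : realType}.
Implicit Types (a b c d x y : R) (v Q q : R -> R).
Local Notation mu := (@lebesgue_measure R).
Local Notation TV := total_variation.

Lemma bounded_variation_decomposition a b v : a <= b -> bounded_variation a b v ->
  exists F G : R -> R, [/\ {in `[a, b] &, {homo F : x y / x <= y}},
    {in `[a, b] &, {homo G : x y / x <= y}} & {in `[a, b], v =1 (F \- G)}].
Proof.
move=> ab bv; exists (fine \o pos_tv a v), (fine \o neg_tv a v); split.
- exact: fine_neg_tv_nondecreasing (bounded_variationN bv).
- exact: fine_neg_tv_nondecreasing bv.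
- exact: bounded_variation_pos_neg_tvE bv.
Qed.

Lemma bounded_variation_measurable a b v : a <= b -> bounded_variation a b v ->
  measurable_fun `[a, b] v.
Proof.
move=> ab /(bounded_variation_decomposition ab)[F [G [ndF ndG vE]]].
have m (H : R -> R) : {in `[a, b] &, {homo H : x y / x <= y}} -> measurable_fun `[a, b] H.
  move=> ndH; pose cl x := Num.max a (Num.min b x).
  have clab x : cl x \in `[a, b] by rewrite in_itv/= le_max lexx ge_max ge_min ab lexx.
  apply: (@eq_measurable_fun _ _ _ _ _ (H \o cl)).
    move=> x; rewrite inE/= in_itv/= => /andP[ax xb].
    by rewrite /cl (min_idPr xb) (max_idPr ax).
  apply: nondecreasing_measurable => // x y xy; apply: ndH => //.
  by rewrite ge_max !le_max lexx /= le_min !ge_min lexx xy !orbT.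
apply: (@eq_measurable_fun _ _ _ _ _ (F \- G)).
  by move=> x /set_mem xab; rewrite vE.
by apply: measurable_funB; exact: m.
Qed.

Lemma bounded_variation_le a b v x : a <= x -> x <= b -> bounded_variation a b v ->
  `|v x - v a| <= fine (TV a b v).
Proof.
move=> ax xb bv; have ab := le_trans ax xb.
have fin := (bounded_variationP _ ab).1 bv.
rewrite -lee_fin fineK//; apply: le_trans (total_variation_ge _ ax) _.
by rewrite (total_variationD v ax xb) leeDl// total_variation_ge0.
Qed.

Lemma bounded_measurable_integrable a b q B :
  measurable_fun `[a, b] q -> (forall x, a <= x <= b -> `|q x| <= B) ->
  mu.-integrable `[a, b] (EFin \o q).
Proof.
move=> mq qB; apply: measurable_bounded_integrable => //.
  by rewrite /= lebesgue_measure_itv/=; case: ifP => // _; rewrite -EFinB ltry.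
exists B; split; first exact: num_real.
by move=> M hM x; rewrite /= in_itv/= => /qB /le_trans; apply; exact: ltW.
Qed.

Lemma bounded_variation_integrable a b v q B : a <= b -> bounded_variation a b v ->
  measurable_fun `[a, b] q -> (forall x, a <= x <= b -> `|q x| <= B) ->
  mu.-integrable `[a, b] (EFin \o (fun x => v x * q x)).
Proof.
move=> ab bv mq qB.
have mv := bounded_variation_measurable ab bv.
apply: (@bounded_measurable_integrable _ _ _ ((`|v a| + fine (TV a b v)) * B)).
  exact: measurable_funM.
move=> x /andP[ax xb]; rewrite normrM ler_pM//; last by apply: qB; rewrite ax.
rewrite -[v x](subrK (v a)) addrC (le_trans (ler_normD _ _))// lerD2l.
exact: bounded_variation_le.
Qed.

Lemma bounded_variation_right_cvg a b v : a < b -> bounded_variation a b v ->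
  cvg (v x @[x --> a^'+]).
Proof.
move=> ab /(bounded_variation_decomposition (ltW ab))[F [G [ndF ndG vE]]].
have m (H : R -> R) : {in `[a, b] &, {homo H : x y / x <= y}} -> cvg (H x @[x --> a^'+]).
  move=> ndH; apply: nondecreasing_at_right_is_cvgr.
    near=> x => y z; rewrite !in_itv/= => /andP[ay yx] /andP[az zx] yz.
    have xb : x <= b by near: x; exact: nbhs_right_le.
    by apply: ndH => //; rewrite in_itv/= ltW//= (le_trans (ltW _) xb).
  near=> x; have xb : x <= b by near: x; exact: nbhs_right_le.
  exists (H a) => _ [y + <-]; rewrite /= in_itv/= => /andP[ay yx].
  by apply: ndH; rewrite ?in_itv/= ?lexx ?(ltW ab) ?(ltW ay)//= (le_trans (ltW yx)).
have cvF := m _ ndF; have cvG := m _ ndG.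
apply/cvg_ex; exists (lim (F x @[x --> a^'+]) - lim (G x @[x --> a^'+])).
apply: cvg_trans (cvgB cvF cvG); apply: near_eq_cvg; near=> x.
rewrite vE// in_itv/=; apply/andP; split; near: x; [exact: nbhs_right_ge|exact: nbhs_right_le].
Unshelve. all: by end_near. Qed.

Let cell_parts v Q q c d x y (M B : R) : c <= d -> bounded_variation c d v ->
  measurable_fun `[c, d] q ->
  (forall t, c <= t <= d -> `|q t| <= B) -> (forall t, c <= t <= d -> `|Q t| <= M) ->
  (forall s t, c <= s -> s <= t -> t <= d -> \int[mu]_(z in `[s, t]) q z = Q t - Q s) ->
  c <= x -> x <= y -> y <= d ->
  `|\int[mu]_(t in `[x, y]) (v t * q t) - (v y * Q y - v x * Q x)| <= (M + B * (y - x)) * fine (TV x y v).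
Proof.
move=> cd bv mq qB QM FTC cx xy yd; have cy := le_trans cx xy; have xd := le_trans xy yd.
have bvxy : bounded_variation x y v.
  exact: bounded_variationr cx xy (bounded_variationl cy yd bv).
have sub : `[x, y]%classic `<=` `[c, d]%classic.
  by move=> t /=; rewrite !in_itv/= => /andP[xt ty]; rewrite (le_trans cx)// (le_trans ty).
have ivq : mu.-integrable `[x, y] (EFin \o (fun t => v t * q t)).
  by apply: integrableS (bounded_variation_integrable cd bv mq qB).
have iq : mu.-integrable `[x, y] (EFin \o q).
  by apply: integrableS (bounded_measurable_integrable mq qB).
have ivyq : mu.-integrable `[x, y] (EFin \o (fun t => v y * q t)) by exact: integrableZl_EFin.
have -> : \int[mu]_(t in `[x, y]) (v t * q t) - (v y * Q y - v x * Q x) =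
    \int[mu]_(t in `[x, y]) (v t * q t - v y * q t) - Q x * (v y - v x).
  by rewrite RintegralB// RintegralZl// FTC//; ring.
set T := fine _; have T0 : 0 <= T by rewrite fine_ge0// total_variation_ge0.
have h1 : `|Q x * (v y - v x)| <= M * T.
  rewrite normrM ler_pM//; first by rewrite QM ?cx.
  exact: bounded_variation_le.
have B0 : 0 <= B by have := qB c; rewrite lexx cd => /(_ isT); apply: le_trans.
have h2 : `|\int[mu]_(t in `[x, y]) (v t * q t - v y * q t)| <= B * (y - x) * T.
  have ivv : mu.-integrable `[x, y] (EFin \o (fun t => v t * q t - v y * q t)) by exact: integrableB_EFin.
  apply: le_trans (le_normr_Rintegral _ ivv) _ => //.
  apply: (@le_trans _ _ (\int[mu]_(t in `[x, y]) (T * B))).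
    apply: le_Rintegral => //.
    - by have /integrable_norm := ivv.
    - by apply: (@bounded_measurable_integrable _ _ _ `|T * B|) => //.
    move=> t; rewrite /= in_itv/= => /andP[xt ty]; rewrite -mulrBl normrM ler_pM//.
      have tyv := total_variation_ge v ty.
      rewrite distrC -lee_fin /T fineK; last exact: (bounded_variationP _ xy).1.
      by apply: (le_trans tyv); rewrite (total_variationD v xt ty) leeDr// total_variation_ge0.
    by rewrite qB// (le_trans cx xt) (le_trans ty yd).
  rewrite Rintegral_cst// /= lebesgue_measure_itv/= lte_fin.
  have [xy'|xy'] := ltP x y; first by rewrite -EFinB /= (mulrC (B * _)) mulrA.
  by rewrite mulr0 !mulr_ge0// subr_ge0.
rewrite mulrDl [leRHS]addrC; exact: le_trans (ler_normB _ _) (lerD h2 h1).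
Qed.

Lemma bounded_variation_parts v Q q c d (M B : R) : c <= d -> bounded_variation c d v ->
  measurable_fun `[c, d] q ->
  (forall t, c <= t <= d -> `|q t| <= B) -> (forall t, c <= t <= d -> `|Q t| <= M) ->
  (forall s t, c <= s -> s <= t -> t <= d -> \int[mu]_(z in `[s, t]) q z = Q t - Q s) ->
  `|\int[mu]_(t in `[c, d]) (v t * q t) - (v d * Q d - v c * Q c)| <= M * fine (TV c d v).
Proof.
move=> cd bv mq qB QM FTC.
have ivq := bounded_variation_integrable cd bv mq qB.
have T0 : 0 <= fine (TV c d v) by rewrite fine_ge0// total_variation_ge0.
have B0 : 0 <= B by have := qB c; rewrite lexx cd => /(_ isT); apply: le_trans.
have step n i x : (i <= n.+1)%N -> x = grid c d n.+1 i ->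
  `|\int[mu]_(t in `[c, x]) (v t * q t) - (v x * Q x - v c * Q c)| <= (M + B * ((d - c) / n.+1%:R)) * fine (TV c x v).
  elim: i x => [x _ ->|i IH x i_n xE].
    by rewrite grid0 set_itv1 /Rintegral integral_set1 subrr subr0 normr0 total_variationxx mulr0.
  have /andP[cy yd] := @grid_itv R c d n.+1 i cd (ltnW i_n) isT.
  have /andP[cx xd] := @grid_itv R c d n.+1 i.+1 cd i_n isT.
  rewrite -xE in cx xd; have yx : grid c d n.+1 i <= x by rewrite xE; exact: grid_le.
  have := IH _ (ltnW i_n) erefl.
  have := cell_parts cd bv mq qB QM FTC cy yx xd.
  rewrite -(gridS c d n.+1 i) -xE.
  have ivx : mu.-integrable `[c, x] (EFin \o (fun t => v t * q t)).
    by apply: integrableS ivq => // t /=; rewrite !in_itv/= => /andP[-> /le_trans ->].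
  have fin s t : c <= s -> s <= t -> t <= d -> TV s t v \is a fin_num.
    move=> cs st td; apply/bounded_variationP => //.
    exact: bounded_variationr cs st (bounded_variationl (le_trans cs st) td bv).
  rewrite (total_variationD v cy yx) fineD ?fin//.
  have -> : \int[mu]_(t in `[c, x]) (v t * q t) =
    \int[mu]_(t in `[c, (grid c d n.+1 i)]) (v t * q t) + \int[mu]_(t in `[(grid c d n.+1 i), x]) (v t * q t).
    rewrite -(Rintegral_itv_obnd_cbnd (r := grid c d n.+1 i)); last first.
      by apply: integrableS ivx => // t /=; rewrite !in_itv/= => /andP[/ltW/(le_trans cy) -> ->].
    by rewrite -(Rintegral_itvB (x := grid c d n.+1 i) ivx) ?bnd_simp// addrC subrK.
  move: (\int[mu]_(t in _) _) (\int[mu]_(t in _) _) => I1 I2 h2 h1.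
  rewrite mulrDr; apply: le_trans (lerD h1 h2); apply: le_trans (ler_normD _ _).
  rewrite le_eqVlt; apply/orP; left; apply/eqP; congr `|_|; ring.
apply/ler_addgt0Pr => e e0.
pose n := Num.truncn (B * (d - c) * fine (TV c d v) / e).
have := step n _ d (leqnn _); rewrite gridn// => /(_ erefl) /le_trans; apply.
have : B * (d - c) * fine (TV c d v) / e < n.+1%:R by exact: truncnS_gt.
rewrite ltr_pdivrMr// mulrDl lerD2l => h.
by rewrite mulrA mulrAC ler_pdivrMr// [leRHS]mulrC ltW.
Qed.

Lemma bounded_variation_parts_right v Q q c d (M B : R) : c < d -> bounded_variation c d v ->
  measurable_fun `[c, d] q ->
  (forall t, c <= t <= d -> `|q t| <= B) -> (forall t, c <= t <= d -> `|Q t| <= M) ->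
  (forall s t, c <= s -> s <= t -> t <= d -> \int[mu]_(z in `[s, t]) q z = Q t - Q s) ->
  Q d = 0 ->
  `|\int[mu]_(t in `[c, d]) (v t * q t)| <= M * (fine (TV c d v) + `|lim (v x @[x --> c^'+])|).
Proof.
move=> cd bv mq qB QM FTC Qd.
have ivq := bounded_variation_integrable (ltW cd) bv mq qB.
have M0 : 0 <= M by have := QM c; rewrite lexx (ltW cd) => /(_ isT); apply: le_trans.
have B0 : 0 <= B by have := qB c; rewrite lexx (ltW cd) => /(_ isT); apply: le_trans.
pose V := `|v c| + fine (TV c d v).
have T0 : 0 <= fine (TV c d v) by rewrite fine_ge0// total_variation_ge0// ltW.
have V0 : 0 <= V by rewrite addr_ge0.
have bound x : c < x -> x < d ->
    `|\int[mu]_(t in `[c, d]) (v t * q t)| <= M * (fine (TV c d v) + `|v x|) + V * B * (x - c).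
  move=> cx xd.
  have bvx := bounded_variationr (ltW cx) (ltW xd) bv.
  have sub : `[x, d]%classic `<=` `[c, d]%classic.
    by move=> t /=; rewrite !in_itv/= => /andP[/(le_trans (ltW cx)) -> ->].
  have := @bounded_variation_parts v Q q x d M B (ltW xd) bvx (measurable_funS _ sub mq).
  have cxle : c <= x by exact: ltW.
  have lift (P : R -> Prop) : (forall t, c <= t <= d -> P t) -> forall t, x <= t <= d -> P t.
    by move=> h t /andP[xt td]; apply: h; rewrite (le_trans cxle xt).
  move=> /(_ _ (lift _ qB) (lift _ QM)) => /(_ (measurable_itv _)).
  have FTC' s t : x <= s -> s <= t -> t <= d -> \int[mu]_(z in `[s, t]) q z = Q t - Q s.
    by move=> xs; apply: FTC; exact: le_trans xs.
  move=> /(_ FTC'); rewrite Qd mulr0 sub0r opprK => h1.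
  have fin s t : c <= s -> s <= t -> t <= d -> TV s t v \is a fin_num.
    move=> cs st td; apply/bounded_variationP => //.
    exact: bounded_variationr cs st (bounded_variationl (le_trans cs st) td bv).
  have h2 : fine (TV x d v) <= fine (TV c d v).
    rewrite (total_variationD v cxle (ltW xd)) fineD ?fin ?(ltW xd)// lerDr fine_ge0//.
    exact: total_variation_ge0.
  have icx : mu.-integrable `[c, x] (EFin \o (fun t => v t * q t)).
    by apply: integrableS ivq => // t /=; rewrite !in_itv/= => /andP[-> /le_trans ->]//; exact: ltW.
  have -> : \int[mu]_(t in `[c, d]) (v t * q t) =
    \int[mu]_(t in `[c, x]) (v t * q t) + \int[mu]_(t in `[x, d]) (v t * q t).
    rewrite -(Rintegral_itv_obnd_cbnd (r := x)); last first.
      by apply: integrableS ivq => // t /=; rewrite !in_itv/= => /andP[/ltW/(le_trans cxle) -> ->].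
    by rewrite -(Rintegral_itvB (x := x) ivq) ?bnd_simp ?(ltW xd)// addrC subrK.
  have h3 : `|\int[mu]_(t in `[c, x]) (v t * q t)| <= V * B * (x - c).
    apply: le_trans (le_normr_Rintegral _ icx) _ => //.
    apply: (@le_trans _ _ (\int[mu]_(t in `[c, x]) (V * B))).
      apply: le_Rintegral => //.
      - by have /integrable_norm := icx.
      - by apply: (@bounded_measurable_integrable _ _ _ `|V * B|) => //.
      move=> t; rewrite /= in_itv/= => /andP[ct tx].
      have td : t <= d by rewrite (le_trans tx)// ltW.
      rewrite normrM ler_pM//; last by rewrite qB ?ct.
      rewrite -[v t](subrK (v c)) addrC (le_trans (ler_normD _ _))// lerD2l.
      exact: bounded_variation_le.
    by rewrite Rintegral_cst// /= lebesgue_measure_itv/= lte_fin cx -EFinB.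
  have h4 : `|v x * Q x| <= M * `|v x| by rewrite normrM mulrC ler_wpM2r ?QM// ?cxle ltW.
  have h5 : M * fine (TV x d v) <= M * fine (TV c d v) by rewrite ler_wpM2l.
  rewrite mulrDr; move: h1 h3 h4 h5; move: (Rintegral _ _ _) (Rintegral _ _ _) (M * fine _) (M * fine _) (M * `|_|) (V * B * _) (v x * Q x) => I1 I2 X1 X2 X3 X4 X5 h1 h3 h4 h5.
  have -> : I1 + I2 = I1 + (I2 + X5 - X5) by rewrite addrK.
  apply: le_trans (ler_normD _ _) _; rewrite addrC; apply: lerD; last exact: h3.
  by apply: le_trans (ler_normB _ _) _; apply: lerD => //; exact: le_trans h5.
have cvL := bounded_variation_right_cvg cd bv.
have cv : M * (fine (TV c d v) + `|v x|) + V * B * (x - c) @[x --> c^'+] -->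
    M * (fine (TV c d v) + `|lim (v x @[x --> c^'+])|) + V * B * (c - c).
  apply: cvgD.
    by apply: cvgM; [exact: cvg_cst|apply: cvgD; [exact: cvg_cst|exact: cvg_norm]].
  apply: cvgM; [exact: cvg_cst|apply: cvgB; [|exact: cvg_cst]].
  by apply: cvg_at_right_filter; exact: cvg_id.
rewrite subrr mulr0 addr0 in cv; rewrite -(cvg_lim _ cv)//.
apply: limr_ge; first by apply/cvg_ex; eexists; exact: cv.
by near=> x; apply: bound; near: x; [exact: nbhs_right_gt|exact: nbhs_right_lt].
Unshelve. all: by end_near. Qed.

End bounded_variation_parts.

Section legendre_tail.
Context {R : realType}.
Implicit Types (a b s x y : R) (n j : nat) (q : {poly R}).
Local Notation mu := (@lebesgue_measure R).
Local Notation L := (@legendre_flip R).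

Lemma measurable_frac_poly s q : measurable_fun setT (frac_poly s q).
Proof.
rewrite /frac_poly; elim: (size q) => [|n IH].
  rewrite [X in measurable_fun _ X](_ : _ = cst 0); first exact: measurable_cst.
  by apply/funext => z; exact: big_ord0.
rewrite [X in measurable_fun _ X](_ : _ = (fun z => \sum_(j < n) q`_j * (j`!%:R / Gamma (j%:R + s + 1)) * z `^ (j%:R + s)) \+
   (fun z => q`_n * (n`!%:R / Gamma (n%:R + s + 1)) * z `^ (n%:R + s))); last first.
  by apply/funext => z; exact: big_ord_recr.
apply: measurable_funD => //; apply: measurable_funM; first exact: measurable_cst.
exact: measurable_powR.
Qed.

Lemma frac_poly_bounded s q : 0 <= s -> exists C, forall z, 0 <= z <= 2 -> `|frac_poly s q z| <= C.
Proof.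
move=> s0; exists (\sum_(j < size q) `|q`_j * (j`!%:R / Gamma (j%:R + s + 1))| * 2 `^ (j%:R + s)).
move=> z /andP[z0 z2]; apply: le_trans (ler_norm_sum _ _ _) _; apply: ler_sum => j _.
rewrite normrM ler_wpM2l// ger0_norm ?powR_ge0// ge0_ler_powR ?nnegrE// addr_ge0//.
Qed.

Lemma frac_poly_continuous_pos s q (z : R) : 0 < z -> {for z, continuous (frac_poly s q)}.
Proof.
move=> z0; have : has_derivative (frac_poly s q) z (\sum_(j < size q) (0 * z `^ (j%:R + s) +
    q`_j * (j`!%:R / Gamma (j%:R + s + 1)) * ((j%:R + s) * z `^ (j%:R + s - 1) * 1))).
  by apply: isd_sum => j; apply: has_derivativeM; [exact: has_derivative_cst|apply: has_derivative_powR z0 _; exact: has_derivative_id].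
exact: is_derive_continuous.
Qed.

(* The [s]-fold fractional integral of [q (1 - x)] from 1 to the left, in the variable [x]. *)
Definition frac_tail s q x : R := frac_poly s q (1 - x).

Lemma measurable_frac_tail s q : measurable_fun setT (frac_tail s q).
Proof. by apply: (measurableT_comp (measurable_frac_poly s q)); exact: measurable_funB. Qed.

Lemma frac_tail_bounded s q : 0 <= s -> exists C, forall x, -1 <= x <= 1 -> `|frac_tail s q x| <= C.
Proof.
move=> /(frac_poly_bounded q)[C hC]; exists C => x x1; apply: hC; lra.
Qed.

Lemma has_derivative_frac_tail s q x : x < 1 ->
  0 <= s -> has_derivative (frac_tail (s + 1) q) x (- frac_tail s q x).
Proof.
move=> x1 s0; have z0 : 0 < 1 - x by rewrite subr_gt0.
have s10 : 0 < s + 1 by rewrite ltr_wpDl.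
have d1 : has_derivative (fun t : R => 1 - t) x (0 - 1).
  by apply: has_derivativeD; [exact: has_derivative_cst|apply: has_derivativeN; exact: has_derivative_id].
apply: has_derivative_eq; first exact: (@has_derivative_comp _ (frac_poly (s + 1) q) (fun t => 1 - t) _ _ _ (has_derivative_frac_poly q s10 z0) d1).
by rewrite addrK add0r mulrN1.
Qed.

Lemma frac_tail_continuous s q a b : 0 < s -> b <= 1 -> {within `[a, b], continuous (frac_tail s q)}.
Proof.
move=> s0 b1; rewrite /frac_tail /frac_poly; elim: (size q) => [|n IH].
  rewrite [X in continuous X](_ : _ = cst 0); first by move=> x; exact: cvg_cst.
  by apply/funext => z; exact: big_ord0.
rewrite [X in continuous X](_ : _ = (fun z => \sum_(j < n) q`_j * (j`!%:R / Gamma (j%:R + s + 1)) * (1 - z) `^ (j%:R + s)) \+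
   (fun z => q`_n * (n`!%:R / Gamma (n%:R + s + 1)) * (1 - z) `^ (n%:R + s))); last first.
  by apply/funext => z; exact: big_ord_recr.
have c : {within `[a, b], continuous (fun x : R => (1 - x) `^ (n%:R + s))}.
  apply: within_continuous_powR; first by rewrite ltr_wpDl.
    by move=> x; rewrite /= in_itv/= subr_ge0 => /andP[_ /le_trans]; apply.
  by apply: continuous_subspaceT => x; apply: cvgB; [exact: cvg_cst|exact: cvg_id].
move=> x; apply: cvgD; first exact: IH.
by apply: cvgM; [exact: cvg_cst|exact: c].
Qed.

Lemma frac_tail1 s q : 0 < s -> frac_tail s q 1 = 0.
Proof. by move=> s0; rewrite /frac_tail subrr frac_poly0. Qed.

Lemma frac_tail_integrable s q a b : 0 <= s -> -1 <= a -> b <= 1 ->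
  mu.-integrable `[a, b] (EFin \o frac_tail s q).
Proof.
move=> s0 a1 b1; have [C hC] := frac_tail_bounded q s0.
apply: (@bounded_measurable_integrable _ _ _ _ C).
  by apply: measurable_funTS; exact: measurable_frac_tail.
by move=> x /andP[ax xb]; apply: hC; rewrite (le_trans a1) ?(le_trans xb).
Qed.

Lemma Rintegral_frac_tail s q a b : 0 <= s -> -1 <= a -> a <= b -> b <= 1 ->
  \int[mu]_(x in `[a, b]) frac_tail s q x = frac_tail (s + 1) q a - frac_tail (s + 1) q b.
Proof.
move=> s0 a1; rewrite le_eqVlt => /predU1P[<- _|ab b1].
  by rewrite set_itv1 /Rintegral integral_set1 subrr.
have s10 : 0 < s + 1 by rewrite ltr_wpDl.
transitivity (- frac_tail (s + 1) q b - - frac_tail (s + 1) q a); last by rewrite opprK addrC.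
apply: (@FTC2_integrable _ _ (fun x => - frac_tail (s + 1) q x)) => //.
- exact: frac_tail_integrable.
- move=> x; rewrite in_itv/= => /andP[ax xb].
  have x1 : 0 < 1 - x by rewrite subr_gt0 (lt_le_trans xb).
  apply: (@continuous_comp _ _ _ (fun x => 1 - x) (frac_poly s q)); last exact: frac_poly_continuous_pos.
  by apply: cvgB; [exact: cvg_cst|exact: cvg_id].
- by move=> x; apply: cvgN; exact: frac_tail_continuous.
- move=> x; rewrite in_itv/= => /andP[ax xb].
  have := has_derivativeN (has_derivative_frac_tail q (lt_le_trans xb b1) s0); rewrite opprK; exact.
Qed.

(* The semigroup property of fractional integration, from the Beta integral. *)
Lemma Rintegral_frac_tail_kernel s r q y : 0 < s -> 0 < r -> y <= 1 ->
  \int[mu]_(x in `[y, 1]) (frac_tail s q x * (x - y) `^ (r - 1)) = Gamma r * frac_tail (s + r) q y.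
Proof.
move=> s0 r0; rewrite le_eqVlt => /predU1P[->|y1].
  by rewrite set_itv1 /Rintegral integral_set1 frac_tail1 ?addr_gt0// mulr0.
rewrite /frac_tail /frac_poly.
have term (n : nat) : mu.-integrable `[y, 1] (EFin \o (fun x => q`_n * (n`!%:R / Gamma (n%:R + s + 1)) * (1 - x) `^ (n%:R + s) * (x - y) `^ (r - 1))) /\
  \int[mu]_(x in `[y, 1]) (q`_n * (n`!%:R / Gamma (n%:R + s + 1)) * (1 - x) `^ (n%:R + s) * (x - y) `^ (r - 1)) =
  Gamma r * (q`_n * (n`!%:R / Gamma (n%:R + (s + r) + 1)) * (1 - y) `^ (n%:R + (s + r))).
  have ns : 1 < n%:R + s + 1 by rewrite ltrDr ltr_wpDl.
  have i := integrable_beta_integrand y1 ns r0.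
  have e := beta_integralE y1 ns r0.
  have E : (fun x => q`_n * (n`!%:R / Gamma (n%:R + s + 1)) * (1 - x) `^ (n%:R + s) * (x - y) `^ (r - 1)) =
     (fun x => q`_n * (n`!%:R / Gamma (n%:R + s + 1)) * beta_integrand y 1 (n%:R + s + 1) r x).
    by apply/funext => x; rewrite /beta_integrand addrK -!mulrA; congr (_ * (_ * (_ * _))); rewrite mulrC.
  rewrite E; split; first exact: integrableZl_EFin.
  rewrite RintegralZl// -/(beta_integral y 1 (n%:R + s + 1) r) e.
  rewrite (_ : r + (n%:R + s + 1) - 1 = n%:R + (s + r)); last by ring.
  rewrite (_ : r + (n%:R + s + 1) = n%:R + (s + r) + 1); last by ring.
  have : 0 < Gamma (n%:R + s + 1) by apply: Gamma_gt0; exact: lt_trans ns.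
  have nsr : 0 < n%:R + (s + r) by apply: ltr_wpDl; [exact: ler0n|exact: addr_gt0].
  have : 0 < Gamma (n%:R + (s + r) + 1) by apply: Gamma_gt0; apply: addr_gt0.
  move: (Gamma (n%:R + s + 1)) (Gamma (n%:R + (s + r) + 1)) (Gamma r) (_ `^ _) (q`_n) (n`!%:R : R) => g1 g2 g3 p c f g10 g20.
  by field; rewrite !gt_eqF.
suff H N : mu.-integrable `[y, 1] (EFin \o (fun x =>
    (\sum_(j < N) q`_j * (j`!%:R / Gamma (j%:R + s + 1)) * (1 - x) `^ (j%:R + s)) * (x - y) `^ (r - 1))) /\
  \int[mu]_(x in `[y, 1]) ((\sum_(j < N) q`_j * (j`!%:R / Gamma (j%:R + s + 1)) * (1 - x) `^ (j%:R + s)) * (x - y) `^ (r - 1)) =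
  Gamma r * \sum_(j < N) q`_j * (j`!%:R / Gamma (j%:R + (s + r) + 1)) * (1 - y) `^ (j%:R + (s + r)).
  by have [] := H (size q).
elim: N => [|N [IHi IHe]].
  rewrite big_ord0 mulr0 (_ : (fun _ => _) = cst 0); last by apply/funext => x; rewrite big_ord0 mul0r.
  by split; [exact: integrable0|rewrite /Rintegral integral0].
have [i e] := term N.
rewrite (_ : (fun x => (\sum_(j < N.+1) _) * _) = (fun x => (\sum_(j < N) q`_j * (j`!%:R / Gamma (j%:R + s + 1)) * (1 - x) `^ (j%:R + s)) * (x - y) `^ (r - 1)
    + q`_N * (N`!%:R / Gamma (N%:R + s + 1)) * (1 - x) `^ (N%:R + s) * (x - y) `^ (r - 1))); last first.
  by apply/funext => x; rewrite big_ord_recr mulrDl.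
split; first exact: integrableD_EFin.
by rewrite RintegralD// IHe e big_ord_recr mulrDr.
Qed.

Lemma frac_tail0 n x : x <= 1 -> frac_tail 0 (L n) x = (legendre R n).[x].
Proof.
move=> x1; have -> : (legendre R n).[x] = (L n).[1 - x] by rewrite horner_legendre_flip subKr.
rewrite /frac_tail /frac_poly horner_coef; apply: eq_bigr => j _.
rewrite addr0 powR_mulrn ?subr_ge0//; congr (_ * _).
suff -> : Gamma (j%:R + 1) = j`!%:R :> R by rewrite divff ?mulr1// pnatr_eq0 -lt0n fact_gt0.
elim: (nat_of_ord j) => [|k IH]; first by rewrite add0r Gamma1.
have k0 : 0 < k%:R + 1 :> R by rewrite ltr_wpDl.
by rewrite -[k.+1%:R]natr1 (GammaS k0) IH factS natrM -natr1.
Qed.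

Lemma continuous_horner (p : {poly R}) : continuous (horner p).
Proof. exact: is_derive_continuousT (@has_derivative_horner R p). Qed.

Lemma legendre_orthogonal m n : m != n ->
  \int[mu]_(x in `[-1, 1]) ((legendre R m).[x] * (legendre R n).[x]) = 0.
Proof.
move=> mn; pose a := legendre R m; pose b := legendre R n.
pose c : R := n%:R * n.+1%:R - m%:R * m.+1%:R.
have c0 : c != 0.
  rewrite subr_eq0 -!natrM eqr_nat; apply: contra mn => /eqP h.
  have lt_sqr i j : (i < j)%N -> (i * i.+1 < j * j.+1)%N by move=> ij; apply: ltn_mul.
  by case: ltngtP => // /lt_sqr; rewrite h ltnn.
apply: (mulfI c0); rewrite mulr0.
have cab : continuous (fun x => a.[x] * b.[x]).
  by move=> x; apply: cvgM; exact: continuous_horner.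
rewrite -RintegralZl//; last exact: continuousT_integrable.
pose F (x : R) := (1 - x ^+ 2) * (a^`().[x] * b.[x] - a.[x] * b^`().[x]).
transitivity (F 1 - F (-1)); last by rewrite /F sqrrN expr1n subrr !mul0r subrr.
apply: FTC2_continuousT; first by rewrite -subr_gt0; lra.
  by move=> x; apply: cvgM; [exact: cvg_cst|exact: cab].
move=> x; apply: has_derivative_eq.
  apply: has_derivativeM.
    by apply: has_derivativeD; [exact: has_derivative_cst|apply: has_derivativeN; apply: has_derivativeX; exact: has_derivative_id].
  apply: has_derivativeD; first by apply: has_derivativeM; exact: has_derivative_horner.
  by apply: has_derivativeN; apply: has_derivativeM; exact: has_derivative_horner.
have := horner_legendre_ode n x; have := horner_legendre_ode m x.
rewrite -/a -/b /= expr1 => ea eb.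
transitivity (- (2 * x) * (a^`().[x] * b.[x] - a.[x] * b^`().[x]) + (((1 - x ^+ 2) * a^`()^`().[x]) * b.[x] - a.[x] * ((1 - x ^+ 2) * b^`()^`().[x]))).
  by move: a^`()^`() a^`() b^`()^`() b^`() => a2 a1 b2 b1; ring.
by rewrite ea eb /c; move: a^`() b^`() => a1 b1; ring.
Qed.

Lemma frac_tailN1 n j : (0 < j)%N -> (j <= n)%N -> frac_tail j%:R (L n) (-1) = 0.
Proof.
case: j => // j _ jn; elim: j jn => [|j IH] jn; last first.
  have s1 : 1 < j.+2%:R :> R by rewrite ltr1n.
  have := @frac_legendre_ode R n j.+2%:R 2 s1 (ltr0n R 2).
  have -> : j.+2%:R - 1 = j.+1%:R :> R by rewrite -[j.+2%:R]natr1 addrK.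
  have := IH (ltnW jn); rewrite /frac_tail opprK => ->.
  rewrite subrr mulr0 mul0r mulr0 subr0 add0r => /eqP; rewrite mulf_eq0 => /orP[|/eqP//].
  have jn' : j.+2%:R <= n%:R :> R by rewrite ler_nat.
  have c1 : 0 < n%:R - j.+2%:R + 1 :> R by lra.
  have c2 : 0 < n%:R + j.+2%:R :> R by lra.
  by rewrite (gt_eqF (mulr_gt0 c1 c2)).
have := @Rintegral_frac_tail 0 (L n) (-1) 1 (lexx _) (lexx _) _ (lexx _).
rewrite add0r frac_tail1// subr0 => <-; last by lra.
have n0 : (0 != n)%N by case: (n) jn.
rewrite -[RHS](legendre_orthogonal n0) legendre0; apply: eq_Rintegral => x.
by rewrite inE/= in_itv/= => /andP[_ x1]; rewrite frac_tail0// -polyC1 hornerC mul1r.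
Qed.

Lemma frac_tail_le n s x : 1 < s -> s < n.+1%:R -> -1 <= x <= 1 ->
  `|frac_tail s (L n) x| <= legendre_max n s.
Proof. by move=> s1 sn x1; apply: frac_legendre_le => //; lra. Qed.

End legendre_tail.

Section integration_by_parts_chain.
Context {R : realType}.
Implicit Types (u g h : R -> R) (x y : R) (k n j : nat).
Local Notation mu := (@lebesgue_measure R).
Local Notation L := (@legendre_flip R).

Lemma ae_neq (a : R) : {ae mu, forall x, x != a}.
Proof.
exists [set a]; split; [exact: measurable_set1|exact: lebesgue_measure_set1|].
by move=> x /= /negP; rewrite negbK => /eqP.
Qed.

Lemma AC_derivatives_density k u : AC_derivatives (-1) 1 k.+1 u ->
  exists (g : nat -> R -> R) (h : R -> R),
  [/\ g 0%N = u, forall j, (j <= k)%N -> absolutely_continuous (-1) 1 (g j),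
    forall j x, (j < k)%N -> -1 < x < 1 -> has_derivative (g j) x (g j.+1 x) &
    [/\ mu.-integrable setT (EFin \o h),
    forall x, -1 <= x <= 1 -> \int[mu]_(t in `[-1, x]) h t = g k x - g k (-1) &
    ae_eq mu `[-1, 1]%classic (derive1n k.+1 u) h]].
Proof.
move=> [acu acD].
have /choice[g gP] : forall j, exists g, (j <= k)%N -> [/\ j = 0%N -> g = u, absolutely_continuous (-1) 1 g &
    forall x, -1 < x < 1 -> g x = derive1n j u x].
  case=> [|j]; first by exists u.
  have [jk|kj] := ltnP j k; last by exists u.
  by have [_ [g ag gE]] := acD j jk; exists g => _; split.
exists g.
have ge j x : (j <= k)%N -> -1 < x < 1 -> \forall y \near x, g j y = derive1n j u y.
  move=> jk x1; have [_ _ gE] := gP _ jk; near=> y; apply: gE.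
  have : y \in `]-1, 1[ by near: y; apply: near_in_itvoo; rewrite in_itv.
  by rewrite in_itv.
have [_ agk _] := gP _ (leqnn k).
have lt11 : -1 < 1 :> R by lra.
have [h [ih hE hd]] := absolutely_continuous_derive lt11 agk; exists h; split.
- by have [/(_ erefl)] := gP 0%N (leq0n k).
- by move=> j /gP[].
- move=> j x jk x1; have [dj _] := acD j jk.
  have [_ _ gE] := gP j.+1 jk; rewrite gE// derive1nS.
  have dd : has_derivative (derive1n j u) x (derive1 (derive1n j u) x).
    by rewrite derive1E; apply: DeriveDef => //; exact: dj.
  apply: is_derive_near_eq dd; have := ge j x (ltnW jk) x1.
  by apply: filterS => y ->.
split => //.
have aefilter := ae_filter_ringOfSetsType mu.
apply: filterS3 hd (ae_neq 1) (ae_neq (-1)) => x /= hdx x1 x1'; rewrite in_itv/= => /andP[l1 l2].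
have xI : -1 < x < 1 by rewrite !lt_neqAle l1 l2 x1 eq_sym x1'.
rewrite derive1E.
have dd : has_derivative (derive1n k u) x (h x) by apply: is_derive_near_eq (hdx xI); exact: ge.
by have [] := dd.
Unshelve. all: by end_near. Qed.

Lemma absolutely_continuous_within a b g : absolutely_continuous a b g ->
  {within `[a, b], continuous g}.
Proof.
move=> acg; apply/subspace_continuousP => x xab; apply/cvgrPdist_lt => e e0.
move: xab; rewrite /= in_itv/= => xab.
have [d d0 hd] := absolutely_continuous_continuous acg xab e0.
rewrite near_withinE; near=> y => yab; rewrite distrC; apply: hd; first by move: yab; rewrite /= in_itv.
by rewrite distrC; near: y; exact: cvgr_dist_lt.
Unshelve. all: by end_near. Qed.

Lemma absolutely_continuous_interior a b g x : absolutely_continuous a b g ->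
  a < x < b -> {for x, continuous g}.
Proof.
move=> acg xab; apply/cvgrPdist_lt => e e0.
have xab' : a <= x <= b by case/andP: xab => ? ?; rewrite !ltW.
have [d d0 hd] := absolutely_continuous_continuous acg xab' e0.
near=> y; rewrite distrC; apply: hd.
  have : y \in `]a, b[ by near: y; apply: near_in_itvoo; rewrite in_itv.
  by rewrite in_itv/= => /andP[? ?]; rewrite !ltW.
by rewrite distrC; near: y; exact: cvgr_dist_lt.
Unshelve. all: by end_near. Qed.

Let integrable_mul g (s : R) n : 0 <= s -> absolutely_continuous (-1) 1 g ->
  mu.-integrable `[-1, 1] (EFin \o (fun x => g x * frac_tail s (L n) x)).
Proof.
move=> s0 acg; have lt11 : -1 <= 1 :> R by lra.
have [C hC] := frac_tail_bounded (L n) s0.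
apply: bounded_variation_integrable hC => //.
  exact: absolutely_continuous_bounded_variation acg.
by apply: measurable_funTS; exact: measurable_frac_tail.
Qed.

Lemma Rintegral_legendre_parts k u n (g : nat -> R -> R) h :
  g 0%N = u -> (forall j, (j <= k)%N -> absolutely_continuous (-1) 1 (g j)) ->
  (forall j x, (j < k)%N -> -1 < x < 1 -> has_derivative (g j) x (g j.+1 x)) ->
  mu.-integrable setT (EFin \o h) ->
  (forall x, -1 <= x <= 1 -> \int[mu]_(t in `[-1, x]) h t = g k x - g k (-1)) ->
  (k < n)%N ->
  \int[mu]_(x in `[-1, 1]) (u x * (legendre R n).[x]) =
  \int[mu]_(x in `[-1, 1]) (h x * frac_tail k.+1%:R (L n) x).
Proof.
move=> g0 acg dg ih hE kn; have lt11 : -1 < 1 :> R by lra.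
have step j : (j <= k)%N -> \int[mu]_(x in `[-1, 1]) (u x * (legendre R n).[x]) =
    \int[mu]_(x in `[-1, 1]) (g j x * frac_tail j%:R (L n) x).
  elim: j => [_|j IH jk].
    rewrite g0; apply: eq_Rintegral => x; rewrite inE/= in_itv/= => /andP[_ x1].
    by rewrite frac_tail0.
  rewrite (IH (ltnW jk)); apply/eqP; rewrite -subr_eq0 -oppr_eq0 opprB; apply/eqP.
  have i1 := integrable_mul n (ler0n R j.+1) (acg _ jk).
  have i0 := integrable_mul n (ler0n R j) (acg _ (ltnW jk)).
  rewrite -RintegralB//.
  have j1 : j.+1%:R = j%:R + 1 :> R by rewrite natr1.
  have j0 : 0 < j%:R + 1 :> R by rewrite -j1.
  pose F x := g j x * frac_tail (j%:R + 1) (L n) x.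
  transitivity (F 1 - F (-1)); last first.
    by rewrite /F -!j1 frac_tail1// frac_tailN1// ?mulr0 ?subrr// (leq_trans jk (ltnW kn)).
  apply: (@FTC2_integrable _ _ F) => //.
  - exact: integrableB_EFin.
  - move=> x; rewrite in_itv/= => x1; have /andP[_ x1'] := x1.
    have z0 : 0 < 1 - x by rewrite subr_gt0.
    have c s : {for x, continuous (frac_tail s (L n))}.
      apply: (@continuous_comp _ _ _ (fun x => 1 - x) (frac_poly s (L n))); last exact: frac_poly_continuous_pos.
      by apply: cvgB; [exact: cvg_cst|exact: cvg_id].
    apply: cvgB; apply: cvgM; try exact: c.
      exact: absolutely_continuous_interior (acg _ jk) x1.
    exact: absolutely_continuous_interior (acg _ (ltnW jk)) x1.
  - move=> x; apply: cvgM; first exact: (absolutely_continuous_within (acg _ (ltnW jk))).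
    exact: frac_tail_continuous.
  - move=> x; rewrite in_itv/= => x1; have /andP[_ x1'] := x1.
    have H := has_derivativeM (dg j x jk x1) (has_derivative_frac_tail (L n) x1' (ler0n R j)).
    by rewrite mulrN in H; rewrite j1; exact: H.
rewrite (step k (leqnn k)).
have k1 : k.+1%:R = k%:R + 1 :> R by rewrite natr1.
have ig := integrable_mul n (ler0n R k) (acg _ (leqnn k)).
have it := @frac_tail_integrable R k%:R (L n) (-1) 1 (ler0n R k) (lexx _) (lexx _).
have it' : mu.-integrable `[-1, 1] (EFin \o (fun x => g k (-1) * frac_tail k%:R (L n) x)) by exact: integrableZl_EFin.
have t0 : \int[mu]_(x in `[-1, 1]) (g k (-1) * frac_tail k%:R (L n) x) = 0.
  rewrite RintegralZl// Rintegral_frac_tail ?(ltW lt11)// -k1 frac_tail1// frac_tailN1//.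
  by rewrite subrr mulr0.
rewrite -[LHS]subr0 -t0 -RintegralB//.
have [C hC] := frac_tail_bounded (L n) (ler0n R k).
have mT : measurable_fun setT (frac_tail k%:R (L n)) by exact: measurable_frac_tail.
have := fubini_triangle lt11 ltr01 ih mT hC.
have -> : \int[mu]_(x in `[-1, 1]) (frac_tail k%:R (L n) x * \int[mu]_(y in `[-1, x]) (h y * (x - y) `^ (1 - 1))) =
    \int[mu]_(x in `[-1, 1]) (g k x * frac_tail k%:R (L n) x - g k (-1) * frac_tail k%:R (L n) x).
  apply: eq_Rintegral => x; rewrite inE/= in_itv/= => x1.
  rewrite -mulrBl -(hE _ x1) mulrC; congr (_ * _); apply: eq_Rintegral => y _.
  by rewrite subrr powRr0 mulr1.
move=> ->; apply: eq_Rintegral => y; rewrite inE/= in_itv/= => /andP[y0 y1].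
congr (_ * _); rewrite k1 -[RHS]subr0 -(@frac_tail1 R (k%:R + 1) (L n)) -?k1// k1.
rewrite -Rintegral_frac_tail//; apply: eq_Rintegral => x _.
by rewrite subrr powRr0 mulr1.
Qed.

End integration_by_parts_chain.

Section integral_reflection.
Context {R : realType}.
Implicit Types (a b x y : R) (h v : R -> R).
Local Notation mu := (@lebesgue_measure R).

Lemma Rintegral_itvZl a b (c : R) h : mu.-integrable `[a, b] (EFin \o h) ->
  \int[mu]_(x in `[a, b]) (c * h x) = c * \int[mu]_(x in `[a, b]) h x.
Proof. by move=> ih; rewrite RintegralZl. Qed.

Lemma ge0_integral_reflect (D : set (measurableTypeR R)) (f : R -> \bar R) : measurable D ->
  measurable_fun setT f -> (forall x, 0 <= f x)%E ->
  (\int[mu]_(x in D) f x = \int[mu]_(x in (-%R : R -> measurableTypeR R) @^-1` D) f (- x)%R)%E.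
Proof.
have mN : measurable_fun setT (-%R : R -> measurableTypeR R) by exact: oppr_measurable.
move=> mD mf f0; rewrite -[RHS]ge0_integral_pushforward//=; last exact: measurable_funTS mf.
by apply: eq_measure_integral => //= A mA _; exact/esym/lebesgue_measureN.
Qed.

Lemma Rintegral_reflect a b h : measurable_fun setT h ->
  \int[mu]_(x in `[a, b]) h x = \int[mu]_(x in `[- b, - a]) h (- x).
Proof.
move=> mh; rewrite [LHS]/Rintegral [RHS]/Rintegral; congr fine.
have mEh : measurable_fun setT (EFin \o h) by exact/measurable_EFinP.
have mI : measurable (`[a, b]%classic : set (measurableTypeR R)) by exact: measurable_itv.
rewrite (_ : `[(- b)%R, (- a)%R]%classic = (-%R : _ -> measurableTypeR R) @^-1` `[a, b]); last first.
  by rewrite opp_preimage_itvbndbnd.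
rewrite integralE [RHS]integralE ge0_integral_reflect//; last exact: measurable_funepos.
rewrite [X in (_ - X)%E]ge0_integral_reflect//; last exact: measurable_funeneg.
by congr (_ - _)%E; apply: eq_integral => x _; rewrite ?(funeposE, funenegE).
Qed.

Lemma ae_reflect (P : R -> Prop) : {ae mu, forall x, P x} -> {ae mu, forall x, P (- x)}.
Proof.
have mN : measurable_fun setT (-%R : R -> measurableTypeR R) by exact: oppr_measurable.
move=> [N [mN' N0 PN]]; exists (-%R @^-1` N); split.
- by rewrite -[X in measurable X]setTI; exact: mN.
- by rewrite -N0; exact: lebesgue_measureN.
- by move=> x /= Px; exact: PN.
Qed.

Lemma bounded_variation_reflect a b v : a <= b -> bounded_variation a b v ->
  bounded_variation (- b) (- a) (v \o -%R).
Proof.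
move=> ab /(bounded_variationP _ ab) bv; apply/bounded_variationP; first by rewrite lerN2.
by rewrite -total_variation_opp.
Qed.

Lemma lim_reflect a v : lim ((v \o -%R) x @[x --> (- a)^'+]) = lim (v x @[x --> a^'-]).
Proof.
rewrite at_rightN; congr (lim _); apply/funext => A.
by rewrite /fmap/= /nbhs/=; apply/propext; split; apply: filterS => x /=; rewrite opprK.
Qed.

End integral_reflection.

Section coefficient_bounds.
Context {R : realType}.
Implicit Types (s mu theta x y : R) (h v : R -> R) (k n : nat).
Local Notation lam := (@lebesgue_measure R).
Local Notation L := (@legendre_flip R).
Local Notation TV := total_variation.

Lemma frac_tail_parity n k x : (k <= n)%N -> -1 <= x <= 1 ->
  frac_tail k%:R (L n) (- x) = (-1) ^+ (n + k) * frac_tail k%:R (L n) x.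
Proof.
elim: k x => [|k IH] x kn /andP[x0 x1].
  by rewrite !frac_tail0 ?addn0 ?horner_legendreN//; lra.
have k1 : k.+1%:R = k%:R + 1 :> R by rewrite natr1.
have k0 : 0 <= k%:R :> R by [].
have e1 : frac_tail k.+1%:R (L n) x = \int[lam]_(y in `[x, 1]) frac_tail k%:R (L n) y.
  by rewrite Rintegral_frac_tail// -!k1 frac_tail1// subr0.
have x0' : -1 <= - x by lra.
have x1' : - x <= 1 by lra.
have e2 : frac_tail k.+1%:R (L n) (- x) = - \int[lam]_(y in `[-1, - x]) frac_tail k%:R (L n) y.
  by rewrite Rintegral_frac_tail// -!k1 frac_tailN1// sub0r opprK.
rewrite e1 e2 Rintegral_reflect ?opprK; last exact: measurable_frac_tail.
rewrite addnS exprS mulN1r mulNr; congr (- _).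
rewrite -(Rintegral_itvZl _ (frac_tail_integrable _ k0 x0 (lexx _))).
apply: eq_Rintegral => y; rewrite inE/= in_itv/= => /andP[xy y1].
by rewrite IH ?(ltnW kn)// y1 (le_trans x0).
Qed.

Let FTC_tail s n a b : 0 <= s -> -1 <= a -> a <= b -> b <= 1 ->
  \int[lam]_(x in `[a, b]) frac_tail s (L n) x = - frac_tail (s + 1) (L n) b - - frac_tail (s + 1) (L n) a.
Proof. by move=> *; rewrite Rintegral_frac_tail// opprK addrC. Qed.

Lemma right_half_bound n k mu theta h v :
  k%:R - 1 < mu < k%:R -> 0 < mu -> mu < n%:R -> -1 <= theta < 1 ->
  lam.-integrable setT (EFin \o h) -> bounded_variation theta 1 v ->
  {ae lam, forall x, theta <= x <= 1 ->
    (Gamma (k%:R - mu))^-1 * \int[lam]_(y in `[theta, x]) (h y * (x - y) `^ (k%:R - mu - 1)) = v x} ->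
  `|\int[lam]_(x in `[theta, 1]) (h x * frac_tail k%:R (L n) x)| <=
  legendre_max n (mu + 1) * (fine (TV theta 1 v) + `|lim (v x @[x --> theta^'+])|).
Proof.
move=> /andP[mu1 mu2] mu0 mun /andP[t0 t1] ih bv vE.
have aefilter := ae_filter_ringOfSetsType lam.
have r0 : 0 < k%:R - mu by rewrite subr_gt0.
have g0 := Gamma_gt0 r0.
have [C hC] := frac_tail_bounded (L n) (ltW mu0).
have mT : measurable_fun setT (frac_tail mu (L n)) by exact: measurable_frac_tail.
have hC' x : theta <= x <= 1 -> `|frac_tail mu (L n) x| <= C.
  by move=> /andP[tx x1]; apply: hC; rewrite (le_trans t0).
have -> : \int[lam]_(x in `[theta, 1]) (h x * frac_tail k%:R (L n) x) =
    \int[lam]_(x in `[theta, 1]) (v x * frac_tail mu (L n) x).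
  have kernelE y : y <= 1 -> \int[lam]_(x in `[y, 1]) (frac_tail mu (L n) x * (x - y) `^ (k%:R - mu - 1)) =
      Gamma (k%:R - mu) * frac_tail k%:R (L n) y.
    by move=> y1; rewrite Rintegral_frac_tail_kernel// subrKC.
  have i2 : lam.-integrable `[theta, 1] (EFin \o (fun y => h y * frac_tail k%:R (L n) y)).
    have [D hD] := frac_tail_bounded (L n) (ler0n R k).
    have ih' : lam.-integrable `[theta, 1] (EFin \o h) by apply: integrableS ih.
    have mk : measurable_fun `[theta, 1] (frac_tail k%:R (L n)) by apply: measurable_funTS; exact: measurable_frac_tail.
    apply: (integrableMl _ ih' mk) => //.
    exists D; split; first exact: num_real.
    move=> M hM x; rewrite /= in_itv/= => /andP[tx x1].
    by apply: le_trans (ltW hM); apply: hD; rewrite (le_trans t0).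
  have F := fubini_triangle t1 r0 ih mT hC'.
  have i1 := bounded_variation_integrable (ltW t1) bv (measurable_funTS mT) hC'.
  move: (Gamma _) g0 vE kernelE => G g0 vE kernelE.
  have E1 : \int[lam]_(y in `[theta, 1]) (h y * \int[lam]_(x in `[y, 1]) (frac_tail mu (L n) x * (x - y) `^ (k%:R - mu - 1))) =
     \int[lam]_(y in `[theta, 1]) (G * (h y * frac_tail k%:R (L n) y)).
    apply: eq_Rintegral => y; rewrite inE/= in_itv/= => /andP[ty y1].
    by rewrite (kernelE _ y1) mulrCA.
  have E2 : \int[lam]_(x in `[theta, 1]) (frac_tail mu (L n) x * \int[lam]_(y in `[theta, x]) (h y * (x - y) `^ (k%:R - mu - 1))) =
     \int[lam]_(x in `[theta, 1]) (G * (v x * frac_tail mu (L n) x)).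
    rewrite [LHS]/Rintegral [RHS]/Rintegral; apply: (congr1 fine); apply: ae_eq_integralW.
    apply: filterS vE => x /= vx xt; rewrite -vx; last by move: xt; rewrite in_itv.
    by move: (Rintegral _ _ _) (frac_tail _ _ _) => I T; congr EFin; field; rewrite gt_eqF.
  have {F}E := etrans (etrans (esym E2) F) E1.
  by apply: (mulfI (lt0r_neq0 g0)); exact: etrans (esym (Rintegral_itvZl G i2)) (etrans (esym E) (Rintegral_itvZl G i1)).
have lim0 : frac_tail (mu + 1) (L n) 1 = 0 by rewrite frac_tail1// addr_gt0.
apply: (bounded_variation_parts_right (Q := fun x => - frac_tail (mu + 1) (L n) x) t1 bv (measurable_funTS mT) hC').
- move=> x /andP[tx x1]; rewrite normrN; apply: frac_tail_le; rewrite ?ltrDr//; first by rewrite -natr1 ltrD2r.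
  by rewrite x1 (le_trans t0).
- by move=> a b ta ab b1; rewrite FTC_tail ?(ltW mu0)// (le_trans t0).
- by rewrite lim0 oppr0.
Qed.

Lemma left_half_bound n k mu theta h v :
  k%:R - 1 < mu < k%:R -> 0 < mu -> mu < n%:R -> -1 < theta <= 1 ->
  lam.-integrable setT (EFin \o h) -> bounded_variation (-1) theta v ->
  {ae lam, forall x, -1 <= x <= theta ->
    (-1) ^+ k * ((Gamma (k%:R - mu))^-1 * \int[lam]_(y in `[x, theta]) (h y * (y - x) `^ (k%:R - mu - 1))) = v x} ->
  `|\int[lam]_(x in `[-1, theta]) (h x * frac_tail k%:R (L n) x)| <=
  legendre_max n (mu + 1) * (fine (TV (-1) theta v) + `|lim (v x @[x --> theta^'-])|).
Proof.
move=> mu12 mu0 mun /andP[t0 t1] ih bv vE; have /andP[mu1 mu2] := mu12.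
have kn : (k <= n)%N by rewrite -ltnS -(ltr_nat R) -[n.+1%:R]natr1; lra.
have mh : measurable_fun setT h by apply/measurable_EFinP; exact: measurable_int ih.
have mhN : measurable_fun setT (fun y => h (- y)) by apply: (measurableT_comp mh); exact: oppr_measurable.
have ihN : lam.-integrable setT (EFin \o (fun y => h (- y))).
  apply/integrableP; split; first exact/measurable_EFinP.
  have /integrableP[_] := ih; rewrite (ge0_integral_reflect (measurableT : measurable (setT : set (measurableTypeR R))))//.
  by apply: measurableT_comp => //; exact/measurable_EFinP.
pose v' x := (-1) ^+ k * v (- x).
have bvN := bounded_variation_reflect (ltW t0) bv; rewrite opprK in bvN.
have nt1 : - theta < 1 by lra.
have cvN := bounded_variation_right_cvg nt1 bvN.
have [bv' TV' lim'] : [/\ bounded_variation (- theta) 1 v', TV (- theta) 1 v' = TV (-1) theta v &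
    `|lim (v' x @[x --> (- theta)^'+])| = `|lim (v x @[x --> theta^'-])| ].
  rewrite [TV (-1) theta v]total_variation_opp opprK -lim_reflect.
  have [sE|sE] : (-1) ^+ k = 1 :> R \/ (-1) ^+ k = -1 :> R by rewrite -signr_odd; case: (odd k); [right|left].
    by have -> : v' = v \o -%R by apply/funext => x; rewrite /v' sE mul1r.
  have -> : v' = \- (v \o -%R) by apply/funext => x; rewrite /v' sE mulN1r.
  split; [exact: bounded_variationN|exact: total_variationN|].
  by rewrite (_ : lim _ = - lim ((v \o -%R) x @[x --> (- theta)^'+])) ?normrN//; exact: limN.
have := @right_half_bound n k mu (- theta) (fun y => h (- y)) v' mu12 mu0 mun.
rewrite lerN2 t1 nt1 TV' lim' => /(_ isT ihN bv') H.
have ae' : {ae lam, forall x, - theta <= x <= 1 -> (Gamma (k%:R - mu))^-1 *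
    \int[lam]_(y in `[- theta, x]) (h (- y) * (x - y) `^ (k%:R - mu - 1)) = v' x}.
  have aefilter := ae_filter_ringOfSetsType lam.
  apply: filterS (ae_reflect vE) => x /= vx tx1.
  have tx : -1 <= - x <= theta by case/andP: tx1 => ? ?; rewrite lerN2 lerNl; apply/andP.
  rewrite /v' -(vx tx) [RHS]mulrA -expr2 sqrr_sign mul1r; apply: (congr1 ( *%R _)).
  rewrite [RHS]Rintegral_reflect ?opprK.
    by apply: eq_Rintegral => y _; congr (_ * _ `^ _); ring.
  apply: measurable_funM => //; apply: (measurableT_comp (measurable_powR _)).
  by apply: measurable_funD.
have mT : measurable_fun setT (frac_tail k%:R (L n)) by exact: measurable_frac_tail.
rewrite Rintegral_reflect ?opprK; last exact: measurable_funM.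
apply: le_trans (H ae'); rewrite le_eqVlt; apply/orP; left; apply/eqP.
have [D hD] := frac_tail_bounded (L n) (ler0n R k).
have i2 : lam.-integrable `[- theta, 1] (EFin \o (fun y => h (- y) * frac_tail k%:R (L n) y)).
  have ih' : lam.-integrable `[- theta, 1] (EFin \o (fun y => h (- y))) by apply: integrableS ihN.
  have mk : measurable_fun `[- theta, 1] (frac_tail k%:R (L n)) by exact: measurable_funTS.
  apply: (integrableMl _ ih' mk) => //.
  exists D; split; first exact: num_real.
  move=> M hM x; rewrite /= in_itv/= => /andP[tx x1].
  by apply: le_trans (ltW hM); apply: hD; rewrite x1 andbT; apply: le_trans tx; rewrite lerN2.
transitivity `|(-1) ^+ (n + k) * \int[lam]_(x in `[- theta, 1]) (h (- x) * frac_tail k%:R (L n) x)|; last first.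
  by rewrite normrM normrX normrN1 expr1n mul1r.
rewrite -(Rintegral_itvZl _ i2); congr `|_|; apply: eq_Rintegral => x; rewrite inE/= in_itv/= => /andP[tx x1].
have x01 : -1 <= x <= 1 by rewrite x1 andbT; apply: le_trans tx; rewrite lerN2.
by rewrite (frac_tail_parity kn x01) mulrCA.
Qed.

Lemma whole_bound n k h v : (0 < k)%N -> (k < n)%N ->
  bounded_variation (-1) 1 v -> ae_eq lam `[-1, 1]%classic h v ->
  `|\int[lam]_(x in `[-1, 1]) (h x * frac_tail k%:R (L n) x)| <=
  legendre_max n (k%:R + 1) * fine (TV (-1) 1 v).
Proof.
move=> k0 kn bv hv; have aefilter := ae_filter_ringOfSetsType lam; have lt11 : -1 <= 1 :> R by lra.
have k0' : 0 < k%:R :> R by rewrite ltr0n.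
have -> : \int[lam]_(x in `[-1, 1]) (h x * frac_tail k%:R (L n) x) =
    \int[lam]_(x in `[-1, 1]) (v x * frac_tail k%:R (L n) x).
  rewrite [LHS]/Rintegral [RHS]/Rintegral; apply: (congr1 fine); apply: ae_eq_integralW.
  by apply: filterS hv => x /= hx xt; rewrite hx.
have [C hC] := frac_tail_bounded (L n) (ler0n R k).
have mT : measurable_fun setT (frac_tail k%:R (L n)) by exact: measurable_frac_tail.
pose Q x := - frac_tail (k%:R + 1) (L n) x.
have QM x : -1 <= x <= 1 -> `|Q x| <= legendre_max n (k%:R + 1).
  move=> x1; rewrite normrN; apply: frac_tail_le => //; first by rewrite ltrDr.
  by rewrite natr1 ltr_nat.
have Q1 : Q 1 = 0 by rewrite /Q frac_tail1 ?oppr0// addr_gt0.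
have QN1 : Q (-1) = 0 by rewrite /Q natr1 frac_tailN1 ?oppr0.
have := @bounded_variation_parts R v Q _ (-1) 1 _ C lt11 bv (measurable_funTS mT) hC QM.
rewrite Q1 QN1 !mulr0 !subr0; apply.
by move=> a b ta ab b1; rewrite FTC_tail.
Qed.

End coefficient_bounds.

Section legendre_projection.
Context {R : realType}.
Implicit Types (a b x y : R) (f g u : R -> R) (p q : {poly R}) (n m M : nat).
Local Notation mu := (@lebesgue_measure R).
Local Notation P := (legendre R).
Local Notation cont f := {within `[(-1 : R), (1 : R)], continuous (f : R -> R)}.

Let lt11 : -1 < 1 :> R. Proof. lra. Qed.

Let contI f : cont f -> mu.-integrable `[-1, 1] (EFin \o f).
Proof. by move=> cf; apply: continuous_compact_integrable => //; exact: segment_compact. Qed.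

Let contP p : cont (horner p).
Proof. by apply: continuous_subspaceT; exact: continuous_horner. Qed.

Let contC (c : R) : cont (fun=> c).
Proof. by move=> x; exact: cvg_cst. Qed.

Let contM f g : cont f -> cont g -> cont (fun x => f x * g x).
Proof. by move=> cf cg x; apply: cvgM; [exact: cf|exact: cg]. Qed.

Let contD f g : cont f -> cont g -> cont (fun x => f x + g x).
Proof. by move=> cf cg x; apply: cvgD; [exact: cf|exact: cg]. Qed.

Let contN f : cont f -> cont (fun x => - f x).
Proof. by move=> cf x; apply: cvgN; exact: cf. Qed.

Let RintD f g : cont f -> cont g ->
  \int[mu]_(x in `[-1, 1]) (f x + g x) = \int[mu]_(x in `[-1, 1]) f x + \int[mu]_(x in `[-1, 1]) g x.
Proof. by move=> /contI f1 /contI g1; rewrite RintegralD. Qed.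

Let RintZ f (c : R) : cont f ->
  \int[mu]_(x in `[-1, 1]) (c * f x) = c * \int[mu]_(x in `[-1, 1]) f x.
Proof. by move=> /contI f1; rewrite Rintegral_itvZl. Qed.

Let Rint_sum f (c : nat -> R) M : cont f ->
  \int[mu]_(x in `[-1, 1]) (f x * (\sum_(n < M) c n *: P n).[x]) =
  \sum_(n < M) c n * \int[mu]_(x in `[-1, 1]) (f x * (P n).[x]).
Proof.
move=> cf; elim: M => [|M IH].
  by rewrite !big_ord0 /Rintegral integral0_eq// => x _; rewrite horner0 mulr0.
rewrite [RHS]big_ord_recr /= -IH -RintZ; last exact: contM.
rewrite -RintD; [|exact: contM|by apply: contM; [exact: contC|exact: contM]].
by apply: eq_Rintegral => x _; rewrite big_ord_recr hornerD hornerZ mulrDr mulrCA.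
Qed.

Lemma legendre_span M p : (size p <= M)%N -> exists c : nat -> R, p = \sum_(n < M) c n *: P n.
Proof.
elim: M p => [|M IH] p pM.
  by exists (fun=> 0); rewrite big_ord0; apply/eqP; rewrite -size_poly_leq0.
have lc0 : (P M)`_M != 0.
  by have := lead_coef_eq0 (P M); rewrite lead_coefE size_legendre /= => ->; rewrite -size_poly_eq0 size_legendre.
have [|c cE] := IH (p - (p`_M / (P M)`_M) *: P M).
  apply/leq_sizeP => j; rewrite leq_eqVlt => /predU1P[<-|Mj].
    by rewrite coefB coefZ divfK// subrr.
  by rewrite coefB coefZ (nth_default _ (leq_trans pM Mj)) (nth_default _ (_ : size (P M) <= j)%N) ?mulr0 ?subrr// size_legendre.
exists (fun n => if n == M then p`_M / (P M)`_M else c n).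
rewrite big_ord_recr /= eqxx -[LHS](subrK ((p`_M / (P M)`_M) *: P M)) cE; congr (_ + _).
by apply: eq_bigr => i _; rewrite ltn_eqF.
Qed.

Lemma legendre_orthogonal_low n p : (size p <= n)%N ->
  \int[mu]_(x in `[-1, 1]) ((P n).[x] * p.[x]) = 0.
Proof.
move=> /legendre_span[c ->]; rewrite Rint_sum//; apply: big1 => i _.
by rewrite legendre_orthogonal ?mulr0// gtn_eqF.
Qed.

Lemma legendre_norm n : \int[mu]_(x in `[-1, 1]) ((P n).[x] * (P n).[x]) = 2 / (2 * n%:R + 1).
Proof.
suff : (n%:R + 2^-1) * \int[mu]_(x in `[-1, 1]) ((P n).[x] * (P n).[x]) = 1.
  have n0 : 0 < 2 * n%:R + 1 :> R by rewrite ltr_wpDl// mulr_ge0.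
  move=> h; apply: (@mulfI _ (n%:R + 2^-1)); first by rewrite gt_eqF// ltr_wpDl.
  by rewrite h; field; rewrite gt_eqF.
pose q := 'X * (P n)^`() - n%:R *: P n.
have sq : (size q <= n)%N.
  rewrite /q; case: (n) => [|m]; first by rewrite scale0r subr0 legendre0 -polyC1 derivC mulr0 size_poly0.
  by rewrite -deriv_legendre (leq_trans (ltnW (lt_size_deriv _)))// -?size_poly_eq0 size_legendre.
have e : n%:R * \int[mu]_(x in `[-1, 1]) ((P n).[x] * (P n).[x]) =
    \int[mu]_(x in `[-1, 1]) ((P n).[x] * ('X * (P n)^`()).[x]).
  rewrite -RintZ; last exact: contM.
  rewrite -[RHS]subr0 -(legendre_orthogonal_low sq).
  have e1 : \int[mu]_(x in `[-1, 1]) ((P n).[x] * ('X * (P n)^`()).[x]) = \int[mu]_(x in `[-1, 1]) (n%:R * ((P n).[x] * (P n).[x]) + (P n).[x] * q.[x]).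
    by apply: eq_Rintegral => x _; rewrite /q; move: (P n)^`() (P n) => d p; rewrite hornerD hornerN hornerZ; ring.
  rewrite e1 RintD ?addrK//; last exact: contM.
  by apply: contM; [exact: contC|exact: contM].
rewrite mulrDl e -RintZ; last exact: contM.
rewrite -RintD; [|exact: contM|by apply: contM; [exact: contC|exact: contM]].
pose F (x : R) := 2^-1 * (x * ((P n).[x] * (P n).[x])).
transitivity (F 1 - F (-1)); last first.
  rewrite /F horner_legendreN horner_legendre1 !mulr1 (_ : (-1) ^+ n * (-1) ^+ n = 1 :> R).
    by field.
  by rewrite -expr2 sqrr_sign.
apply: FTC2_continuousT => //.
  move=> x; apply: cvgD; first by apply: cvgM; exact: continuous_horner.
  by apply: cvgM; [exact: cvg_cst|apply: cvgM; exact: continuous_horner].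
move=> x; apply: has_derivative_eq.
  apply: has_derivativeM; first exact: has_derivative_cst.
  by apply: has_derivativeM; [exact: has_derivative_id|apply: has_derivativeM; exact: has_derivative_horner].
rewrite hornerM hornerX; move: (P n)^`() (P n) => p' p0; by field.
Qed.

Lemma legendre_residual u M n : cont u -> (n <= M)%N ->
  \int[mu]_(x in `[-1, 1]) ((u x - (legendre_proj M u).[x]) * (P n).[x]) = 0.
Proof.
move=> cu nM.
have -> : \int[mu]_(x in `[-1, 1]) ((u x - (legendre_proj M u).[x]) * (P n).[x]) =
    \int[mu]_(x in `[-1, 1]) (u x * (P n).[x] + (-1) * ((P n).[x] * (legendre_proj M u).[x])).
  by apply: eq_Rintegral => x _; move: ((P n).[x]) ((legendre_proj M u).[x]) => A B; ring.
rewrite RintD ?RintZ; [|exact: contM|exact: contM|by apply: contM; [exact: contC|exact: contM]].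
rewrite /legendre_proj (Rint_sum (fun i => legendre_coef u i))// (bigD1 (Ordinal (nM : (n < M.+1)%N)))//= big1 ?addr0.
  have n0 : 0 < 2 * n%:R + 1 :> R by rewrite ltr_wpDl// mulr_ge0.
  rewrite legendre_norm /legendre_coef; move: (Rintegral _ _ _) => I; field; by rewrite gt_eqF.
move=> i /eqP ni; rewrite legendre_orthogonal ?mulr0//; apply/eqP => e; apply: ni; exact: val_inj.
Qed.

Lemma legendre_residual_poly u M p : cont u -> (size p <= M.+1)%N ->
  \int[mu]_(x in `[-1, 1]) ((u x - (legendre_proj M u).[x]) * p.[x]) = 0.
Proof.
move=> cu /legendre_span[c ->]; rewrite Rint_sum; last by apply: contD => //; exact: contN.
by apply: big1 => i _; rewrite legendre_residual ?mulr0// -ltnS.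
Qed.

Lemma size_legendre_proj M u : (size (legendre_proj M u) <= M.+1)%N.
Proof.
apply: leq_trans (size_sum _ _ _) _; apply/bigmax_leqP => i _.
by rewrite (leq_trans (size_scale_leq _ _))// size_legendre.
Qed.

Lemma legendre_bessel u M : cont u ->
  \int[mu]_(x in `[-1, 1]) ((u x - (legendre_proj M u).[x]) ^+ 2) <= \int[mu]_(x in `[-1, 1]) (u x ^+ 2).
Proof.
move=> cu; have cd : cont (fun x => u x - (legendre_proj M u).[x]) by apply: contD => //; exact: contN.
have c1 : cont (fun x => (u x - (legendre_proj M u).[x]) ^+ 2) by exact: contM.
have c2 : cont (fun x => (legendre_proj M u).[x] ^+ 2) by exact: contM.
have c3 : cont (fun x => (u x - (legendre_proj M u).[x]) * (legendre_proj M u).[x]) by exact: contM.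
have -> : \int[mu]_(x in `[-1, 1]) (u x ^+ 2) = \int[mu]_(x in `[-1, 1]) ((u x - (legendre_proj M u).[x]) ^+ 2 +
   ((legendre_proj M u).[x] ^+ 2 + 2 * ((u x - (legendre_proj M u).[x]) * (legendre_proj M u).[x]))).
  by apply: eq_Rintegral => x _; move: (_.[x]) => A; ring.
rewrite RintD ?RintD ?RintZ//.
- rewrite legendre_residual_poly ?size_legendre_proj// mulr0 addr0 lerDl.
  by apply: Rintegral_ge0 => x _; exact: sqr_ge0.
- by apply: contM => //; exact: contC.
- by apply: contD => //; apply: contM => //; exact: contC.
Qed.

(* If the residuals kept a constant sign near [x0], the polynomials
   [(1 - (x - x0)^2 / 4)^m], which peak at [x0], could not be orthogonal to them. *)
Lemma legendre_residual_sign u N x0 eta e s : cont u -> 0 < eta ->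
  -1 <= x0 - eta -> x0 + eta <= 1 -> 0 < e -> `|s| = 1 ->
  (forall M x, (N <= M)%N -> `|x - x0| <= eta -> e <= s * (u x - (legendre_proj M u).[x])) -> False.
Proof.
move=> cu eta0 xl xr e0 s1 H.
pose r := 1 - eta ^+ 2 / 4; pose r' := 1 - eta ^+ 2 / 16.
have eta1 : eta <= 1 by lra.
have eta21 : eta ^+ 2 <= 1 by rewrite expr_le1// ltW.
have eta20 : 0 < eta ^+ 2 by rewrite exprn_gt0.
have r0 : 0 < r by rewrite /r; lra.
have rr' : r < r' by rewrite /r /r'; lra.
have r'0 : 0 < r' := lt_trans r0 rr'.
pose C := 1 + 2^-1 * \int[mu]_(x in `[-1, 1]) (u x ^+ 2).
have [m hm] : exists m, r ^+ m * C < e * r' ^+ m * eta.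
  have q1 : `|r / r'| < 1 by rewrite gtr0_norm ?divr_gt0// ltr_pdivrMr// mul1r.
  have h : (r / r') ^+ n * C @[n --> \oo] --> 0 * C by apply: cvgM; [exact: cvg_expr|exact: cvg_cst].
  move/cvgrPdist_lt : h => /(_ (e * eta) (mulr_gt0 e0 eta0))[m _ /(_ m (leqnn m))]/=.
  rewrite mul0r sub0r normrN => /(le_lt_trans (ler_norm _)).
  rewrite expr_div_n -[_ / _ * C]mulrAC ltr_pdivrMr ?exprn_gt0// => hm.
  by exists m; rewrite mulrAC.
pose p : {poly R} := (1 - 4^-1 *: ('X - x0%:P) ^+ 2) ^+ m.
pose M := maxn N m.*2.
have sp : (size p <= M.+1)%N.
  apply: leq_trans (size_poly_exp_leq _ _) _; rewrite ltnS (leq_trans _ (leq_maxr _ _))//.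
  have sq : (size (1 - 4^-1 *: ('X - x0%:P) ^+ 2)%R <= 3)%N.
    rewrite (leq_trans (size_polyD _ _))// geq_max size_poly1 size_polyN /=.
    by rewrite (leq_trans (size_scale_leq _ _))// size_exp_XsubC.
  by rewrite -mul2n leq_mul2r; apply/orP; right; case: (size _) sq.
have pE x : p.[x] = (1 - (x - x0) ^+ 2 / 4) ^+ m.
  by rewrite /p horner_exp hornerD hornerN hornerZ horner_exp hornerXsubC hornerC mulrC.
pose d x := u x - (legendre_proj M u).[x].
have cd : cont d by apply: contD => //; exact: contN.
pose G x := s * (d x * p.[x]) + r ^+ m * (2^-1 * (1 + d x * d x)).
have cdp : cont (fun x => d x * p.[x]) by exact: contM.
have cd2 : cont (fun x => d x * d x) by exact: contM.
have c1d2 : cont (fun x => 1 + d x * d x) by apply: contD => //; exact: contC.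
have ch : cont (fun x => 2^-1 * (1 + d x * d x)) by apply: contM => //; exact: contC.
have crh : cont (fun x => r ^+ m * (2^-1 * (1 + d x * d x))) by apply: contM => //; exact: contC.
have csdp : cont (fun x => s * (d x * p.[x])) by apply: contM => //; exact: contC.
have cG : cont G by exact: contD.
have pbase x : -1 <= x <= 1 -> 0 <= 1 - (x - x0) ^+ 2 / 4.
  move=> x1; have xx2 : `|x - x0| <= 2 by rewrite ler_distl; lra.
  have : `|x - x0| ^+ 2 <= 2 ^+ 2 by apply: lerXn2r => //; rewrite nnegrE.
  by rewrite real_normK ?num_real// -natrX; lra.
have p0 x : -1 <= x <= 1 -> 0 <= p.[x] by move=> /pbase x1; rewrite pE exprn_ge0.
have h0 x : 0 <= r ^+ m * (2^-1 * (1 + d x * d x)).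
  by rewrite mulr_ge0 ?exprn_ge0 ?ltW// mulr_gt0// ltr_pwDl// -expr2 sqr_ge0.
have nearG x : -1 <= x <= 1 -> `|x - x0| <= eta -> e * p.[x] <= G x.
  move=> x1 xx; rewrite /G -[leLHS]addr0 lerD// mulrA ler_wpM2r ?p0//.
  by apply: H => //; exact: leq_maxl.
have G0 x : -1 <= x <= 1 -> 0 <= G x.
  move=> x1; have [xx|xx] := leP `|x - x0| eta.
    by apply: le_trans (nearG x x1 xx); rewrite mulr_ge0 ?p0// ltW.
  rewrite /G -lerBlDr sub0r; apply: lerNnormlW; rewrite !normrM s1 mul1r mulrC.
  apply: ler_pM => //.
    rewrite pE ger0_norm ?exprn_ge0 ?pbase//; apply: lerXn2r; rewrite ?nnegrE ?pbase ?(ltW r0)//.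
    have : eta ^+ 2 < `|x - x0| ^+ 2 by rewrite ltr_pXn2r ?nnegrE ?(ltW eta0).
    by rewrite real_normK ?num_real// /r; lra.
  have -> : d x * d x = `|d x| * `|d x| by rewrite -normrM ger0_norm// -expr2 sqr_ge0.
  have := sqr_ge0 (`|d x| - 1); move: (`|d x|) => D; rewrite expr2; nra.
have intG : \int[mu]_(x in `[-1, 1]) G x <= r ^+ m * C.
  rewrite /G RintD// (RintZ _ cdp) legendre_residual_poly// mulr0 add0r (RintZ _ ch) (RintZ _ c1d2).
  rewrite (RintD (@contC 1) cd2).
  rewrite ler_pM2l ?exprn_gt0// /C mulrDr lerD//; last first.
    by rewrite ler_pM2l//; apply: legendre_bessel.
  rewrite Rintegral_cst//= lebesgue_measure_itv/= lte_fin lt11 -EFinD/=; lra.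
have intJ : e * r' ^+ m * eta <= \int[mu]_(x in `[-1, 1]) G x.
  have J x : `|x - x0| <= eta / 2 -> -1 <= x <= 1 /\ e * r' ^+ m <= G x.
    move=> xx; have xx' : `|x - x0| <= eta by lra.
    have x1 : -1 <= x <= 1 by move: xx'; rewrite ler_distl; lra.
    split=> //; apply: le_trans (nearG x x1 xx'); rewrite ler_pM2l// pE.
    apply: lerXn2r; rewrite ?nnegrE ?pbase ?(ltW r'0)//.
    have : `|x - x0| ^+ 2 <= (eta / 2) ^+ 2 by apply: lerXn2r; rewrite ?nnegrE ?normr_ge0// divr_ge0// ltW.
    by rewrite real_normK ?num_real// exprMn exprVn /r'; lra.
  rewrite /Rintegral -lee_fin fineK; last by apply: integrable_fin_num => //; exact: contI.
  have Jsub : `[x0 - eta / 2, x0 + eta / 2] `<=` `[(-1 : R), 1].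
    by move=> x /=; rewrite !in_itv/= -ler_distl => /J[].
  have [mG _] := integrableP _ _ _ (contI cG).
  apply: (@le_trans _ _ (\int[mu]_(x in `[(x0 - eta / 2)%R, (x0 + eta / 2)%R]) (EFin \o G) x)%E); last first.
    exact: ge0_subset_integral.
  have -> : (e * r' ^+ m * eta)%:E = (\int[mu]_(x in `[(x0 - eta / 2)%R, (x0 + eta / 2)%R]) (cst (e * r' ^+ m)%:E) x)%E.
    rewrite integral_cst//= lebesgue_measure_itv/= lte_fin ifT; last by lra.
    by rewrite -EFinD -EFinM; congr (_ * _)%:E; lra.
  apply: ge0_le_integral => //.
  - by move=> x _; rewrite lee_fin mulr_ge0 ?exprn_ge0 ?ltW.
  - exact: measurable_funS Jsub mG.
  - by move=> x; rewrite /= in_itv/= -ler_distl lee_fin => /J[].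
by have := le_lt_trans (le_trans intJ intG) hm; rewrite ltxx.
Qed.

Lemma legendre_proj_telescope u N wt (B : nat -> R) x :
  (forall n, (N <= n)%N -> `|legendre_coef u n.+1| * `|(P n.+1).[x]| * wt <= B n - B n.+1) ->
  0 <= wt -> forall M, (N <= M)%N ->
  `|wt * ((legendre_proj M u).[x] - (legendre_proj N u).[x])| <= B N - B M.
Proof.
move=> hB wt0; elim=> [|M IH].
  by rewrite leqn0 => /eqP ->; rewrite !subrr mulr0 normr0.
rewrite leq_eqVlt => /predU1P[<-|NM]; first by rewrite !subrr mulr0 normr0.
rewrite /legendre_proj big_ord_recr /= -/(legendre_proj M u) hornerD.
have := IH NM; have := hB M NM.
rewrite -[X in X * wt]normrM -hornerZ; move: (legendre_coef u M.+1 *: _) => q.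
move: (legendre_proj M u).[x] (legendre_proj N u).[x] => a b h1 h2.
rewrite (_ : wt * (a + q.[x] - b) = wt * (a - b) + q.[x] * wt); last by ring.
apply: le_trans (ler_normD _ _) _; rewrite [`|q.[x] * wt|]normrM (ger0_norm wt0); lra.
Qed.

Lemma legendre_proj_error u N (wt : R -> R) (B : nat -> R) : cont u ->
  (forall x, -1 < x < 1 -> {for x, continuous u}) ->
  (forall x, -1 < x < 1 -> {for x, continuous wt}) ->
  (forall x, -1 < x < 1 -> 0 <= wt x <= 1) ->
  (forall n, (N <= n)%N -> 0 <= B n) ->
  (forall n x, (N <= n)%N -> -1 < x < 1 ->
     `|legendre_coef u n.+1| * `|(P n.+1).[x]| * wt x <= B n - B n.+1) ->
  forall x, -1 < x < 1 -> `|wt x * (u x - (legendre_proj N u).[x])| <= B N.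
Proof.
move=> cu iu iwt wt01 B0 hB x0 x01; rewrite leNgt; apply/negP => hlt.
have /andP[wx0 _] := wt01 _ x01.
pose d x := u x - (legendre_proj N u).[x].
pose s : R := (-1) ^+ (d x0 < 0)%R.
have sd : s * d x0 = `|d x0| by rewrite /s -normrEsign.
pose f x := wt x * (s * d x).
have fx0 : B N < f x0 by rewrite /f sd -(ger0_norm wx0) -normrM.
have cf : f x @[x --> x0] --> f x0.
  apply: cvgM; first exact: iwt.
  apply: cvgM; first exact: cvg_cst.
  by apply: cvgB; [exact: iu|exact: continuous_horner].
have e0 : 0 < (f x0 - B N) / 2 by rewrite divr_gt0// subr_gt0.
have [eta eta0 heta] : exists2 eta, 0 < eta & forall x, `|x - x0| <= eta -> -1 < x < 1 /\ B N + (f x0 - B N) / 2 <= f x.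
  have /cvgrPdist_lt/(_ _ e0) hf := cf.
  have xI : x0 \in `]-1, 1[ by rewrite in_itv.
  have : \forall x \near x0, -1 < x < 1 /\ B N + (f x0 - B N) / 2 <= f x.
    near=> x; split; first by have : x \in `]-1, 1[ by near: x; exact: near_in_itvoo.
    have : `|f x0 - f x| < (f x0 - B N) / 2 by near: x.
    by rewrite ltr_distl; lra.
  move=> /nbhs_ballP[eta /= eta0 h]; exists (eta / 2); first by rewrite divr_gt0.
  move=> x xx; apply: h; rewrite /ball/= distrC (le_lt_trans xx)// ltr_pdivrMr// ltr_pMr//; lra.
have bnd y : `|y - x0| = eta -> -1 < y < 1 by move=> yy; have [] := heta y; rewrite ?yy.
have := bnd (x0 - eta); have := bnd (x0 + eta).
rewrite !(addrC x0) addrK addrK normrN (gtr0_norm eta0) => /(_ erefl)/andP[_ h1] /(_ erefl)/andP[h2 _].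
apply: (@legendre_residual_sign u N x0 eta ((f x0 - B N) / 2) s cu eta0) => //.
- by rewrite addrC ltW.
- by rewrite addrC ltW.
- by rewrite normrX normrN1 expr1n.
move=> M x NM xx; have [x1 fx] := heta x xx; have /andP[w0 w1] := wt01 _ x1.
have tel := legendre_proj_telescope (fun n Nn => hB n x Nn x1) w0 NM.
have BM := B0 _ NM.
have low : (f x0 - B N) / 2 <= wt x * (s * (u x - (legendre_proj M u).[x])).
  have : `|wt x * (s * ((legendre_proj M u).[x] - (legendre_proj N u).[x]))| <= B N - B M.
    by rewrite mulrCA normrM normrX normrN1 expr1n mul1r.
  move=> /(le_trans (ler_norm _)); move: fx; rewrite /f /d.
  move: (legendre_proj M u).[x] (legendre_proj N u).[x] (f x0) => A D y fx h.
  rewrite (_ : wt x * (s * (u x - A)) = wt x * (s * (u x - D)) - wt x * (s * (A - D))); last by ring.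
  lra.
apply: (le_trans low); rewrite ler_piMl//.
rewrite leNgt; apply/negP => neg.
have : wt x * (s * (u x - (legendre_proj M u).[x])) <= 0 by rewrite mulr_ge0_le0// ltW.
by move=> /(le_trans low); rewrite leNgt e0.
Unshelve. all: by end_near. Qed.

End legendre_projection.

Section main_bounds.
Context {R : realType}.
Implicit Types (mu theta x y U : R) (f u h v : R -> R) (k n N : nat).
Local Notation lam := (@lebesgue_measure R).
Local Notation L := (@legendre_flip R).
Local Notation TV := total_variation.

Lemma Linfty_norm_le f c : 0 <= c -> (forall x, -1 < x < 1 -> `|f x| <= c) ->
  (Linfty_norm f <= c%:E)%E.
Proof.
move=> c0 fc; rewrite /Linfty_norm unlock; case: ifPn => _; last by rewrite lee_fin.
apply/ess_supP; apply: aeW => x /=; rewrite lee_fin patchE.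
by case: ifPn => [|_]; rewrite ?normr0// inE/= in_itv/= => /fc.
Qed.

Lemma legendre_weighted_le n x : -1 < x < 1 ->
  `|(legendre R n).[x]| * (1 - x ^+ 2) `^ (1 / 4) <= Num.sqrt (2 / (pi * (n%:R + 2^-1))).
Proof.
move=> x1; have := legendre_bernstein n x1; move: (legendre R n).[x] => p h.
have n0 : 0 < n%:R + 2^-1 :> R by rewrite ltr_wpDl.
have d0 : 0 < pi * (n%:R + 2^-1) :> R by rewrite mulr_gt0// pi_gt0.
rewrite -[leLHS]ger0_norm ?mulr_ge0 ?powR_ge0// -sqrtr_sqr ler_wsqrtr// ler_pdivlMr//.
rewrite exprMn real_normK ?num_real// -(powR_mulrn 2 (powR_ge0 (1 - x ^+ 2) (1 / 4))) -powRrM.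
rewrite (_ : 1 / 4 * 2%:R = 2^-1); last by lra.
by rewrite mulrC [X in _ * X <= _]mulrC.
Qed.

Lemma caputo_left_density theta k mu u h x : -1 <= theta -> x <= 1 -> mu < k%:R ->
  ae_eq lam `[-1, 1]%classic (derive1n k u) h ->
  caputo_left theta k mu u x =
  (Gamma (k%:R - mu))^-1 * \int[lam]_(y in `[theta, x]) (h y * (x - y) `^ (k%:R - mu - 1)).
Proof.
move=> t0 x1 muk hD; rewrite /caputo_left /frac_int_left subr_eq0 gt_eqF//; congr (_ * _).
have aefilter := ae_filter_ringOfSetsType lam.
rewrite [LHS]/Rintegral [RHS]/Rintegral; apply: (congr1 fine); apply: ae_eq_integralW.
apply: filterS hD => y /= hy; rewrite in_itv/= => /andP[ty yx].
by rewrite hy ?in_itv/= ?(le_trans t0)// ?(le_trans yx)// -powRN opprB.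
Qed.

Lemma caputo_right_density theta k mu u h x : theta <= 1 -> -1 <= x -> mu < k%:R ->
  ae_eq lam `[-1, 1]%classic (derive1n k u) h ->
  caputo_right theta k mu u x = (-1) ^+ k *
  ((Gamma (k%:R - mu))^-1 * \int[lam]_(y in `[x, theta]) (h y * (y - x) `^ (k%:R - mu - 1))).
Proof.
move=> t1 x0 muk hD; rewrite /caputo_right /frac_int_right subr_eq0 gt_eqF//; congr (_ * (_ * _)).
have aefilter := ae_filter_ringOfSetsType lam.
rewrite [LHS]/Rintegral [RHS]/Rintegral; apply: (congr1 fine); apply: ae_eq_integralW.
apply: filterS hD => y /= hy; rewrite in_itv/= => /andP[xy yt].
by rewrite hy ?in_itv/= ?(le_trans x0)// ?(le_trans yt)// -powRN opprB.
Qed.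

Lemma legendre_coef_caputo k mu theta u vl vr n :
  (0 < k)%N -> AC_derivatives (-1) 1 k u -> k%:R - 1 < mu < k%:R -> -1 < theta < 1 ->
  BV_version (-1) theta (caputo_right theta k mu u) vl ->
  BV_version theta 1 (caputo_left theta k mu u) vr -> mu < n%:R ->
  `|\int[lam]_(x in `[-1, 1]) (u x * (legendre R n).[x])| <=
  legendre_max n (mu + 1) * fine (U_theta theta vl vr).
Proof.
case: k => // k _ /AC_derivatives_density[g [h [g0 acg dg [ih hE hD]]]] mu12 /andP[t0 t1].
move=> [bvl vlE] [bvr vrE] mun; have /andP[mu1 mu2] := mu12.
have aefilter := ae_filter_ringOfSetsType lam.
have mu0 : 0 < mu by apply: le_lt_trans mu1; rewrite -natr1 addrK.
have kn : (k < n)%N by rewrite -ltnS -(ltr_nat R) -[n.+1%:R]natr1; lra.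
have Hr := @right_half_bound R n k.+1 mu theta h vr mu12 mu0 mun.
have Hl := @left_half_bound R n k.+1 mu theta h vl mu12 mu0 mun.
have {}Hr : `|\int[lam]_(x in `[theta, 1]) (h x * frac_tail k.+1%:R (L n) x)| <=
    legendre_max n (mu + 1) * (fine (TV theta 1 vr) + `|lim (vr x @[x --> theta^'+])|).
  apply: Hr => //; first by rewrite t1 ltW.
  apply: filterS vrE => x /= xE x1; rewrite -xE; last by rewrite in_itv.
  by case/andP: x1 => _ x1; rewrite (caputo_left_density (ltW t0) x1 mu2 hD).
have {}Hl : `|\int[lam]_(x in `[-1, theta]) (h x * frac_tail k.+1%:R (L n) x)| <=
    legendre_max n (mu + 1) * (fine (TV (-1) theta vl) + `|lim (vl x @[x --> theta^'-])|).
  apply: Hl => //; first by rewrite t0 ltW.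
  apply: filterS vlE => x /= xE x1; rewrite -xE; last by rewrite in_itv.
  by case/andP: x1 => x0 _; rewrite (caputo_right_density (ltW t1) x0 mu2 hD).
have ihk : lam.-integrable `[-1, 1] (EFin \o (fun x => h x * frac_tail k.+1%:R (L n) x)).
  have [D hDb] := frac_tail_bounded (L n) (ler0n R k.+1).
  have ih' : lam.-integrable `[-1, 1] (EFin \o h) by apply: integrableS ih.
  have mk : measurable_fun `[(-1 : R), 1] (frac_tail k.+1%:R (L n)) by apply: measurable_funTS; exact: measurable_frac_tail.
  apply: (integrableMl _ ih' mk) => //.
  exists D; split; first exact: num_real.
  by move=> M hM x; rewrite /= in_itv/= => x1; apply: le_trans (ltW hM); exact: hDb.
rewrite (Rintegral_legendre_parts g0 acg dg ih hE kn).
have -> : \int[lam]_(x in `[-1, 1]) (h x * frac_tail k.+1%:R (L n) x) =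
    \int[lam]_(x in `[-1, theta]) (h x * frac_tail k.+1%:R (L n) x) +
    \int[lam]_(x in `[theta, 1]) (h x * frac_tail k.+1%:R (L n) x).
  rewrite -(Rintegral_itv_obnd_cbnd (r := theta)); last first.
    by apply: integrableS ihk => // t /=; rewrite !in_itv/= => /andP[/ltW/(le_trans (ltW t0)) -> ->].
  by rewrite -(Rintegral_itvB (x := theta) ihk) ?bnd_simp ?(ltW t0) ?(ltW t1)// addrC subrK.
have fl : TV (-1) theta vl \is a fin_num by apply/bounded_variationP => //; exact: ltW.
have fr : TV theta 1 vr \is a fin_num by apply/bounded_variationP => //; exact: ltW.
apply: le_trans (ler_normD _ _) _; apply: le_trans (lerD Hl Hr) _.
rewrite /U_theta.
move: (TV _ theta vl) fl (TV theta _ vr) fr (lim _) (lim _) => [A| |]// _ [B| |]// _ c d /=.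
by rewrite -mulrDr addrACA !addrA.
Qed.

Lemma legendre_coef_bv k u w n : (0 < k)%N -> AC_derivatives (-1) 1 k u ->
  BV_version (-1) 1 (derive1n k u) w -> (k < n)%N ->
  `|\int[lam]_(x in `[-1, 1]) (u x * (legendre R n).[x])| <=
  legendre_max n (k%:R + 1) * fine (TV (-1) 1 w).
Proof.
case: k => // k _ /AC_derivatives_density[g [h [g0 acg dg [ih hE hD]]]] [bw wE] kn.
have aefilter := ae_filter_ringOfSetsType lam.
rewrite (Rintegral_legendre_parts g0 acg dg ih hE (ltnW kn)).
apply: whole_bound => //.
by apply: filterS2 hD wE => x /= h1 h2 x1; rewrite -h1// h2.
Qed.

Lemma legendre_proj_Linfty u mu N U : absolutely_continuous (-1) 1 u ->
  0 < mu -> mu <= N%:R -> 0 <= U ->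
  (forall n, (N < n)%N -> `|\int[lam]_(x in `[-1, 1]) (u x * (legendre R n).[x])| <=
     legendre_max n (mu + 1) * U) ->
  (1 / 2 < mu ->
    (Linfty_norm (fun x => u x - (legendre_proj N u).[x])%R <= (uniform_bound mu N * U)%:E)%E) /\
  (Linfty_norm (fun x => (1 - x ^+ 2) `^ (1 / 4) * (u x - (legendre_proj N u).[x]))%R
   <= (weighted_bound mu N * U)%:E)%E.
Proof.
move=> acu mu0 muN U0 hU.
have cu := absolutely_continuous_within acu.
have iu x : -1 < x < 1 -> {for x, continuous u} by exact: absolutely_continuous_interior acu.
have muNn n : (N <= n)%N -> mu <= n%:R by move=> Nn; rewrite (le_trans muN)// ler_nat.
have K0 n : (N <= n)%N -> 0 < legendre_max n.+1 (mu + 1).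
  move=> /muNn mn; apply: legendre_max_gt0; first lra.
  by rewrite -natr1 ltrD2r -natr1 (le_lt_trans mn)// ltrDl.
have n0 n : 0 < n%:R + 2^-1 :> R by rewrite ltr_wpDl.
have coefE n : (N <= n)%N -> `|legendre_coef u n.+1| <= (n.+1%:R + 2^-1) * legendre_max n.+1 (mu + 1) * U.
  move=> Nn; rewrite /legendre_coef normrM (_ : (2 * n.+1%:R + 1) / 2 = n.+1%:R + 2^-1); last first.
    by move: (n.+1%:R : R) => z; field.
  by rewrite (gtr0_norm (n0 _)) -mulrA ler_pM2l//; exact: hU.
split=> [mu2|].
  apply: Linfty_norm_le; first by rewrite mulr_ge0// ltW// uniform_bound_gt0.
  move=> x x1; rewrite -[X in `|X|]mul1r.
  apply: (@legendre_proj_error R u N (fun=> 1) (fun n => uniform_bound mu n * U) cu iu) => //.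
  - by move=> y _; exact: cvg_cst.
  - by move=> y _; rewrite ler01 lexx.
  - by move=> n Nn; rewrite mulr_ge0// ltW// uniform_bound_gt0// muNn.
  move=> n y Nn y1; rewrite mulr1 -mulrBl.
  apply: le_trans (ler_wpM2r U0 (uniform_bound_step mu2 (muNn _ Nn))).
  rewrite -[leRHS]mulr1; apply: ler_pM => //; first exact: coefE.
  by apply: legendre_norm_le1; case/andP: y1 => *; rewrite !ltW.
have x2 x : -1 < x < 1 -> 0 < 1 - x ^+ 2 by move=> x1; nra.
apply: Linfty_norm_le; first by rewrite mulr_ge0// ltW// weighted_bound_gt0.
apply: (@legendre_proj_error R u N (fun x => (1 - x ^+ 2) `^ (1 / 4)) (fun n => weighted_bound mu n * U) cu iu) => //.
- move=> x /x2 x0.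
  have d : has_derivative (fun t : R => 1 - t ^+ 2) x (0 - 2%:R * x ^+ 1 * 1).
    by apply: has_derivativeD; [exact: has_derivative_cst|apply: has_derivativeN; apply: (@has_derivativeX _ id); exact: has_derivative_id].
  exact: is_derive_continuous (@has_derivative_powR _ (fun t : R => 1 - t ^+ 2) (1 / 4) x _ x0 d).
- have e : 1 `^ (1 / 4) = 1 :> R by rewrite powR1.
  move=> x /x2 x0; rewrite powR_ge0/= -[leRHS]e; apply: ge0_ler_powR; rewrite ?nnegrE ?(ltW x0)//; last by rewrite gerBl sqr_ge0.
- by move=> n Nn; rewrite mulr_ge0// ltW// weighted_bound_gt0// muNn.
move=> n y Nn y1; rewrite -mulrBl -mulrA.
apply: le_trans (ler_wpM2r U0 (weighted_bound_step mu0 (muNn _ Nn))).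
rewrite [leRHS]mulrAC; apply: ler_pM => //; [by rewrite mulr_ge0// powR_ge0|exact: coefE|exact: legendre_weighted_le].
Qed.

End main_bounds.

Theorem theorem2 (R : realType) (k : nat) (u : R -> R)
    (k_ge1 : (1 <= k)%N) (u_AC : AC_derivatives (-1) 1 k u) :
  (* (i) *)
  (forall (mu theta : R) (vl vr : R -> R),
    k%:R - 1 < mu < k%:R ->
    -1 < theta < 1 ->
    BV_version (-1) theta (caputo_right theta k mu u) vl ->
    BV_version theta 1 (caputo_left theta k mu u) vr ->
    (1 / 2 < mu -> forall N : nat, mu <= N%:R ->
      (Linfty_norm (fun x => u x - (legendre_proj N u).[x])%R
       <= (1 / (2 `^ (mu - 1) * (mu - 1 / 2) * Num.sqrt pi)
           * (Gamma ((N%:R - mu + 1) / 2) / Gamma ((N%:R + mu) / 2)))%:E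
          * U_theta theta vl vr)%E) /\
    (forall N : nat, mu <= N%:R ->
      (Linfty_norm
         (fun x => (1 - x ^+ 2) `^ (1 / 4) * (u x - (legendre_proj N u).[x]))%R
       <= (1 / (2 `^ (mu - 1) * mu * pi)
           * (Gamma ((N%:R - mu + 1) / 2) / Gamma ((N%:R + mu + 1) / 2)))%:E
          * U_theta theta vl vr)%E)) /\
  (* (ii) *)
  (forall w : R -> R,
    BV_version (-1) 1 (derive1n k u) w ->
    forall N : nat, (k <= N)%N ->
      (Linfty_norm (fun x => u x - (legendre_proj N u).[x])%R
       <= (1 / (2 `^ (k%:R - 1) * (k%:R - 1 / 2) * Num.sqrt pi)
           * (Gamma ((N%:R - k%:R + 1) / 2) / Gamma ((N%:R + k%:R) / 2)))%:E
          * total_variation (-1) 1 w)%E /\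
      (Linfty_norm
         (fun x => (1 - x ^+ 2) `^ (1 / 4) * (u x - (legendre_proj N u).[x]))%R
       <= (1 / (2 `^ (k%:R - 1) * k%:R * pi)
           * (Gamma ((N%:R - k%:R + 1) / 2) / Gamma ((N%:R + k%:R + 1) / 2)))%:E
          * total_variation (-1) 1 w)%E).
Proof.
have k0 : 0 < k%:R :> R by rewrite ltr0n.
have k1 : 1 <= k%:R :> R by rewrite ler1n.
have k2 : 1 / 2 < k%:R :> R by apply: lt_le_trans k1; lra.
have acu : absolutely_continuous (-1) 1 u by case: u_AC.
split=> [mu theta vl vr mu12 t12 hl hr|w hw N kN].
  have mu0 : 0 < mu by case/andP: mu12 => + _; apply: le_lt_trans; rewrite subr_ge0.
  have /andP[t0 t1] := t12.
  have fl : total_variation (-1) theta vl \is a fin_num by apply/bounded_variationP; [exact: ltW|case: hl].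
  have fr : total_variation theta 1 vr \is a fin_num by apply/bounded_variationP; [exact: ltW|case: hr].
  have U0 : (0 <= U_theta theta vl vr)%E.
    by rewrite /U_theta !adde_ge0// ?lee_fin//; apply: total_variation_ge0; exact: ltW.
  have UE : (fine (U_theta theta vl vr))%:E = U_theta theta vl vr.
    by apply: fineK; rewrite /U_theta !fin_numD fl fr.
  have bounds N : mu <= N%:R -> _ := fun muN =>
    legendre_proj_Linfty acu mu0 muN (fine_ge0 U0) (fun n Nn =>
      legendre_coef_caputo k_ge1 u_AC mu12 t12 hl hr (le_lt_trans muN (etrans (ltr_nat R N n) Nn))).
  by split=> [mu2 N /bounds[/(_ mu2) + _]|N /bounds[_]]; rewrite EFinM UE.
have fw : total_variation (-1) 1 w \is a fin_num.
  by apply/bounded_variationP; [lra|case: hw].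
have w0 : (0 <= total_variation (-1) 1 w)%E by apply: total_variation_ge0; lra.
have kN' : k%:R <= N%:R :> R by rewrite ler_nat.
have [b1 b2] := legendre_proj_Linfty acu k0 kN' (fine_ge0 w0) (fun n Nn =>
  legendre_coef_bv k_ge1 u_AC hw (leq_ltn_trans kN Nn)).
rewrite EFinM (fineK fw) in b2; have := b1 k2; rewrite EFinM (fineK fw) => b1'.
exact: conj b1' b2.
Qed.
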